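(* Let $\mathcal{G}$ be a compact group, $\mathfrak{R}$ a unital $C^*$-algebra (not necessarily Abelian) and $\alpha\colon\mathfrak{C}(\mathcal{G})\to\mathrm{Aut}\,\mathfrak{R}$ a fixed action of the chain group of $\mathcal{G}$. Then for every set $\mathfrak{G}$ of finite-dimensional continuous unitary representations of $\mathcal{G}$ there exists a universal unital $C^*$-algebra $\mathfrak{R}\rtimes^\alpha\mathfrak{G}$ generated by $\mathfrak{R}$ (as a unital subalgebra) and elements $\psi_{V,i}$ ($V\in\mathfrak{G}$, $1\le i\le\dim\mathcal{H}_V$) satisfying $$\sum_i\psi_{V,i}\psi_{V,i}^*=\mathbb{1},\qquad \psi_{V,i}^*\psi_{V,j}=\delta_{ij}\mathbb{1},\qquad \psi_{V,i}B=\alpha_{[D_{V,i}]}(B)\,\psi_{V,i}\quad(B\in\mathfrak{R}),$$ $$[\psi_{V,i},\psi_{W,j}]=[\psi_{V,i}^*,\psi_{W,j}]=0\quad (V\neq W,\ V,W\in\mathfrak{G});$$ thus it is generated by $\mathfrak{R}$ and the family of Cuntz-Pimsner algebras $\{\mathcal{O}_{\mathfrak{H}_V}\}_{V\in\mathfrak{G}}$, the product of elements of different algebras being twisted by the chain group action $\alpha$. Moreover the formulas $$\beta_g(\psi)=V(g)\psi\ (\psi\in\mathcal{H}_V,\ V\in\mathfrak{G}),\quad\beta_g(B)=B\ (B\in\mathfrak{R}),\qquad g\in\mathcal{G},$$ $$\delta_z(\psi_{V,i})=z(V)\psi_{V,i},\quad\delta_z(B)=B\ (B\in\mathfrak{R}),\qquad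 z\in\mathbb{T}^{\mathfrak{G}},$$ where $\mathcal{H}_V=\mathrm{span}\{\psi_{V,i}\}_i$, extend to actions of $\mathcal{G}$ and of $\mathbb{T}^{\mathfrak{G}}=\prod_{V\in\mathfrak{G}}\mathbb{T}$ by automorphisms of $\mathfrak{R}\rtimes^\alpha\mathfrak{G}$.
   Context: Chain group. $\widehat{\mathcal{G}}$ is the set of equivalence classes of continuous irreducible unitary representations of $\mathcal{G}$. For $D_1,\dots,D_n\in\widehat{\mathcal{G}}$, $D_1\times\dots\times D_n\subset\widehat{\mathcal{G}}$ is the set of classes of irreducible subrepresentations of the tensor product of representations of classes $D_1,\dots,D_n$. Write $D\approx D'$ if there are $D_1,\dots,D_n$ with $D,D'\in D_1\times\dots\times D_n$; this is an equivalence relation, with classes $[D]$. The chain group is $\mathfrak{C}(\mathcal{G})=\widehat{\mathcal{G}}/\!\approx$ with product $[D_0]\cdot[D_1]:=[D]$ for any $D\in D_0\times D_1$; it is an Abelian group. An action of it on $\mathfrak{R}$ is a group homomorphism $[D]\mapsto\alpha_{[D]}\in\mathrm{Aut}(\mathfrak{R})$. For each $V\in\mathfrak{G}$ acting on $\mathcal{H}_V$, decompose $\mathcal{H}_V$ orthogonally into irreducible subspaces and fix an orthonormal basis $\{\psi_{V,i}\}_i$ such that each $\psi_{V,i}$ lies in one of these subspaces, whose class is denoted $D_{V,i}\in\widehat{\mathcal{G}}$. The $\mathfrak{R}$-bimodule $\mathfrak{H}_V=\mathcal{H}_V\otimes\mathfrak{R}$ is the free right Hilbert $\mathfrak{R}$-module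 with orthonormal basis $\{\psi_{V,i}\}_i$ and left action $B\psi_{V,i}=\psi_{V,i}\alpha_{[D_{V,i}]}^{-1}(B)$; its Cuntz-Pimsner algebra $\mathcal{O}_{\mathfrak{H}_V}$ is the universal unital $C^*$-algebra generated by $\mathfrak{R}$ and $\{\psi_{V,i}\}_i$ subject to the first three relations of the claim for this $V$ alone. ''Universal'' means: for every unital $C^*$-algebra $\mathfrak{B}$ with a unital $*$-homomorphism $\mathfrak{R}\to\mathfrak{B}$ and elements of $\mathfrak{B}$ satisfying the same relations, there is a unique $*$-homomorphism $\mathfrak{R}\rtimes^\alpha\mathfrak{G}\to\mathfrak{B}$ compatible with these data. *)

(* Defs.v *)
(* The complex numbers are [R[i]], for [R : realType]. *)
From HB Require Import structures.
From mathcomp Require Import all_boot all_order all_algebra.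
From mathcomp Require Import complex.
From mathcomp Require Import all_classical all_reals all_analysis.
Import numFieldNormedType.Exports.
Import Order.TTheory GRing.Theory Num.Theory.

Set Implicit Arguments.
Unset Strict Implicit.
Unset Printing Implicit Defensive.

Local Open Scope classical_set_scope.
Local Open Scope ring_scope.

HB.mixin Record isTopologicalGroup G & Group G & Topological G := {
  mulg_continuous : continuous (fun xy : G * G => (xy.1 * xy.2)%g);
  invg_continuous : continuous (fun x : G => (x^-1)%g)
}.

#[short(type="topologicalGroupType")]
HB.structure Definition TopologicalGroup :=
  {G of isTopologicalGroup G & Group G & Topological G}.

(* The inner product is linear in its first argument. *)
HB.mixin Record isHilbert (R : realType) H & CompleteNormedModule R[i] H := {
  hdot : {dot H for @Num.conj R[i]};
  hdot_norm : forall x : H, hdot x x = `|x| ^+ 2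
}.

#[short(type="hilbertType")]
HB.structure Definition Hilbert (R : realType) :=
  {H of isHilbert R H & CompleteNormedModule R[i] H}.

(* The norm takes its values in [R[i]], where [0 <= z] implies that [z] is
   real.  The ring operations are fields of the mixin because the MathComp
   hierarchy has no join of normed modules and rings; the instances below turn
   every C*-algebra into an [algType].  As everywhere in MathComp, [1 != 0]. *)
HB.mixin Record isCStarAlgebra (R : realType) A
    & CompleteNormedModule R[i] A := {
  cstar_one : A;
  cstar_mul : A -> A -> A;
  cstar_mulA : associative cstar_mul;
  cstar_mul1 : left_id cstar_one cstar_mul;
  cstar_mulr1 : right_id cstar_one cstar_mul;
  cstar_mulDl : left_distributive cstar_mul +%R;
  cstar_mulDr : right_distributive cstar_mul +%R;
  cstar_one_neq0 : cstar_one != 0;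
  cstar_scaleAl : forall (a : R[i]) (x y : A),
    a *: cstar_mul x y = cstar_mul (a *: x) y;
  cstar_scaleAr : forall (a : R[i]) (x y : A),
    a *: cstar_mul x y = cstar_mul x (a *: y);
  adj : A -> A;
  adjK : involutive adj;
  adjD : {morph adj : x y / x + y};
  adjZ : forall (a : R[i]) (x : A), adj (a *: x) = Num.conj a *: adj x;
  adjM : forall x y : A, adj (cstar_mul x y) = cstar_mul (adj y) (adj x);
  cstar_normM : forall x y : A, `|cstar_mul x y| <= `|x| * `|y|;
  cstar_norm : forall x : A, `|cstar_mul (adj x) x| = `|x| ^+ 2
}.

#[short(type="cstarAlgType")]
HB.structure Definition CStarAlgebra (R : realType) :=
  {A of isCStarAlgebra R A & CompleteNormedModule R[i] A}.

HB.instance Definition _ (R : realType) (A : cstarAlgType R) :=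
  GRing.Zmodule_isNzRing.Build (CStarAlgebra.sort A) cstar_mulA cstar_mul1
    cstar_mulr1 cstar_mulDl cstar_mulDr cstar_one_neq0.
HB.instance Definition _ (R : realType) (A : cstarAlgType R) :=
  GRing.Lmodule_isLalgebra.Build R[i] (CStarAlgebra.sort A) cstar_scaleAl.
HB.instance Definition _ (R : realType) (A : cstarAlgType R) :=
  GRing.Lalgebra_isAlgebra.Build R[i] (CStarAlgebra.sort A) cstar_scaleAr.

Section CStar.
Variable R : realType.
Implicit Types A B : cstarAlgType R.

Record starHom A B := StarHom {
  starHom_fun :> {lrmorphism A -> B};
  starHom_adj : forall x : A, starHom_fun (adj x) = adj (starHom_fun x)
}.

Record starAut A := StarAut {
  starAut_hom :> starHom A A;
  starAut_bij : bijective starAut_hom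
}.

Definition is_action (T : groupType) A (b : T -> starAut A) : Prop :=
  (forall x, b 1%g x = x) /\ (forall s t x, b (s * t)%g x = b s (b t x)).

Definition cstar_subalgebra A (S : set A) : Prop :=
  [/\ closed S, S 1,
      forall (a : R[i]) x y, S x -> S y -> S (a *: x + y),
      forall x y, S x -> S y -> S (x * y)
    & forall x, S x -> S (adj x)].

Definition cstar_generated A (S : set A) : Prop :=
  smallest (@cstar_subalgebra A) S = [set: A].

(* [U] is the universal unital C*-algebra generated by the image of [A] and
   the elements [psi j], [j : J], subject to the relations [rel].  A
   *-homomorphism compatible with unital maps on [A] is automatically unital,
   so it is enough to consider unital ones. *)
Definition universal_cstar A (J : Type)
    (rel : forall B : cstarAlgType R, starHom A B -> (J -> B) -> Prop)
    (U : cstarAlgType R) (iota : starHom A U) (psi : J -> U) : Prop :=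
  [/\ rel U iota psi,
      cstar_generated (range iota `|` range psi)
    & forall (B : cstarAlgType R) (rho : starHom A B) (phi : J -> B),
        rel B rho phi ->
        let compatible (theta : starHom U B) :=
          (forall a, theta (iota a) = rho a) /\
          (forall j, theta (psi j) = phi j) in
        exists2 theta, compatible theta &
          forall theta', compatible theta' -> theta' =1 theta].

End CStar.

Section Torus.
Variables (R : realType) (I : Type).

Definition torus := {z : I -> R[i] | forall i, `|z i| = 1}.
Definition torus_fun (z : torus) : I -> R[i] := sval z.
Coercion torus_fun : torus >-> Funclass.

HB.instance Definition _ := gen_eqMixin torus.
HB.instance Definition _ := gen_choiceMixin torus.

Lemma torus_norm (z : torus) i : `|z i| = 1. Proof. exact: (svalP z). Qed.

Lemma torusP (z w : torus) : z =1 w -> z = w.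
Proof.
case: z w => [z hz] [w hw] zw; have {}zw : z = w by apply: funext.
by case: _ / zw hw => hw; congr exist; exact: Prop_irrelevance.
Qed.

Lemma torus_one_subproof (i : I) : `|1 : R[i]| = 1. Proof. exact: normr1. Qed.
Definition torus_one : torus := exist _ (fun=> 1) torus_one_subproof.

Lemma torus_mul_subproof (z w : torus) i : `|z i * w i| = 1.
Proof. by rewrite normrM !torus_norm mulr1. Qed.
Definition torus_mul (z w : torus) : torus :=
  exist _ (fun i => z i * w i) (torus_mul_subproof z w).

Lemma torus_inv_subproof (z : torus) i : `|(z i)^-1| = 1.
Proof. by rewrite normfV torus_norm invr1. Qed.
Definition torus_inv (z : torus) : torus :=
  exist _ (fun i => (z i)^-1) (torus_inv_subproof z).

Lemma torus_neq0 (z : torus) i : z i != 0.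
Proof. by rewrite -normr_eq0 torus_norm oner_eq0. Qed.

Lemma torus_mulA : associative torus_mul.
Proof. by move=> x y z; apply: torusP => i; exact: mulrA. Qed.
Lemma torus_mul1 : left_id torus_one torus_mul.
Proof. by move=> x; apply: torusP => i; exact: mul1r. Qed.
Lemma torus_mulr1 : right_id torus_one torus_mul.
Proof. by move=> x; apply: torusP => i; exact: mulr1. Qed.
Lemma torus_mulV : left_inverse torus_one torus_inv torus_mul.
Proof. by move=> x; apply: torusP => i; apply: mulVf; exact: torus_neq0. Qed.
Lemma torus_mulrV : right_inverse torus_one torus_inv torus_mul.
Proof. by move=> x; apply: torusP => i; apply: mulfV; exact: torus_neq0. Qed.

HB.instance Definition _ := isGroup.Build torus
  torus_mulA torus_mul1 torus_mulr1 torus_mulV torus_mulrV.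

End Torus.

Section Representations.
Variables (R : realType) (G : topologicalGroupType).

Record urep := URep {
  urep_space :> hilbertType R;
  urep_act : G -> {linear urep_space -> urep_space};
  urep_act1 : forall x, urep_act 1%g x = x;
  urep_actM : forall g h x, urep_act (g * h)%g x = urep_act g (urep_act h x);
  urep_dot : forall g x y, hdot (urep_act g x) (urep_act g y) = hdot x y;
  urep_continuous : forall x, continuous (fun g => urep_act g x)
}.

Implicit Types V W : urep.

Definition nonzero V : Prop := exists x : V, x != 0.

Definition finite_dimensional V : Prop :=
  exists n (v : 'I_n -> V), forall x, exists c : 'I_n -> R[i],
    x = \sum_i c i *: v i.

Definition closed_subspace (H : hilbertType R) (E : set H) : Prop :=
  [/\ closed E, E 0 &
      forall (a : R[i]) x y, E x -> E y -> E (a *: x + y)].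

Definition subrepresentation V (E : set V) : Prop :=
  closed_subspace E /\ forall g x, E x -> E (urep_act V g x).

Definition irreducible_subspace V (E : set V) : Prop :=
  [/\ subrepresentation E, E <> [set 0] &
      forall F : set V, subrepresentation F -> F `<=` E ->
        F = [set 0] \/ F = E].

Definition irreducible V : Prop := irreducible_subspace [set: V].

Definition intertwiner W V (T : {linear W -> V}) : Prop :=
  (forall x y, hdot (T x) (T y) = hdot x y) /\
  (forall g x, T (urep_act W g x) = urep_act V g (T x)).

Definition equivalent_to W V (E : set V) : Prop :=
  exists2 T : {linear W -> V}, intertwiner T & range T = E.

Definition urep_class V : urep -> Prop := fun W => equivalent_to W [set: V].

(* The dual [G^], as a type of equivalence classes.  Finite-dimensionality of
   irreducible representations (Peter-Weyl, for compact [G]) is not built in.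
   Classes of representations are plain predicates: [urep] lives in a universe
   too large to be an argument of [set]. *)
Definition dual :=
  {D : urep -> Prop | exists2 V, irreducible V & D = urep_class V}.
Definition dual_pred (D : dual) : urep -> Prop := sval D.
Coercion dual_pred : dual >-> Funclass.

Definition of_class V (E : set V) (D : dual) : Prop :=
  exists2 W, D W & equivalent_to W E.

(* [T] is the Hilbert space tensor product of the [V i], with [tau] the map
   [x |-> x_1 (x) ... (x) x_n]. *)
Definition is_tensor n (V : 'I_n -> urep) (T : urep) : Prop :=
  exists tau : (forall i, V i) -> T,
  [/\ forall x i (a : R[i]) (u v : V i),
        tau (dfwith x i (a *: u + v)) =
        a *: tau (dfwith x i u) + tau (dfwith x i v),
      forall x y, hdot (tau x) (tau y) = \prod_i hdot (x i) (y i),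
      forall g x, tau (fun i => urep_act (V i) g (x i)) = urep_act T g (tau x)
    & smallest (@closed_subspace T) (range tau) = [set: T]].

(* [D_1 x ... x D_n] *)
Definition dual_prod n (D : 'I_n -> dual) (D' : dual) : Prop :=
  exists (V : 'I_n -> urep) (T : urep) (E : set T),
    [/\ forall i, D i (V i), is_tensor V T,
        irreducible_subspace E & of_class E D'].

Definition dual_pair (D0 D1 : dual) : 'I_2 -> dual :=
  fun i => if i == ord0 then D0 else D1.

Definition chain_equiv (D D' : dual) : Prop :=
  exists n (Ds : 'I_n.+1 -> dual), dual_prod Ds D /\ dual_prod Ds D'.

Definition chain_class (D : dual) : dual -> Prop := chain_equiv D.

Definition chain_group :=
  {c : dual -> Prop | exists D, c = chain_class D}.

Definition chain_of (D : dual) : chain_group :=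
  exist _ (chain_class D) (ex_intro _ D erefl).

(* Graph of the product: [c0 * c1 = c] when [D0 x D1] contains [D] for some
   representatives [D0], [D1] and [D] of [c0], [c1] and [c]. *)
Definition chain_mul (c0 c1 c : chain_group) : Prop :=
  exists D0 D1 D, [/\ c0 = chain_of D0, c1 = chain_of D1, c = chain_of D
    & dual_prod (dual_pair D0 D1) D].

(* A group homomorphism from the chain group to [Aut A]; preservation of units
   and inverses follows from multiplicativity. *)
Definition chain_action (A : cstarAlgType R) (alpha : chain_group -> starAut A)
    : Prop :=
  forall c0 c1 c, chain_mul c0 c1 c ->
    forall a, alpha c a = alpha c0 (alpha c1 a).

(* An orthogonal decomposition of [V] into irreducible subspaces, and an
   orthonormal basis of [V] each of whose vectors [ab_vec i] lies in one of
   them, [ab_sub (ab_pos i)], of class [ab_class i]. *)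
Record adapted_basis V := AdaptedBasis {
  ab_num : nat;
  ab_sub : 'I_ab_num -> set V;
  ab_sub_irr : forall k, irreducible_subspace (ab_sub k);
  ab_sub_orth : forall k l x y, k != l -> ab_sub k x -> ab_sub l y ->
    hdot x y = 0;
  ab_sub_total : forall x, exists2 y : 'I_ab_num -> V,
    (forall k, ab_sub k (y k)) & x = \sum_k y k;
  ab_dim : nat;
  ab_vec : 'I_ab_dim -> V;
  ab_vec_orthonormal : forall i j, hdot (ab_vec i) (ab_vec j) = (i == j)%:R;
  ab_vec_total : forall x, x = \sum_i hdot x (ab_vec i) *: ab_vec i;
  ab_pos : 'I_ab_dim -> 'I_ab_num;
  ab_vec_sub : forall i, ab_sub (ab_pos i) (ab_vec i);
  ab_class : 'I_ab_dim -> dual;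
  ab_classP : forall i, of_class (ab_sub (ab_pos i)) (ab_class i)
}.

Arguments ab_sub {V} _ _.
Arguments ab_vec {V} _ _.
Arguments ab_pos {V} _ _.
Arguments ab_class {V} _ _.

(* The linear map from [V] onto the span of the [psi i] that sends [ab_vec i]
   to [psi i]. *)
Definition embed V (b : adapted_basis V) (B : cstarAlgType R)
    (psi : 'I_(ab_dim b) -> B) (x : V) : B :=
  \sum_i hdot x (ab_vec b i) *: psi i.

End Representations.

Arguments ab_sub {R G V} _ _.
Arguments ab_vec {R G V} _ _.
Arguments ab_pos {R G V} _ _.
Arguments ab_class {R G V} _ _.

Section Relations.
Variables (R : realType) (G : topologicalGroupType) (A : cstarAlgType R).
Variable alpha : chain_group R G -> starAut A.

Definition cuntz_relations n (D : 'I_n -> dual R G) (B : cstarAlgType R)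
    (rho : starHom A B) (phi : 'I_n -> B) : Prop :=
  [/\ \sum_i phi i * adj (phi i) = 1,
      forall i j, adj (phi i) * phi j = (i == j)%:R
    & forall i a, phi i * rho a = rho (alpha (chain_of (D i)) a) * phi i].

Definition is_cuntz_pimsner (W : urep R G) (c : adapted_basis W) :
    forall O : cstarAlgType R, starHom A O -> ('I_(ab_dim c) -> O) -> Prop :=
  universal_cstar (cuntz_relations (ab_class c)).

Variables (I : Type) (V : I -> urep R G).
Variable b : forall v, adapted_basis (V v).

(* The index set of the generators [psi_{V,i}]. *)
Definition gen := {v : I & 'I_(ab_dim (b v))}.

Definition crossed_relations (B : cstarAlgType R) (rho : starHom A B)
    (phi : gen -> B) : Prop :=
  (forall v, cuntz_relations (ab_class (b v)) rho
     (fun i => phi (Tagged _ i))) /\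
  (forall v w (i : 'I_(ab_dim (b v))) (j : 'I_(ab_dim (b w))), v <> w ->
     GRing.comm (phi (Tagged _ i)) (phi (Tagged _ j)) /\
     GRing.comm (adj (phi (Tagged _ i))) (phi (Tagged _ j))).

Definition is_crossed_product :
    forall U : cstarAlgType R, starHom A U -> (gen -> U) -> Prop :=
  universal_cstar crossed_relations.

End Relations.

(* Main.v *)
(** The universal algebra is the completion of the *-terms in [A] and the
    generators under the supremum of [|t|] over all representations of the
    relations.  That this is nontrivial, that [A] embeds and that the
    Cuntz-Pimsner algebras embed all come from one induction of
    representations.  Let [B] carry a representation of the relations of a set
    [K] of at most one representation [V] (so [B = A] for [K] empty, and
    [B = O_V] for [K = {V}]).  On the Hilbert [B]-module [l^2(X, B)] let [X] be
    the set of pairs of a family of infinite words, one for each [W], and an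
    endomorphism [d] of [A] commuting with the automorphisms of [K]; let [a]
    act at [(y, d)] by [d(a)], let the generators of [K] act by multiplication
    in [B], and those of [W] outside [K] by prepending a letter to the word of
    [W] and composing [d] with the inverse automorphism.  At [d = id] one
    recovers [B].

    The generators commute because the automorphisms do: for subspaces of
    finite-dimensional representations the tensor product exists, contains an
    irreducible subspace, and serves for both orders of the factors.

    The operators on [l^2(X, B)] form a C*-algebra because of the
    Cauchy-Schwarz inequality [|<f, g>|^2 <= |<f, f>| |<g, g>|], that is,
    because [c*c >= 0] in [B].  This is proved without spectral theory, from
    the square root of [1 - a], [|a| <= 1]. *)
From HB Require Import structures.
From mathcomp Require Import all_boot all_order all_algebra.
From mathcomp Require Import complex.
From mathcomp Require Import all_classical all_reals all_analysis.
From mathcomp Require Import ring lra.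
Require Import Defs.
Import numFieldNormedType.Exports.
Import Order.TTheory GRing.Theory Num.Theory.
Set Implicit Arguments.
Unset Strict Implicit.
Unset Printing Implicit Defensive.
Local Open Scope classical_set_scope.
Local Open Scope ring_scope.

(** * Real-valued norms and Banach spaces *)

Section RealNorm.
Variable R : realType.
Local Notation C := R[i].

(** The supremum over representations in arbitrary C*-algebras is a supremum of a set of real
    numbers, so no question of size arises. It is finite because every generator is an isometry, and
    meaningful only if some representation exists; the model is needed for that as well as for
    injectivity. The words of the model are infinite because such a word begins with exactly one
    letter: the ranges of the prepending operators then add up to the whole module, whereas finite
    words would leave the empty word over. Words alone do not record the twist, so each point
    carries its own endomorphism [d]. The set [K] is kept to one element because nothing is known
    about products in [B] of generators of two representations. The module need not be complete: an
    operator is stored together with its adjoint, so finitely supported functions suffice, and one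
    and the same completion of a C*-seminorm yields the model and the universal algebra. Injectivity
    is always obtained as a lower bound of norms, on constants or on terms, and then extended by
    density. *)

Definition nrm (V : normedZmodType C) (x : V) : R := complex.Re `|x|.

Section NormedZmod.
Variable V : normedZmodType C.
Implicit Types x y z : V.

Lemma nrmE x : `|x| = (nrm x)%:C%C.
Proof. by rewrite RRe_real // normr_real. Qed.

Lemma nrm_ge0 x : 0 <= nrm x.
Proof. by rewrite -ler0c -nrmE. Qed.

Lemma nrm0 : nrm (0 : V) = 0.
Proof. by rewrite /nrm normr0. Qed.

Lemma nrm0_eq0 x : nrm x = 0 -> x = 0.
Proof. by move=> x0; apply/normr0_eq0; rewrite nrmE x0. Qed.

Lemma nrmN x : nrm (- x) = nrm x.
Proof. by rewrite /nrm normrN. Qed.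

Lemma nrmBC x y : nrm (x - y) = nrm (y - x).
Proof. by rewrite -nrmN opprB. Qed.

Lemma nrmD x y : nrm (x + y) <= nrm x + nrm y.
Proof. by rewrite -lecR rmorphD /= -!nrmE ler_normD. Qed.

Lemma nrmB x y : nrm (x - y) <= nrm x + nrm y.
Proof. by rewrite -(nrmN y) nrmD. Qed.

Lemma nrm_triangle y x z : nrm (x - z) <= nrm (x - y) + nrm (y - z).
Proof. by rewrite -[x - z](subrKA y) nrmD. Qed.

Lemma nrm_sub x y : nrm x <= nrm y + nrm (x - y).
Proof. by rewrite -{1}[x](subrK y) addrC nrmD. Qed.

End NormedZmod.

Lemma nrm_scalar_real (r : R) : nrm (r%:C%C : C) = `|r|.
Proof. by rewrite /nrm normc_def /= expr0n /= addr0 sqrtr_sqr. Qed.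

Lemma nrm_conj (c : C) : nrm (Num.conj c) = nrm c.
Proof. by rewrite /nrm norm_conjC. Qed.

Lemma nrmZ (V : normedModType C) (c : C) (x : V) : nrm (c *: x) = nrm c * nrm x.
Proof. by apply: complexI; rewrite rmorphM /= -!nrmE normrZ. Qed.

Lemma nrmZr (V : normedModType C) (r : R) (x : V) :
  nrm (r%:C%C *: x) = `|r| * nrm x.
Proof. by rewrite nrmZ nrm_scalar_real. Qed.

Definition ncauchy (V : normedZmodType C) (u : nat -> V) :=
  forall e : R, 0 < e -> exists N, forall m n, (N <= m)%N -> (N <= n)%N ->
    nrm (u m - u n) < e.

Definition ncvg (V : normedZmodType C) (u : nat -> V) (x : V) :=
  forall e : R, 0 < e -> exists N, forall n, (N <= n)%N -> nrm (u n - x) < e.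

Lemma ncvg_cst (V : normedZmodType C) (x : V) : ncvg (fun=> x) x.
Proof. by move=> e e0; exists 0%N => n _; rewrite subrr nrm0. Qed.

Lemma ncvg_le (V W : normedZmodType C) (u : nat -> V) (x : V) (v : nat -> W)
    (y : W) (K : R) : 
  ncvg u x -> (forall n, nrm (v n - y) <= K * nrm (u n - x)) -> ncvg v y.
Proof.
move=> ux uv e e0; have K0 : 0 < `|K| + 1 by rewrite ltr_wpDl.
have [N HN] := ux _ (divr_gt0 e0 K0); exists N => n /HN; rewrite ltr_pdivlMr //.
apply: le_lt_trans; apply: le_trans (uv n) _; rewrite mulrC ler_wpM2l ?nrm_ge0 //.
by rewrite (le_trans (ler_norm _)) // lerDl.
Qed.

Lemma ncvgD (V : normedZmodType C) (u v : nat -> V) x y :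
  ncvg u x -> ncvg v y -> ncvg (fun n => u n + v n) (x + y).
Proof.
move=> ux vy e e0; have e2 : 0 < e / 2 by rewrite divr_gt0.
have [N HN] := ux _ e2; have [M HM] := vy _ e2.
exists (maxn N M) => n; rewrite geq_max => /andP[/HN h1 /HM h2].
by rewrite opprD addrACA (le_lt_trans (nrmD _ _)) // (splitr e) ltrD.
Qed.

Lemma ncvgZ (V : normedModType C) (c : C) (u : nat -> V) x :
  ncvg u x -> ncvg (fun n => c *: u n) (c *: x).
Proof.
by move=> ux; apply: (ncvg_le (K := nrm c) ux) => n; rewrite -scalerBr nrmZ.
Qed.

Lemma ncvg_unique (V : normedZmodType C) (u : nat -> V) x y :
  ncvg u x -> ncvg u y -> x = y.
Proof.
move=> ux uy; apply/subr0_eq/nrm0_eq0/eqP; rewrite eq_le nrm_ge0 andbT.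
apply/ler_addgt0Pr => e e0; rewrite add0r.
have e2 : 0 < e / 2 by rewrite divr_gt0.
have [N HN] := ux _ e2; have [M HM] := uy _ e2.
have := HN (maxn N M) (leq_maxl _ _); have := HM (maxn N M) (leq_maxr _ _).
have := nrm_triangle (u (maxn N M)) x y; rewrite (nrmBC x (u _)); lra.
Qed.

Lemma ncvg_nrm_le (V : normedZmodType C) (u : nat -> V) x (K : R) :
  ncvg u x -> (forall n, nrm (u n) <= K) -> nrm x <= K.
Proof.
move=> ux uK; apply/ler_addgt0Pr => e e0.
have [N /(_ N (leqnn _)) HN] := ux _ e0.
have := nrm_sub x (u N); have := uK N; rewrite nrmBC; lra.
Qed.

Lemma ball_nrm (V : normedModType C) (x y : V) (e : R) :
  ball x e%:C%C y <-> nrm (x - y) < e.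
Proof. by rewrite -ball_normE /= nrmE ltcR. Qed.

Lemma nbhs_nrm (V : normedModType C) (x : V) (S : set V) :
  nbhs x S <-> exists2 e : R, 0 < e & forall y, nrm (x - y) < e -> S y.
Proof.
split=> [/nbhs_ballP[e /= e0 xS]|[e e0 xS]].
  have eE : e = (complex.Re e)%:C%C by rewrite RRe_real // gtr0_real.
  exists (complex.Re e); first by rewrite -ltcR -eE.
  by move=> y xy; apply: xS; rewrite eE; apply/ball_nrm.
apply/nbhs_ballP; exists e%:C%C; first by rewrite /= ltcR.
by move=> y /ball_nrm; exact: xS.
Qed.

Lemma closed_nrm (V : normedModType C) (S : set V) :
  closed S <-> forall x, (forall e : R, 0 < e -> exists2 y, S y & nrm (x - y) < e) ->
    S x.
Proof.
split=> clS x Sx; apply: clS.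
  move=> T /nbhs_nrm[e e0 xT]; have [y Sy xy] := Sx e e0.
  by exists y; split=> //; exact: xT.
move=> e e0; have [|y [Sy xy]] := Sx (fun y => nrm (x - y) < e).
  by apply/nbhs_nrm; exists e.
by exists y.
Qed.

Lemma closed_ncvg (V : normedModType C) (S : set V) u x :
  closed S -> (forall n, S (u n)) -> ncvg u x -> S x.
Proof.
move=> /closed_nrm clS Su ux; apply: clS => e /ux[N /(_ N (leqnn _)) HN].
by exists (u N); rewrite // nrmBC.
Qed.

Lemma ncauchy_cvg (V : completeNormedModType C) (u : nat -> V) :
  ncauchy u -> exists x, ncvg u x.
Proof.
move=> cu; have /cauchy_cvg/cvg_ex[x ux] : cauchy (u @ \oo).
  apply/cauchyP => e e0; have eE : e = (complex.Re e)%:C%C.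
    by rewrite RRe_real // gtr0_real.
  have [|N HN] := cu (complex.Re e); first by rewrite -ltcR -eE.
  exists (u N); exists N => // n Nn; rewrite eE; apply/ball_nrm; exact: HN.
exists x => e e0; have /ux[N _ HN] : nbhs x [set y | nrm (x - y) < e].
  by apply/nbhs_nrm; exists e.
by exists N => n Nn; rewrite nrmBC; exact: HN.
Qed.

Lemma exists_inv_lt (e : R) : 0 < e -> exists N, forall n, (N <= n)%N ->
  n.+1%:R^-1 < e.
Proof.
move=> e0; have [N _ HN] := near_infty_natSinv_lt (PosNum e0).
by exists N => n /HN.
Qed.

End RealNorm.

HB.factory Record Lmodule_isBanach (R : realType) M & GRing.Lmodule R[i] M := {
  bnorm : M -> R;
  bnormD : forall x y, bnorm (x + y) <= bnorm x + bnorm y;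
  bnormZ : forall (c : R[i]) (x : M), bnorm (c *: x) = nrm c * bnorm x;
  bnorm0_eq0 : forall x, bnorm x = 0 -> x = 0;
  bnorm_complete : forall u : nat -> M,
    (forall e : R, 0 < e -> exists N, forall m n, (N <= m)%N -> (N <= n)%N ->
      bnorm (u m - u n) < e) ->
    exists x, forall e : R, 0 < e -> exists N, forall n, (N <= n)%N ->
      bnorm (u n - x) < e
}.

HB.builders Context R M & Lmodule_isBanach R M.

Let norm (x : M) : R[i] := (bnorm x)%:C%C.

Let normD x y : norm (x + y) <= norm x + norm y.
Proof. by rewrite /norm -rmorphD /= lecR bnormD. Qed.

Let normZ (l : R[i]) (x : M) : norm (l *: x) = `|l| * norm x.
Proof. by rewrite /norm bnormZ rmorphM /= -nrmE. Qed.

Let norm0 x : norm x = 0 -> x = 0.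
Proof. by case=> /bnorm0_eq0. Qed.

HB.instance Definition _ :=
  @Lmodule_isNormed.Build R[i] M norm normD normZ norm0.

Let nrm_bnorm (x : M) : nrm x = bnorm x. Proof. by []. Qed.

(** Filters reduce to sequences: [F] contains balls of radius [1/(n+1)], any two of them meet, so
    their centres [u n] form a Cauchy sequence, and [F] converges to its limit. *)
Let complete (F : set_system M) : ProperFilter F -> cauchy F -> cvg F.
Proof.
move=> FF /cauchyP cF.
have /choice[u Fu] n : exists x : M, F (ball x (n.+1%:R^-1 : R)%:C%C).
  by apply: cF; rewrite ltcR invr_gt0.
have close m n : nrm (u m - u n) < m.+1%:R^-1 + n.+1%:R^-1.
  have [x [/ball_nrm um /ball_nrm un]] := filter_ex (filterI (Fu m) (Fu n)).
  by rewrite (le_lt_trans (nrm_triangle x _ _)) // ltrD // nrmBC.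
have [e e0|x ux] := @bnorm_complete u.
  have e2 : 0 < e / 2 by rewrite divr_gt0.
  have [N HN] := exists_inv_lt e2; exists N => m n /HN hm /HN hn.
  by rewrite -nrm_bnorm (lt_trans (close m n)) // (splitr e) ltrD.
apply/cvg_ex; exists x => S /nbhs_nrm[e e0 xS].
have e2 : 0 < e / 2 by rewrite divr_gt0.
have [N HN] := ux _ e2; have [N' HN'] := exists_inv_lt e2.
pose n := maxn N N'; have hn := HN n (leq_maxl _ _).
have hn' := HN' n (leq_maxr _ _).
apply: filterS (Fu n) => y /ball_nrm uy; apply: xS.
rewrite (le_lt_trans (nrm_triangle (u n) _ _)) // (splitr e) ltrD //.
  by rewrite nrmBC nrm_bnorm.
exact: lt_trans uy hn'.
Qed.

HB.instance Definition _ := Uniform_isComplete.Build M complete.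

HB.end.

(** * Order and norm in C*-algebras *)

Section CStarOrder.
Variables (R : realType) (A : cstarAlgType R).
Local Notation C := R[i].
Implicit Types (x y z h k l s : A) (r t : R).
Local Open Scope complex_scope.

Lemma nrmM x y : nrm (x * y) <= nrm x * nrm y.
Proof. by rewrite -lecR rmorphM /= -!nrmE; exact: cstar_normM. Qed.

Lemma nrm_star x : nrm (adj x * x) = nrm x ^+ 2.
Proof. by apply: complexI; rewrite rmorphXn /= -!nrmE; exact: cstar_norm. Qed.

Lemma adj_mul x y : adj (x * y) = adj y * adj x. Proof. exact: adjM. Qed.

Lemma adj0 : adj (0 : A) = 0.
Proof. by rewrite -[in LHS](scale0r (0 : A)) adjZ conjC0 scale0r. Qed.

Lemma adjN x : adj (- x) = - adj x.
Proof. by rewrite -scaleN1r adjZ rmorphN1 scaleN1r. Qed.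

Lemma adjB x y : adj (x - y) = adj x - adj y.
Proof. by rewrite adjD adjN. Qed.

Lemma adj1 : adj (1 : A) = 1.
Proof. by rewrite -[LHS]mulr1 -{2}(adjK (1 : A)) -adj_mul mulr1 adjK. Qed.

Lemma adj_sum (I : Type) (s : seq I) (F : I -> A) :
  adj (\sum_(i <- s) F i) = \sum_(i <- s) adj (F i).
Proof. by apply: (big_morph _ adjD adj0). Qed.

Lemma adjZr r x : adj (r%:C *: x) = r%:C *: adj x.
Proof. by rewrite adjZ conj_Creal ?complex_real. Qed.

Lemma nrm1 : nrm (1 : A) = 1.
Proof.
have n1 : nrm (1 : A) != 0.
  by apply/eqP => /nrm0_eq0 /eqP; rewrite (negbTE (oner_neq0 _)).
by apply: (mulfI n1); rewrite mulr1 -expr2 -nrm_star adj1 mul1r.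
Qed.

Lemma nrm_adj x : nrm (adj x) = nrm x.
Proof.
have le y : nrm y <= nrm (adj y).
  have [->|y0] := eqVneq (nrm y) 0; first exact: nrm_ge0.
  rewrite -(ler_pM2r (x := nrm y)) ?lt0r ?y0 ?nrm_ge0 //.
  by rewrite -expr2 -nrm_star nrmM.
by apply/eqP; rewrite eq_le le -{2}[x]adjK le.
Qed.

Lemma ncvg_adj (u : nat -> A) x : ncvg u x -> ncvg (fun n => adj (u n)) (adj x).
Proof.
by move=> ux; apply: (ncvg_le (K := 1) ux) => n; rewrite -adjB nrm_adj mul1r.
Qed.

Lemma ncvgM (u v : nat -> A) x y :
  ncvg u x -> ncvg v y -> ncvg (fun n => u n * v n) (x * y).
Proof.
move=> ux vy e e0.
have y1 : 0 < nrm y + 1 by rewrite ltr_wpDl ?nrm_ge0.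
have x1 : 0 < nrm x + 1 by rewrite ltr_wpDl ?nrm_ge0.
have [N HN] := ux _ (divr_gt0 (divr_gt0 e0 (ltr0n _ 2)) y1).
have [N' HN'] := ux _ (ltr01).
have [M HM] := vy _ (divr_gt0 (divr_gt0 e0 (ltr0n _ 2)) x1).
exists (maxn (maxn N N') M) => n.
rewrite !geq_max => /andP[/andP[/HN h1 /HN' h2] /HM h3].
rewrite -[_ - _](subrKA (u n * y)) -mulrBr -mulrBl.
rewrite (le_lt_trans (nrmD _ _)) // (splitr e) ltr_leD //.
- rewrite (le_lt_trans (nrmM _ _)) //.
  have un : nrm (u n) <= nrm x + 1.
    by have := nrm_sub (u n) x; move: h2; lra.
  apply: le_lt_trans (ler_wpM2r (nrm_ge0 _) un) _.
  by rewrite mulrC -ltr_pdivlMr.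
- rewrite (le_trans (nrmM _ _)) //.
  apply: le_trans (ler_wpM2l (nrm_ge0 _) (_ : nrm y <= nrm y + 1)) _.
    by rewrite lerDl.
  by rewrite -ler_pdivlMr // ltW.
Qed.

Definition sa x := adj x = x.

Lemma sa1 : sa 1. Proof. exact: adj1. Qed.
Lemma saD x y : sa x -> sa y -> sa (x + y).
Proof. by rewrite /sa adjD => -> ->. Qed.
Lemma saB x y : sa x -> sa y -> sa (x - y).
Proof. by rewrite /sa adjB => -> ->. Qed.
Lemma saZ r x : sa x -> sa (r%:C *: x).
Proof. by rewrite /sa adjZr => ->. Qed.
Lemma sa_sq x : sa x -> sa (x * x).
Proof. by rewrite /sa adj_mul => ->. Qed.
Lemma sa_star x : sa (adj x * x).
Proof. by rewrite /sa adj_mul adjK. Qed.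
Lemma nrm_sa_sq x : sa x -> nrm (x * x) = nrm x ^+ 2.
Proof. by move=> xs; rewrite -{1}xs nrm_star. Qed.

Lemma comm_scale (c : C) x y : GRing.comm x y -> GRing.comm x (c *: y).
Proof. by rewrite /GRing.comm -scalerAr -scalerAl => ->. Qed.

(** * Square root of [1 - a] by iteration *)

Section Sqrt.
Variable a : A.
Hypothesis a1 : nrm a <= 1.

(** [(1 - y)^2 = 1 - a] is the fixed point equation [y = (a + y^2) / 2], solved by iterating from 0.
    [Y_] is the same iteration for the scalar [a = 1] and majorizes the norms of [y_] and of its
    increments. *)
Let step y : A := (2^-1)%:C *: (a + y * y).
Let y_ n : A := iter n step 0.
Let Y_ n : R := iter n (fun r => (1 + r * r) / 2) 0.

(** The explicit rate at which [Y_ n] tends to 1 makes [y_] Cauchy even when [|a| = 1], where no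
    geometric estimate is available. *)
Let Y_bound n : [/\ 0 <= Y_ n, Y_ n <= 1 & (1 - Y_ n) * n.+2%:R <= 2].
Proof.
elim: n => [|n [h0 h1 h2]] /=; first by rewrite /Y_ /=; split; lra.
rewrite -/(Y_ n); split; [nra|nra|].
move: h2; rewrite -[n.+3]addn1 -addn2 !natrD; have := ler0n R n.
set N := n%:R : R; nra.
Qed.

Let comm_y x n : GRing.comm x a -> GRing.comm x (y_ n).
Proof.
move=> xa; elim: n => [|n IHn]; first exact: commr0.
by apply/comm_scale/commrD => //; exact: commrM.
Qed.

Let nrm_y n : nrm (y_ n) <= Y_ n.
Proof.
elim: n => [|n IHn]; first by rewrite nrm0.
rewrite /y_ /Y_ /= -/(y_ n) -/(Y_ n) nrmZr ger0_norm ?invr_ge0 //.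
rewrite mulrC ler_wpM2r ?invr_ge0 // (le_trans (nrmD _ _)) // lerD //.
by rewrite (le_trans (nrmM _ _)) // ler_pM ?nrm_ge0.
Qed.

(** All iterates commute, so the difference of two squares factors; [Y_] obeys the same identity,
    which closes the induction. *)
Let nrm_yS n : nrm (y_ n.+1 - y_ n) <= Y_ n.+1 - Y_ n.
Proof.
elim: n => [|n IHn].
  rewrite /y_ /Y_ /= /step mul0r addr0 !subr0 mulr0 addr0 nrmZr.
  by rewrite ger0_norm ?invr_ge0 // mulrC ler_wpM2r ?invr_ge0.
have -> : y_ n.+2 - y_ n.+1 =
    (2^-1)%:C *: ((y_ n.+1 - y_ n) * (y_ n.+1 + y_ n)).
  rewrite {1}/y_ /= -/(y_ n.+1) {2}/y_ /= -/(y_ n) /step -scalerBr.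
  rewrite opprD addrACA subrr add0r mulrDr !mulrBl.
  have -> : y_ n * y_ n.+1 = y_ n.+1 * y_ n.
    by apply: comm_y; apply/commr_sym/comm_y.
  by rewrite addrA subrK.
have -> : Y_ n.+2 - Y_ n.+1 = 2^-1 * ((Y_ n.+1 - Y_ n) * (Y_ n.+1 + Y_ n)).
  rewrite {1}/Y_ /= -/(Y_ n.+1) {2}/Y_ /= -/(Y_ n); by field.
rewrite nrmZr ger0_norm ?invr_ge0 // ler_wpM2l ?invr_ge0 //.
rewrite (le_trans (nrmM _ _)) // ler_pM ?nrm_ge0 //.
by rewrite (le_trans (nrmD _ _)) // lerD.
Qed.

Let nrm_yB m n : (n <= m)%N -> nrm (y_ m - y_ n) <= Y_ m - Y_ n.
Proof.
elim: m => [|m IHm]; first by rewrite leqn0 => /eqP ->; rewrite !subrr nrm0.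
rewrite leq_eqVlt ltnS => /predU1P[-> | /IHm {}IHm]; first by rewrite !subrr nrm0.
have := nrm_triangle (y_ m) (y_ m.+1) (y_ n); have := nrm_yS m; lra.
Qed.

Let y_cauchy : ncauchy y_.
Proof.
have small m n : (n <= m)%N -> nrm (y_ m - y_ n) * n.+2%:R <= 2.
  move=> /nrm_yB le; have [_ Y1 _] := Y_bound m; have [_ _ ] := Y_bound n.
  apply: le_trans; rewrite ler_wpM2r ?ler0n //; lra.
move=> e e0; have [N HN] := exists_inv_lt (divr_gt0 e0 (ltr0n R 2)).
suff le_e m n : (N <= n)%N -> (n <= m)%N -> nrm (y_ m - y_ n) < e.
  exists N => m n Nm Nn; have [/le_e ->|/ltnW/le_e] // := leqP n m.
  by rewrite nrmBC => ->.
move=> /HN; rewrite -ltf_pV2 ?posrE ?invr_gt0 ?divr_gt0 //.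
rewrite invrK invf_div => Nn /small; set d := nrm _ => hd.
have : d * n.+1%:R <= 2.
  apply: le_trans hd; rewrite ler_wpM2l ?nrm_ge0 // ler_nat; exact: leqW.
rewrite -ler_pdivlMr ?ltr0n // => /le_lt_trans -> //.
by rewrite ltr_pdivrMr ?ltr0n // mulrC -ltr_pdivrMr.
Qed.

(** The clause on commuting elements stands in for functional calculus. The bound on [1 - s] is what
    later shows that the root is itself positive. *)
Lemma sqrt_one_sub : exists s, [/\ s * s = 1 - a,
  forall x, GRing.comm x a -> GRing.comm x s, sa a -> sa s & nrm (1 - s) <= 1].
Proof.
have [y yy] := ncauchy_cvg y_cauchy.
have yE : y = (2^-1)%:C *: (a + y * y).
  apply: (@ncvg_unique _ _ (fun n => y_ n.+1)).
    by move=> e /yy[N HN]; exists N => n /leqW /HN.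
  by apply/ncvgZ/ncvgD; [exact: ncvg_cst|exact: ncvgM].
exists (1 - y); split.
- have -> : a = y + y - y * y.
    rewrite {1 2}yE -scalerDl -rmorphD /=.
    have -> : 2^-1 + 2^-1 = 1 :> R by lra.
    by rewrite scale1r addrK.
  by rewrite mulrBr mulr1 mulrBl mul1r -addrA -opprD addrA.
- move=> x xa; apply: commrB; first exact: commr1.
  apply: (@ncvg_unique _ _ (fun n => x * y_ n)).
    by apply: ncvgM => //; exact: ncvg_cst.
  under [fun n => _]eq_fun do rewrite comm_y //.
  by apply: ncvgM => //; exact: ncvg_cst.
- move=> saa; apply: saB; first exact: sa1.
  apply: ncvg_unique (ncvg_adj yy) _.
  suff : forall n, adj (y_ n) = y_ n by move=> /funext ->.
  elim=> [|n IHn]; first exact: adj0.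
  by rewrite /y_ /= adjZr adjD adj_mul saa IHn.
- rewrite opprB addrC subrK; apply: ncvg_nrm_le yy _ => n.
  by apply: le_trans (nrm_y n) _; have [] := Y_bound n.
Qed.

End Sqrt.

(** * Positive elements *)

Lemma half_double x : (2^-1)%:C *: (x + x) = x.
Proof.
have h : 2^-1 + 2^-1 = 1 :> R by lra.
by rewrite scalerDr -scalerDl -rmorphD /= h scale1r.
Qed.

(* [k + 'i l] is normal, with square modulus [k^2 + l^2]. *)
Lemma nrm_sq_le k l : sa k -> sa l -> GRing.comm k l ->
  nrm k ^+ 2 <= nrm (k * k + l * l).
Proof.
move=> sk sl kl; pose u : A := k + 'i *: l.
have uE : adj u = k - 'i *: l by rewrite /u adjD adjZ sk sl conjCi scaleNr.
have -> : k * k + l * l = adj u * u.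
  rewrite uE /u mulrDr !mulrBl -!scalerAl -!scalerAr -kl scalerA.
  by rewrite -(expr2 'i) sqrCi scaleN1r opprK addrA subrK.
rewrite nrm_star ler_sqr ?nnegrE ?nrm_ge0 //.
have -> : k = (2^-1)%:C *: (u + adj u).
  by rewrite uE addrACA subrr addr0 half_double.
rewrite nrmZr ger0_norm ?invr_ge0 //.
by have := nrmD u (adj u); rewrite nrm_adj; lra.
Qed.

(** Dividing [k] by [sqrt t] reduces to [t = 1]. If [s] is the root of [1 - k^2], then
    [s^2 + k^2 = 1] with [s] and [k] commuting, so [nrm_sq_le] gives [|s| <= 1]. *)
Lemma nrm_sub_sq t k : sa k -> 0 < t -> nrm (k * k) <= t ->
  nrm (t%:C *: 1 - k * k) <= t.
Proof.
move=> sk t0 kt; pose k' := ((Num.sqrt t)^-1)%:C *: k.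
have st0 : 0 < Num.sqrt t by rewrite sqrtr_gt0.
have k'k' : k' * k' = t^-1%:C *: (k * k).
  rewrite /k' -scalerAl -scalerAr scalerA -rmorphM /= -expr2 exprVn.
  by rewrite sqr_sqrtr // ltW.
have [|s [ss sc ssa]] := @sqrt_one_sub (k' * k').
  rewrite k'k' nrmZr ger0_norm ?invr_ge0 ?(ltW t0) //.
  by rewrite mulrC ler_pdivrMr // mul1r.
have sk' : sa k' by exact: saZ.
have {}ssa := ssa (sa_sq sk').
have {}s1 : nrm s ^+ 2 <= 1.
  have := nrm_sq_le ssa sk' (commr_sym (sc k' (commrM (commr_refl _) (commr_refl _)))).
  by rewrite ss subrK nrm1.
have -> : t%:C *: 1 - k * k = t%:C *: (s * s).
  rewrite ss k'k' scalerBr scalerA -rmorphM /= mulfV ?gt_eqF //.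
  by rewrite scale1r.
by rewrite nrmZr ger0_norm ?(ltW t0) // nrm_sa_sq // ler_piMr // ltW.
Qed.

(** The root is required to commute with everything that commutes with [h], so that roots of
    commuting elements commute. By [pos_sq] any self-adjoint root is enough to establish
    positivity. *)
Definition pos h := exists2 k, sa k /\ h = k * k &
  forall x, GRing.comm x h -> GRing.comm x k.

Lemma pos_sa h : pos h -> sa h.
Proof. by move=> [k [sk ->] _]; exact: sa_sq. Qed.

(** The root is [sqrt t] times that of [1 - (1 - h/t)]. Together with [pos_nrm] this turns
    positivity into the condition [|t - h| <= t], which can be added over pairs [(t, h)]: this is
    how [posD] is proved. *)
Lemma pos_of_nrm t h : sa h -> 0 < t -> nrm (t%:C *: 1 - h) <= t -> pos h.
Proof.
move=> sh t0 th; have [|s [ss sc ssa]] := @sqrt_one_sub (1 - t^-1%:C *: h).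
  have -> : 1 - t^-1%:C *: h = t^-1%:C *: (t%:C *: 1 - h).
    by rewrite scalerBr scalerA -rmorphM /= mulVf ?gt_eqF // scale1r.
  rewrite nrmZr ger0_norm ?invr_ge0 ?(ltW t0) //.
  by rewrite mulrC ler_pdivrMr // mul1r.
exists ((Num.sqrt t)%:C *: s); first split.
- by apply/saZ/ssa; apply: saB (saZ _ _) => //; exact: sa1.
- rewrite -scalerAl -scalerAr scalerA -rmorphM /= -expr2 sqr_sqrtr ?(ltW t0) //.
  rewrite ss opprB addrC subrK scalerA -rmorphM /= mulfV ?gt_eqF //.
  by rewrite scale1r.
- move=> x xh; apply/comm_scale/sc; apply: commrB; first exact: commr1.
  exact: comm_scale.
Qed.

Lemma pos_nrm t h : pos h -> 0 < t -> nrm h <= t -> nrm (t%:C *: 1 - h) <= t.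
Proof. by move=> [k [sk ->] _]; exact: nrm_sub_sq. Qed.

Lemma pos_sq k : sa k -> pos (k * k).
Proof.
move=> sk; pose t := nrm (k * k) + 1.
have t0 : 0 < t by rewrite ltr_wpDl ?nrm_ge0.
by apply: (@pos_of_nrm t); rewrite ?nrm_sub_sq ?lerDl //; exact: sa_sq.
Qed.

Lemma pos0 : pos 0.
Proof. by rewrite -[0](mulr0 0); apply: pos_sq; exact: adj0. Qed.

Lemma posD h k : pos h -> pos k -> pos (h + k).
Proof.
move=> ph pk; pose t := nrm h + 1; pose r := nrm k + 1.
have t0 : 0 < t by rewrite ltr_wpDl ?nrm_ge0.
have r0 : 0 < r by rewrite ltr_wpDl ?nrm_ge0.
apply: (@pos_of_nrm (t + r)); first exact: saD (pos_sa ph) (pos_sa pk).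
  exact: addr_gt0.
rewrite rmorphD /= scalerDl opprD addrACA (le_trans (nrmD _ _)) //.
by rewrite lerD // pos_nrm // lerDl.
Qed.

Lemma posZ t h : 0 <= t -> pos h -> pos (t%:C *: h).
Proof.
move=> t0 [k [sk ->] _].
have -> : t%:C *: (k * k) = ((Num.sqrt t)%:C *: k) * ((Num.sqrt t)%:C *: k).
  by rewrite -scalerAl -scalerAr scalerA -rmorphM /= -(expr2 (Num.sqrt t)) sqr_sqrtr.
exact/pos_sq/saZ.
Qed.

(** Sharper than the definition, since the root is itself positive: the root [s] given by
    [sqrt_one_sub] satisfies [|1 - s| <= 1], which is the criterion [pos_of_nrm] with [t = 1]. *)
Lemma pos_sqrt h : pos h ->
  exists k, [/\ pos k, k * k = h & forall x, GRing.comm x h -> GRing.comm x k].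
Proof.
move=> ph; pose t := nrm h + 1; have t0 : 0 < t by rewrite ltr_wpDl ?nrm_ge0.
have [|s [ss sc ssa s1]] := @sqrt_one_sub (1 - t^-1%:C *: h).
  have -> : 1 - t^-1%:C *: h = t^-1%:C *: (t%:C *: 1 - h).
    by rewrite scalerBr scalerA -rmorphM /= mulVf ?gt_eqF // scale1r.
  rewrite nrmZr ger0_norm ?invr_ge0 ?(ltW t0) //.
  by rewrite mulrC ler_pdivrMr // mul1r pos_nrm // lerDl.
exists ((Num.sqrt t)%:C *: s); split.
- apply: posZ; first exact: sqrtr_ge0.
  apply: (@pos_of_nrm 1) => //; last by rewrite scale1r.
  by apply/ssa/saB; [exact: sa1|exact/saZ/pos_sa].
- rewrite -scalerAl -scalerAr scalerA -rmorphM /= -(expr2 (Num.sqrt t)).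
  rewrite sqr_sqrtr ?(ltW t0) // ss opprB addrC subrK scalerA -rmorphM /=.
  by rewrite mulfV ?gt_eqF // scale1r.
- move=> x xh; apply/comm_scale/sc; apply: commrB; first exact: commr1.
  exact: comm_scale.
Qed.

(** For [t > 0] the criterion [pos_of_nrm], applied to [t - h], asks for the norm of
    [t - (t - h) = h]. Otherwise [h = 0]. *)
Lemma pos_nrm_sub t h : sa h -> nrm h <= t -> pos (t%:C *: 1 - h).
Proof.
move=> sh ht; have [t0|t0] := ltP 0 t.
  apply: (@pos_of_nrm t) => //; first by apply: saB => //; apply/saZ/sa1.
  by rewrite opprB addrC subrK.
have h0 : h = 0.
  by apply/nrm0_eq0/eqP; rewrite eq_le nrm_ge0 andbT (le_trans ht).
by have -> : t = 0; [have := nrm_ge0 h; lra|rewrite h0 scale0r subr0; exact: pos0].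
Qed.

(** With roots [k] of [h] and [l] of [t - h], which commute, [k^2 + l^2 = t], and [nrm_sq_le] bounds
    [|k|^2 = |h|]. *)
Lemma pos_nrm_le t h : 0 <= t -> pos h -> pos (t%:C *: 1 - h) -> nrm h <= t.
Proof.
move=> t0 [k [sk hE] kc] [l [sl lE] lc].
have kl : GRing.comm k l.
  apply: lc; apply: commrB; first by apply: comm_scale; exact: commr1.
  by apply/commr_sym; rewrite hE; apply/commr_sym; apply: commrM; exact: commr_refl.
have := nrm_sq_le sk sl kl.
by rewrite -hE -lE addrC subrK nrmZr nrm1 mulr1 ger0_norm // hE nrm_sa_sq.
Qed.

Lemma pos_le_nrm h k : pos h -> pos (k - h) -> nrm h <= nrm k.
Proof.
move=> ph pkh; apply: pos_nrm_le => //; first exact: nrm_ge0.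
rewrite -[_ - h](subrKA k); apply: posD => //; apply: pos_nrm_sub => //.
by rewrite -(subrK h k); apply: saD; exact: pos_sa.
Qed.

Lemma pos_mul_comm h k : pos h -> pos k -> GRing.comm h k -> pos (h * k).
Proof.
move=> [a [sa_a hE] ac] [b [sa_b kE] bc] hk.
have ab : GRing.comm a b.
  by apply/commr_sym/ac/commr_sym/bc.
have -> : h * k = a * b * (a * b).
  by rewrite hE kE -!mulrA (mulrA b a) -ab !mulrA.
by apply: pos_sq; rewrite /sa adj_mul sa_a sa_b ab.
Qed.

(* The Kelley-Vaught argument.  With [h = k^2] and [t = |h|], the element
   [q = xx* = 2 (Re^2 + Im^2) + h] is positive, so [x*(t - q)x = -(th + h^2)]
   has norm at most [t^2]; but [th >= h^2] and [|2h^2| = 2t^2]. *)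
Lemma star_neg_eq0 x k : sa k -> adj x * x = - (k * k) -> x = 0.
Proof.
move=> sk xk; have [h hE] : exists h, h = k * k by exists (k * k).
rewrite -hE in xk; set t := nrm h.
have tx : nrm x ^+ 2 = t by rewrite -nrm_star xk nrmN.
suff t0 : t <= 0.
  by apply/nrm0_eq0/eqP; rewrite -sqrf_eq0 tx eq_le t0 nrm_ge0.
rewrite leNgt; apply/negP => t0.
pose q := x * adj x.
have ph : pos h by rewrite hE; exact: pos_sq.
have pq : pos q.
  pose a := x + adj x; pose b := 'i *: (x - adj x).
  have sa_a : sa a by rewrite /sa adjD adjK addrC.
  have sa_b : sa b by rewrite /sa adjZ adjB adjK conjCi scaleNr -scalerN opprB.
  rewrite -(half_double q).
  have -> : q + q = (a * a + b * b) + (h + h).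
    rewrite -[h]opprK -xk -opprD; apply/eqP; rewrite eq_sym subr_eq; apply/eqP.
    rewrite /b -scalerAl -scalerAr scalerA -(expr2 'i) sqrCi scaleN1r /a.
    have -> : (x + adj x) * (x + adj x) =
        (x * x + adj x * adj x) + (q + adj x * x).
      by rewrite mulrDl !mulrDr [RHS]addrACA (addrC (adj x * adj x)).
    have -> : (x - adj x) * (x - adj x) =
        (x * x + adj x * adj x) - (q + adj x * x).
      by rewrite mulrBl !mulrBr opprB addrACA -opprD.
    by rewrite opprB addrC subrKA addrACA.
  apply: posZ; first by rewrite invr_ge0.
  by apply: posD (posD _ _) (posD _ _) => //; exact: pos_sq.
have nq : nrm (t%:C *: 1 - q) <= t.
  by apply: pos_nrm => //; rewrite /q -{1}[x]adjK nrm_star nrm_adj tx.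
have le : nrm (t%:C *: h + h * h) <= t * t.
  have -> : t%:C *: h + h * h = - (adj x * (t%:C *: 1 - q) * x).
    rewrite mulrBr mulrBl -scalerAr mulr1 -scalerAl /q !mulrA xk -mulrA xk.
    by rewrite mulrNN scalerN -opprD opprK.
  rewrite nrmN (le_trans (nrmM _ _)) // (le_trans (ler_wpM2r _ (nrmM _ _))) ?nrm_ge0 //.
  rewrite nrm_adj mulrAC -expr2 tx ler_wpM2l // ltW //.
have ge : nrm (h * h + h * h) <= nrm (t%:C *: h + h * h).
  apply: pos_le_nrm; first by apply: posD; apply/pos_sq/pos_sa.
  rewrite opprD addrACA subrr addr0.
  have -> : t%:C *: h - h * h = h * (t%:C *: 1 - h).
    by rewrite mulrBr -scalerAr mulr1.
  apply: pos_mul_comm => //; first exact: pos_nrm_sub (pos_sa _) (lexx _).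
  by apply: commrB; [apply/comm_scale/commr1|exact: commr_refl].
have : nrm (h * h + h * h) = 2 * (t * t).
  have -> : h * h + h * h = (2%:R)%:C *: (h * h).
    by rewrite rmorph_nat scaler_nat mulr2n.
  by rewrite nrmZr ger0_norm ?ler0n // nrm_sa_sq ?expr2 //; exact: pos_sa.
nra.
Qed.

(* Apply the previous lemma to [c n], where [n = |h| - h] is twice the negative
   part of [h = c*c]. *)
Lemma pos_star c : pos (adj c * c).
Proof.
have [h hE] : exists h, h = adj c * c by exists (adj c * c).
have sh : sa h by rewrite hE; exact: sa_star.
have [k [pk kk kc]] := pos_sqrt (pos_sq sh); have sk := pos_sa pk.
have [r [sr rE] rc] := pk.
have kh : GRing.comm h k by apply: kc; apply: commrM; exact: commr_refl.
pose n := k - h; have sn : sa n by exact: saB.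
have nh : n * h = - (n * k).
  by rewrite /n !mulrBl opprB kk kh.
have nk : GRing.comm n k.
  apply/commr_sym; apply: commrB; first exact: commr_refl.
  exact: commr_sym.
have nr := rc _ nk.
have cn0 : c * n = 0.
  apply: (@star_neg_eq0 _ (n * r)); first by rewrite /sa adj_mul sn sr nr.
  rewrite adj_mul sn -mulrA (mulrA (adj c)) -hE mulrA nh mulNr.
  by rewrite {2}nr rE !mulrA.
have nh0 : n * h = 0 by rewrite hE mulrA -[n * adj c]adjK adj_mul adjK sn cn0 adj0 mul0r.
have n0 : n = 0.
  apply/nrm0_eq0/eqP; rewrite -sqrf_eq0 -nrm_sa_sq // {2}/n mulrBr nh0 subr0.
  by rewrite -[n * k]opprK -nh nh0 oppr0 nrm0.
by rewrite -hE -(subr0_eq n0).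
Qed.

Lemma pos_sum (I : Type) (s : seq I) (F : I -> A) :
  (forall i, pos (F i)) -> pos (\sum_(i <- s) F i).
Proof. by move=> pF; apply: big_ind => //; [exact: pos0|exact: posD]. Qed.

Lemma pos_conj c h : pos h -> pos (adj c * h * c).
Proof.
move=> [k [sk ->] _].
have -> : adj c * (k * k) * c = adj (k * c) * (k * c) by rewrite adj_mul sk !mulrA.
exact: pos_star.
Qed.

(** * Cauchy-Schwarz inequality for an algebra-valued inner product *)

Section CauchySchwarz.
Variables (I : Type) (s : seq I).
Implicit Types f g : I -> A.

Definition sdot f g : A := \sum_(i <- s) adj (f i) * g i.

Lemma sdotC f g : adj (sdot f g) = sdot g f.
Proof.
by rewrite adj_sum; apply: eq_bigr => i _; rewrite adj_mul adjK.
Qed.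

Lemma pos_sdot f : pos (sdot f f).
Proof. by apply: pos_sum => i; exact: pos_star. Qed.

(** The scalar [t] replaces [<f, f>], which need not be invertible. With [b = <f, g>] and the
    approximate remainder [e = g - f b / t], the difference [t <g, g> - adj b * b] equals
    [t <e, e> + adj b * (t - <f, f>) * b / t], a sum of positive elements. *)
Lemma sdot_le t f g : 0 < t -> nrm (sdot f f) <= t ->
  nrm (sdot f g) ^+ 2 <= t * nrm (sdot g g).
Proof.
move=> t0 ft; set b := sdot f g; have tC : t%:C != 0 :> C by rewrite gt_eqF ?ltcR.
rewrite -nrm_star -(ger0_norm (ltW t0)) -nrmZr.
apply: pos_le_nrm; first exact: pos_star.
have tK x : t%:C *: (t^-1%:C *: x) = x.
  by rewrite scalerA -rmorphM /= mulfV ?gt_eqF // scale1r.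
have tVK x : t^-1%:C *: (t%:C *: x) = x.
  by rewrite scalerA -rmorphM /= mulVf ?gt_eqF // scale1r.
pose e i := g i - f i * (t^-1%:C *: b).
have eE : sdot e e = sdot g g - (t^-1%:C *: (adj b * b) + t^-1%:C *: (adj b * b))
    + t^-1%:C *: (t^-1%:C *: (adj b * sdot f f * b)).
  rewrite [sdot e e]/sdot (eq_bigr (fun i => adj (g i) * g i
    - (t^-1%:C *: (adj (g i) * f i * b) + t^-1%:C *: (adj b * (adj (f i) * g i)))
    + t^-1%:C *: (t^-1%:C *: (adj b * (adj (f i) * f i) * b)))); last first.
    move=> i _; rewrite /e adjB adj_mul adjZr mulrBl !mulrBr opprB.
    rewrite -!scalerAl -!scalerAr !mulrA addrACA -opprD.
    by rewrite addrAC.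
  rewrite big_split sumrB big_split /= -!scaler_sumr -!mulr_suml -!mulr_sumr.
  by rewrite -!/(sdot _ _) -(sdotC f g).
have -> : t%:C *: sdot g g - adj b * b =
   t%:C *: sdot e e + t^-1%:C *: (adj b * (t%:C *: 1 - sdot f f) * b).
  rewrite eE mulrBr mulrBl -scalerAr mulr1 -scalerAl scalerBr tVK.
  rewrite scalerDr scalerBr scalerDr !tK addrACA subrr addr0.
  by rewrite opprD -addrA addrNK.
apply: posD; first by apply: posZ (pos_sdot _); exact: ltW.
apply: posZ; first by rewrite invr_ge0 ltW.
by apply/pos_conj/pos_nrm_sub => //; exact/pos_sa/pos_sdot.
Qed.

Lemma sdot_cauchy_schwarz f g :
  nrm (sdot f g) ^+ 2 <= nrm (sdot f f) * nrm (sdot g g).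
Proof.
apply/ler_addgt0Pr => e e0; set G := nrm (sdot g g).
have G1 : 0 < G + 1 by rewrite ltr_wpDl ?nrm_ge0.
(* [sdot_le] wants [t > 0], so [|<f, f>|] is enlarged by [e / (G + 1)]; after multiplication by [G]
   this costs at most [e]. *)
have d0 : 0 < e / (G + 1) by rewrite divr_gt0.
have := @sdot_le (nrm (sdot f f) + e / (G + 1)) f g.
rewrite lerDl ltr_wpDl ?nrm_ge0 // (ltW d0) => /(_ isT isT) /le_trans; apply.
rewrite mulrDl lerD2l -mulrA ler_piMr ?(ltW e0) //.
by rewrite mulrC ler_pdivrMr // mul1r lerDl.
Qed.

End CauchySchwarz.

End CStarOrder.

(** Images of squares of self-adjoint elements are again such squares, so the order relation
    [h <= |h|] for [h = adj x * x] is preserved, and it bounds the norm of the image of [h]. *)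
Lemma starHom_nrm_le (R : realType) (A B : cstarAlgType R) (th : starHom A B) x :
  nrm (th x) <= nrm x.
Proof.
rewrite -ler_sqr ?nnegrE ?nrm_ge0 // -!nrm_star -starHom_adj -rmorphM /=.
have [h hE] : exists h, h = adj x * x by exists (adj x * x).
rewrite -hE; have ph : pos h by rewrite hE; exact: pos_star.
have thpos (k : A) : pos k -> pos (th k).
  by move=> [l [sl ->] _]; rewrite rmorphM; apply: pos_sq; rewrite /sa -starHom_adj sl.
apply: pos_nrm_le; [exact: nrm_ge0|exact: thpos|].
rewrite -(rmorph1 th) -linearZ -rmorphB; apply: thpos.
exact: pos_nrm_sub (pos_sa ph) (lexx _).
Qed.

(** * Completion of a C*-seminorm *)

(* A *-algebra with a C*-seminorm, in which every algebraic law need only hold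
   up to elements of seminorm zero; [pdist] is the induced pseudo-distance. *)
Record precstar (R : realType) := PreCStar {
  pcar :> Type;
  pzero : pcar;
  pone : pcar;
  padd : pcar -> pcar -> pcar;
  pmul : pcar -> pcar -> pcar;
  pscale : R[i] -> pcar -> pcar;
  padj : pcar -> pcar;
  pdist : pcar -> pcar -> R;
  pdistxx : forall x, pdist x x = 0;
  pdistC : forall x y, pdist x y = pdist y x;
  pdist_triangle : forall y x z, pdist x z <= pdist x y + pdist y z;
  pdistD : forall x y x' y',
    pdist (padd x y) (padd x' y') <= pdist x x' + pdist y y';
  pdistZ : forall c x y, pdist (pscale c x) (pscale c y) = nrm c * pdist x y;
  pdistM : forall x y x' y', pdist (pmul x y) (pmul x' y') <=
    pdist x pzero * pdist y y' + pdist x x' * pdist y' pzero;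
  pdist_adj : forall x y, pdist (padj x) (padj y) = pdist x y;
  pdistB : forall x y, pdist (padd x (pscale (-1) y)) pzero = pdist x y;
  pnormM : forall x y, pdist (pmul x y) pzero <= pdist x pzero * pdist y pzero;
  pnorm_star : forall x, pdist (pmul (padj x) x) pzero = pdist x pzero ^+ 2;
  pnorm1 : pdist pone pzero = 1;
  paddA : forall x y z, pdist (padd x (padd y z)) (padd (padd x y) z) = 0;
  paddC : forall x y, pdist (padd x y) (padd y x) = 0;
  padd0 : forall x, pdist (padd pzero x) x = 0;
  pscaleA : forall a b x, pdist (pscale a (pscale b x)) (pscale (a * b) x) = 0;
  pscale0 : forall a, pdist (pscale a pzero) pzero = 0;
  pscale1 : forall x, pdist (pscale 1 x) x = 0;
  pscaleDr : forall a x y,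
    pdist (pscale a (padd x y)) (padd (pscale a x) (pscale a y)) = 0;
  pscaleDl : forall a b x,
    pdist (pscale (a + b) x) (padd (pscale a x) (pscale b x)) = 0;
  pmulA : forall x y z, pdist (pmul x (pmul y z)) (pmul (pmul x y) z) = 0;
  pmul1 : forall x, pdist (pmul pone x) x = 0;
  pmulr1 : forall x, pdist (pmul x pone) x = 0;
  pmulDl : forall x y z,
    pdist (pmul (padd x y) z) (padd (pmul x z) (pmul y z)) = 0;
  pmulDr : forall x y z,
    pdist (pmul x (padd y z)) (padd (pmul x y) (pmul x z)) = 0;
  pscaleAl : forall a x y, pdist (pscale a (pmul x y)) (pmul (pscale a x) y) = 0;
  pscaleAr : forall a x y, pdist (pscale a (pmul x y)) (pmul x (pscale a y)) = 0;
  padjK : forall x, pdist (padj (padj x)) x = 0;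
  padjD : forall x y, pdist (padj (padd x y)) (padd (padj x) (padj y)) = 0;
  padjZ : forall a x,
    pdist (padj (pscale a x)) (pscale (Num.conj a) (padj x)) = 0;
  padjM : forall x y, pdist (padj (pmul x y)) (pmul (padj y) (padj x)) = 0
}.

Lemma real_cvg_unique (R : realType) (f : nat -> R) (a b : R) :
  f @ \oo --> a -> f @ \oo --> b -> a = b.
Proof. by move=> /(cvg_lim (@Rhausdorff R)) <- /(cvg_lim (@Rhausdorff R)). Qed.

Section Completion.
Variables (R : realType) (P : precstar R).
Implicit Types x y : P.

Lemma pdist_ge0 x y : 0 <= pdist x y.
Proof. by have := pdist_triangle y x x; rewrite pdistxx (pdistC y); lra. Qed.

Lemma pdist_lip x y x' y' :
  `|pdist x y - pdist x' y'| <= pdist x x' + pdist y y'.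
Proof.
have := pdist_triangle x' x y; have := pdist_triangle y' x' y.
have := pdist_triangle x x' y'; have := pdist_triangle y x y'.
by rewrite (pdistC x' x) (pdistC y' y) ler_norml; lra.
Qed.

Definition pcauchy (s : nat -> P) := forall e : R, 0 < e ->
  exists N, forall m n, (N <= m)%N -> (N <= n)%N -> pdist (s m) (s n) < e.

Definition cseq := {s : nat -> P | pcauchy s}.
Definition cseq_fun (s : cseq) : nat -> P := sval s.
Coercion cseq_fun : cseq >-> Funclass.
Implicit Types s t : cseq.

Definition cequiv s t := forall e : R, 0 < e ->
  exists N, forall n, (N <= n)%N -> pdist (s n) (t n) < e.

Lemma cequiv_refl s : cequiv s s.
Proof. by move=> e e0; exists 0%N => n _; rewrite pdistxx. Qed.

Lemma cequiv_sym s t : cequiv s t -> cequiv t s.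
Proof. by move=> st e /st[N HN]; exists N => n /HN; rewrite pdistC. Qed.

Lemma cequiv_trans t s r : cequiv s t -> cequiv t r -> cequiv s r.
Proof.
move=> st tr e e0; have e2 : 0 < e / 2 by rewrite divr_gt0.
have [N HN] := st _ e2; have [M HM] := tr _ e2; exists (maxn N M) => n.
rewrite geq_max => /andP[/HN h1 /HM h2].
by have := pdist_triangle (t n) (s n) (r n); lra.
Qed.

(** Equivalence classes of Cauchy sequences, as predicates. Passing to them completes the space and
    divides out the elements of seminorm zero in a single step. *)
Definition completion := {c : cseq -> Prop | exists s, c = cequiv s}.

HB.instance Definition _ := gen_eqMixin completion.
HB.instance Definition _ := gen_choiceMixin completion.

Definition cls s : completion := exist _ (cequiv s) (ex_intro _ s erefl).

Lemma clsP s t : cls s = cls t <-> cequiv s t.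
Proof.
split=> [[/(congr1 (@^~ t)) ->]|st]; first exact: cequiv_refl.
apply/eq_exist; apply/funext => r; apply/propext; split.
  by apply: cequiv_trans; exact: cequiv_sym.
exact: cequiv_trans.
Qed.

Lemma cls_surj (u : completion) : exists s, u = cls s.
Proof. by case: u => c [s cE]; exists s; apply/eq_exist. Qed.

Definition crepr (u : completion) : cseq := sval (cid (cls_surj u)).

Lemma creprK u : cls (crepr u) = u.
Proof. by rewrite /crepr; case: cid. Qed.

Lemma cequiv_repr s : cequiv (crepr (cls s)) s.
Proof. by apply/clsP; exact: creprK. Qed.

Lemma cls_pt s t : (forall n, pdist (s n) (t n) = 0) -> cls s = cls t.
Proof. by move=> st; apply/clsP => e e0; exists 0%N => n _; rewrite st. Qed.

Lemma cseq_bounded s : exists2 K : R, 0 < K & exists N, forall n, (N <= n)%N ->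
  pdist (s n) (pzero P) < K.
Proof.
have [N HN] := svalP s _ ltr01.
exists (1 + pdist (s N) (pzero P)); first by rewrite ltr_pwDl ?pdist_ge0.
exists N => n Nn; have := HN n N Nn (leqnn _).
by have := pdist_triangle (s N) (s n) (pzero P); rewrite -/(cseq_fun s); lra.
Qed.

(** Sequences and indices vary independently, so that the estimate serves both for products of
    Cauchy sequences and for independence of the representatives. *)
Lemma mul_cauchy_aux (s t s' t' : nat -> P) (K e : R) m n m' n' : 0 < K ->
  pdist (s m) (pzero P) < K -> pdist (t' n') (pzero P) < K ->
  pdist (s m) (s' m') < e / (K + K) -> pdist (t n) (t' n') < e / (K + K) ->
  pdist (pmul (s m) (t n)) (pmul (s' m') (t' n')) < e.
Proof.
move=> K0 hs ht ss tt; have KK : 0 < K + K by exact: addr_gt0.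
apply: le_lt_trans (pdistM _ _ _ _) _.
have -> : e = K * (e / (K + K)) + e / (K + K) * K.
  by rewrite [X in _ + X]mulrC -mulrDl mulrCA divff ?mulr1 // gt_eqF.
by rewrite ltrD // ltr_pM ?pdist_ge0.
Qed.

Lemma add_cauchy s t : pcauchy (fun n => padd (s n) (t n)).
Proof.
move=> e e0; have e2 : 0 < e / 2 by rewrite divr_gt0.
have [N HN] := svalP s _ e2; have [M HM] := svalP t _ e2; exists (maxn N M).
move=> m n; rewrite !geq_max => /andP[Nm Mm] /andP[Nn Mn].
by rewrite (le_lt_trans (pdistD _ _ _ _)) // (splitr e) ltrD ?HN ?HM.
Qed.

Lemma mul_cauchy s t : pcauchy (fun n => pmul (s n) (t n)).
Proof.
move=> e e0; have [K K0 [N1 HN1]] := cseq_bounded s.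
have [L L0 [N2 HN2]] := cseq_bounded t.
have KL : 0 < K + L by rewrite addr_gt0.
have eK : 0 < e / (K + L + (K + L)) by rewrite divr_gt0 // addr_gt0.
have [N3 HN3] := svalP s _ eK; have [N4 HN4] := svalP t _ eK.
exists (maxn (maxn N1 N2) (maxn N3 N4)) => m n.
rewrite !geq_max => /andP[/andP[h1 h2] /andP[h3 h4]] /andP[/andP[h5 h6] /andP[h7 h8]].
apply: (@mul_cauchy_aux s t s t (K + L)); rewrite ?HN3 ?HN4 //.
  by rewrite (lt_trans (HN1 _ h1)) // ltrDl.
by rewrite (lt_trans (HN2 _ h6)) // ltrDr.
Qed.

Lemma scale_cauchy c s : pcauchy (fun n => pscale c (s n)).
Proof.
move=> e e0; have c1 : 0 < nrm c + 1 by rewrite ltr_wpDl ?nrm_ge0.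
have [N HN] := svalP s _ (divr_gt0 e0 c1).
exists N => m n Nm Nn; have := HN m n Nm Nn; rewrite ltr_pdivlMr // => h.
rewrite pdistZ; apply: le_lt_trans h; rewrite mulrC ler_wpM2l ?pdist_ge0 //.
by rewrite lerDl.
Qed.

Lemma adj_cauchy s : pcauchy (fun n => padj (s n)).
Proof. by move=> e /(svalP s)[N HN]; exists N => m n Nm Nn; rewrite pdist_adj HN. Qed.

Lemma cst_cauchy x : pcauchy (fun=> x).
Proof. by move=> e e0; exists 0%N => m n _ _; rewrite pdistxx. Qed.

Definition pinj x : completion := cls (exist _ _ (cst_cauchy x)).

Definition cadd (u v : completion) : completion :=
  cls (exist _ _ (add_cauchy (crepr u) (crepr v))).
Definition cmul (u v : completion) : completion :=
  cls (exist _ _ (mul_cauchy (crepr u) (crepr v))).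
Definition cscale c (u : completion) : completion :=
  cls (exist _ _ (scale_cauchy c (crepr u))).
Definition cadj (u : completion) : completion :=
  cls (exist _ _ (adj_cauchy (crepr u))).

Lemma caddE s t : cadd (cls s) (cls t) = cls (exist _ _ (add_cauchy s t)).
Proof.
apply/clsP => e e0; have e2 : 0 < e / 2 by rewrite divr_gt0.
have [N HN] := @cequiv_repr s _ e2; have [M HM] := @cequiv_repr t _ e2.
exists (maxn N M) => n; rewrite geq_max => /andP[Nn Mn].
by rewrite (le_lt_trans (pdistD _ _ _ _)) // (splitr e) ltrD ?HN ?HM.
Qed.

Lemma cmulE s t : cmul (cls s) (cls t) = cls (exist _ _ (mul_cauchy s t)).
Proof.
apply/clsP => e e0; have [K K0 [N1 HN1]] := cseq_bounded (crepr (cls s)).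
have [L L0 [N2 HN2]] := cseq_bounded t.
have KL : 0 < K + L by rewrite addr_gt0.
have eK : 0 < e / (K + L + (K + L)) by rewrite divr_gt0 // addr_gt0.
have [N3 HN3] := @cequiv_repr s _ eK; have [N4 HN4] := @cequiv_repr t _ eK.
exists (maxn (maxn N1 N2) (maxn N3 N4)) => n.
rewrite !geq_max => /andP[/andP[h1 h2] /andP[h3 h4]].
apply: (@mul_cauchy_aux (crepr (cls s)) (crepr (cls t)) s t (K + L));
  rewrite ?HN3 ?HN4 //.
  by rewrite (lt_trans (HN1 _ h1)) // ltrDl.
by rewrite (lt_trans (HN2 _ h2)) // ltrDr.
Qed.

Lemma cscaleE c s : cscale c (cls s) = cls (exist _ _ (scale_cauchy c s)).
Proof.
apply/clsP => e e0; have c1 : 0 < nrm c + 1 by rewrite ltr_wpDl ?nrm_ge0.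
have [N HN] := @cequiv_repr s _ (divr_gt0 e0 c1).
exists N => n /HN; rewrite ltr_pdivlMr // => h.
rewrite [pdist _ _]pdistZ; apply: le_lt_trans h.
by rewrite mulrC ler_wpM2l ?pdist_ge0 // lerDl.
Qed.

Lemma cadjE s : cadj (cls s) = cls (exist _ _ (adj_cauchy s)).
Proof.
apply/clsP => e /(@cequiv_repr s)[N HN].
by exists N => n /HN; rewrite [pdist (padj _) _]pdist_adj.
Qed.

Let caddA : associative cadd.
Proof.
move=> u v w; have [s ->] := cls_surj u; have [t ->] := cls_surj v.
have [r ->] := cls_surj w.
by rewrite !caddE; apply: cls_pt => n; exact: paddA.
Qed.
Let caddC : commutative cadd.
Proof.
move=> u v; have [s ->] := cls_surj u; have [t ->] := cls_surj v.
by rewrite !caddE; apply: cls_pt => n; exact: paddC.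
Qed.
Let cadd0 : left_id (pinj (pzero P)) cadd.
Proof.
move=> u; have [s ->] := cls_surj u.
by rewrite !caddE; apply: cls_pt => n; exact: padd0.
Qed.
Let caddN : left_inverse (pinj (pzero P)) (cscale (-1)) cadd.
Proof.
move=> u; have [s ->] := cls_surj u; rewrite cscaleE caddC caddE.
by apply: cls_pt => n; rewrite /= pdistB pdistxx.
Qed.

HB.instance Definition _ := GRing.isZmodule.Build completion caddA caddC cadd0 caddN.

Let cscaleA a b u : cscale a (cscale b u) = cscale (a * b) u.
Proof.
have [s ->] := cls_surj u; rewrite !cscaleE; apply: cls_pt => n; exact: pscaleA.
Qed.
Let cscale1 : left_id 1 cscale.
Proof.
move=> u; have [s ->] := cls_surj u.
by rewrite cscaleE; apply: cls_pt => n; exact: pscale1.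
Qed.
Let cscaleDr : right_distributive cscale +%R.
Proof.
move=> a u v; have [s ->] := cls_surj u; have [t ->] := cls_surj v.
rewrite [_ + _]caddE !cscaleE [_ + _]caddE.
by apply: cls_pt => n; exact: pscaleDr.
Qed.
Let cscaleDl u : {morph cscale^~ u : a b / a + b}.
Proof.
move=> a b; have [s ->] := cls_surj u; rewrite !cscaleE [RHS]caddE.
by apply: cls_pt => n; exact: pscaleDl.
Qed.

HB.instance Definition _ := GRing.Zmodule_isLmodule.Build R[i] completion
  cscaleA cscale1 cscaleDr cscaleDl.

Lemma pdist_cvg s t : cvg ((fun n => pdist (s n) (t n)) @ \oo).
Proof.
apply/cauchy_cvgP/cauchyP => e e0; have e2 : 0 < e / 2 by rewrite divr_gt0.
have [N HN] := svalP s _ e2; have [M HM] := svalP t _ e2.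
exists (pdist (s (maxn N M)) (t (maxn N M))), (maxn N M) => // n /=.
rewrite geq_max => /andP[Nn Mn]; rewrite -ball_normE /=.
rewrite (le_lt_trans (pdist_lip _ _ _ _)) // (splitr e).
by rewrite ltrD ?HN ?HM ?leq_maxl ?leq_maxr.
Qed.

Definition cnorm (u : completion) : R :=
  lim ((fun n => pdist (crepr u n) (pzero P)) @ \oo).

Lemma cnorm_cls s :
  (fun n => pdist (s n) (pzero P)) @ \oo --> cnorm (cls s).
Proof.
have /= r0 := @pdist_cvg (crepr (cls s)) (exist _ _ (cst_cauchy (pzero P))).
rewrite -[cnorm _]addr0.
rewrite (_ : (fun n => _) = (fun n => pdist (crepr (cls s) n) (pzero P)) +
  (fun n => pdist (s n) (pzero P) - pdist (crepr (cls s) n) (pzero P))); last first.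
  by apply/funext => n /=; rewrite !fctE addrC subrK.
apply: cvgD => //; apply/cvgrPdist_lt => e e0.
have [N HN] := @cequiv_repr s _ e0; exists N => // n /HN.
rewrite sub0r normrN; apply: le_lt_trans; rewrite distrC.
by rewrite (le_trans (pdist_lip _ _ _ _)) // pdistxx addr0.
Qed.

Arguments cnorm_cls : clear implicits.

Lemma cnorm_pinj x : cnorm (pinj x) = pdist x (pzero P).
Proof.
have h := cnorm_cls (exist _ _ (cst_cauchy x)).
by apply: (real_cvg_unique h) => /=; exact: cvg_cst.
Qed.

Lemma cnorm_sub s t :
  (fun n => pdist (s n) (t n)) @ \oo --> cnorm (cls s - cls t).
Proof.
have -> : cls s - cls t =
    cls (exist _ _ (add_cauchy s (exist _ _ (scale_cauchy (-1) t)))).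
  rewrite -caddE; congr (cadd _ _).
  by rewrite -cscaleE.
under eq_fun do rewrite -pdistB; exact: cnorm_cls.
Qed.

Arguments cnorm_sub : clear implicits.

Lemma pnormD x y : pdist (padd x y) (pzero P) <=
  pdist x (pzero P) + pdist y (pzero P).
Proof.
apply: le_trans (pdist_triangle (padd (pzero P) (pzero P)) _ _) _.
by rewrite padd0 addr0 pdistD.
Qed.

Let cnorm_le s (f : nat -> R) l : f @ \oo --> l ->
  (forall n, pdist (s n) (pzero P) <= f n) -> cnorm (cls s) <= l.
Proof. by move=> fl sf; apply: ler_cvg_to (cnorm_cls s) fl _; near=> n; exact: sf.
Unshelve. all: by end_near. Qed.

Let cnorm_eq s (f : nat -> R) l : f @ \oo --> l ->
  (forall n, pdist (s n) (pzero P) = f n) -> cnorm (cls s) = l.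
Proof.
move=> fl sf; have := cnorm_cls s; under eq_fun do rewrite sf.
by move=> /real_cvg_unique; exact.
Qed.

Let cnormD u v : cnorm (u + v) <= cnorm u + cnorm v.
Proof.
have [s ->] := cls_surj u; have [t ->] := cls_surj v; rewrite [_ + _]caddE.
apply: cnorm_le (cvgD (cnorm_cls s) (cnorm_cls t)) _ => n; exact: pnormD.
Qed.

Let cnormZ c u : cnorm (c *: u) = nrm c * cnorm u.
Proof.
have [s ->] := cls_surj u; rewrite [_ *: _]cscaleE.
apply: cnorm_eq (cvgMr (cnorm_cls s)) _ => n /=; rewrite -pdistZ.
apply/eqP; rewrite -subr_eq0 -normr_le0.
by rewrite (le_trans (pdist_lip _ _ _ _)) // pdistxx pdistC pscale0 addr0.
Qed.

Let cnorm0_eq0 u : cnorm u = 0 -> u = 0.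
Proof.
have [s ->] := cls_surj u => s0; apply/clsP => e e0.
have /cvgrPdist_lt/(_ e e0)[N _ HN] := cnorm_cls s; exists N => n /HN /=.
by rewrite s0 sub0r normrN ger0_norm ?pdist_ge0.
Qed.

Lemma pinj_cvg s (e : R) : 0 < e ->
  exists N, forall n, (N <= n)%N -> cnorm (cls s - pinj (s n)) <= e.
Proof.
move=> e0; have [N HN] := svalP s _ e0; exists N => n Nn.
apply: (ler_cvg_to (cnorm_sub s (exist _ _ (cst_cauchy (s n)))) (cvg_cst e)).
by exists N => // m Nm; rewrite ltW //; exact: HN.
Qed.

(** Diagonal argument: [u n] lies within [1/(n+1)] of some [pinj (x n)]; the sequence [x] is Cauchy
    in [P], and its class is the limit. *)
Let completion_complete (u : nat -> completion) :
  (forall e : R, 0 < e -> exists N, forall m n, (N <= m)%N -> (N <= n)%N ->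
     cnorm (u m - u n) < e) ->
  exists v, forall e : R, 0 < e -> exists N, forall n, (N <= n)%N ->
     cnorm (u n - v) < e.
Proof.
move=> cu; have cnormN v : cnorm (- v) = cnorm v.
  by rewrite -scaleN1r cnormZ nrmN /nrm normr1 mul1r.
have tri v w z : cnorm (v - z) <= cnorm (v - w) + cnorm (w - z).
  by rewrite -[v - z](subrKA w) cnormD.
have /choice[x ux] n : exists x, cnorm (u n - pinj x) <= n.+1%:R^-1.
  have n0 : 0 < n.+1%:R^-1 :> R by rewrite invr_gt0.
  have [s sE] := cls_surj (u n); have [N HN] := pinj_cvg s n0.
  by exists (s N); rewrite sE; exact: HN.
have cx : pcauchy x.
  move=> e e0; have e3 : 0 < e / 3 by rewrite divr_gt0.
  have [N HN] := cu _ e3; have [M HM] := exists_inv_lt e3.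
  exists (maxn N M) => m n; rewrite !geq_max => /andP[Nm Mm] /andP[Nn Mn].
  have -> : pdist (x m) (x n) = cnorm (pinj (x m) - pinj (x n)).
    apply: real_cvg_unique (cvg_cst _) _.
    exact: (cnorm_sub (exist _ _ (cst_cauchy (x m))) (exist _ _ (cst_cauchy (x n)))).
  have := tri (pinj (x m)) (u m) (pinj (x n)).
  have := tri (u m) (u n) (pinj (x n)).
  have := HN m n Nm Nn; have := le_lt_trans (ux m) (HM m Mm).
  by have := le_lt_trans (ux n) (HM n Mn); rewrite -(cnormN (u m - _)) opprB; lra.
exists (cls (exist _ _ cx)) => e e0; have e2 : 0 < e / 2 by rewrite divr_gt0.
have [N HN] := exists_inv_lt e2.
have [M HM] := pinj_cvg (exist _ _ cx) (divr_gt0 e2 (ltr0n _ 2)).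
exists (maxn N M) => n; rewrite geq_max => /andP[/HN Nn /HM /=].
have := le_lt_trans (ux n) Nn; have := tri (u n) (pinj (x n)) (cls (exist _ _ cx)).
by rewrite -(cnormN (pinj _ - _)) opprB; lra.
Qed.

HB.instance Definition _ := @Lmodule_isBanach.Build R completion
  cnorm cnormD cnormZ cnorm0_eq0 completion_complete.

Lemma nrm_completion (u : completion) : nrm u = cnorm u.
Proof. by []. Qed.

Let cmulA : associative cmul.
Proof.
move=> u v w; have [s ->] := cls_surj u; have [t ->] := cls_surj v.
have [r ->] := cls_surj w; rewrite !cmulE; apply: cls_pt => n; exact: pmulA.
Qed.
Let cmul1 : left_id (pinj (pone P)) cmul.
Proof.
by move=> u; have [s ->] := cls_surj u; rewrite cmulE; apply: cls_pt => n; exact: pmul1.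
Qed.
Let cmulr1 : right_id (pinj (pone P)) cmul.
Proof.
by move=> u; have [s ->] := cls_surj u; rewrite cmulE; apply: cls_pt => n; exact: pmulr1.
Qed.
Let cmulDl : left_distributive cmul +%R.
Proof.
move=> u v w; have [s ->] := cls_surj u; have [t ->] := cls_surj v.
have [r ->] := cls_surj w; rewrite [_ + _]caddE !cmulE [_ + _]caddE.
by apply: cls_pt => n; exact: pmulDl.
Qed.
Let cmulDr : right_distributive cmul +%R.
Proof.
move=> u v w; have [s ->] := cls_surj u; have [t ->] := cls_surj v.
have [r ->] := cls_surj w; rewrite [_ + _]caddE !cmulE [_ + _]caddE.
by apply: cls_pt => n; exact: pmulDr.
Qed.
Let cone_neq0 : pinj (pone P) != 0.
Proof.
apply/eqP => e; have := cnorm_pinj (pone P); rewrite e pnorm1 cnorm_pinj pdistxx.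
by move/eqP; rewrite eq_sym oner_eq0.
Qed.
Let cscaleAl a u v : a *: cmul u v = cmul (a *: u) v.
Proof.
have [s ->] := cls_surj u; have [t ->] := cls_surj v.
rewrite cmulE ![_ *: _]cscaleE cmulE; apply: cls_pt => n; exact: pscaleAl.
Qed.
Let cscaleAr a u v : a *: cmul u v = cmul u (a *: v).
Proof.
have [s ->] := cls_surj u; have [t ->] := cls_surj v.
rewrite cmulE ![_ *: _]cscaleE cmulE; apply: cls_pt => n; exact: pscaleAr.
Qed.
Let cadjK : involutive cadj.
Proof.
by move=> u; have [s ->] := cls_surj u; rewrite !cadjE; apply: cls_pt => n; exact: padjK.
Qed.
Let cadjD : {morph cadj : u v / u + v}.
Proof.
move=> u v; have [s ->] := cls_surj u; have [t ->] := cls_surj v.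
rewrite [_ + _]caddE !cadjE [_ + _]caddE; apply: cls_pt => n; exact: padjD.
Qed.
Let cadjZ a u : cadj (a *: u) = Num.conj a *: cadj u.
Proof.
have [s ->] := cls_surj u; rewrite [_ *: _]cscaleE !cadjE [_ *: _]cscaleE.
by apply: cls_pt => n; exact: padjZ.
Qed.
Let cadjM u v : cadj (cmul u v) = cmul (cadj v) (cadj u).
Proof.
have [s ->] := cls_surj u; have [t ->] := cls_surj v.
by rewrite cmulE !cadjE cmulE; apply: cls_pt => n; exact: padjM.
Qed.
Let cnormM u v : `|cmul u v| <= `|u| * `|v|.
Proof.
rewrite !nrmE -rmorphM lecR !nrm_completion.
have [s ->] := cls_surj u; have [t ->] := cls_surj v; rewrite cmulE.
apply: cnorm_le (cvgM (cnorm_cls s) (cnorm_cls t)) _ => n; exact: pnormM.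
Qed.
Let cnorm_star u : `|cmul (cadj u) u| = `|u| ^+ 2.
Proof.
rewrite !nrmE -rmorphXn /= !nrm_completion; congr (_%:C%C).
have [s ->] := cls_surj u; rewrite cadjE cmulE.
apply: cnorm_eq (cvgM (cnorm_cls s) (cnorm_cls s)) _ => n; exact: pnorm_star.
Qed.

HB.instance Definition _ := @isCStarAlgebra.Build R completion
  (pinj (pone P)) cmul cmulA cmul1 cmulr1 cmulDl cmulDr cone_neq0 cscaleAl
  cscaleAr cadj cadjK cadjD cadjZ cadjM cnormM cnorm_star.

End Completion.

Section CompletionMap.
Variables (R : realType) (P : precstar R).
Local Notation U := (completion P : cstarAlgType R).
Implicit Types x y : P.

Lemma pinjD x y : pinj (padd x y) = pinj x + pinj y :> U.
Proof. by rewrite [RHS]caddE; apply: cls_pt => n; rewrite pdistxx. Qed.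
Lemma pinjM x y : pinj (pmul x y) = (pinj x : U) * (pinj y : U) :> U.
Proof. by rewrite [RHS]cmulE; apply: cls_pt => n; rewrite pdistxx. Qed.
Lemma pinjZ c x : pinj (pscale c x) = c *: (pinj x : U) :> U.
Proof. by rewrite [RHS]cscaleE; apply: cls_pt => n; rewrite pdistxx. Qed.
Lemma pinj_adj x : pinj (padj x) = adj (pinj x : U) :> U.
Proof. by rewrite [RHS]cadjE; apply: cls_pt => n; rewrite pdistxx. Qed.

Lemma nrm_pinj x : nrm (pinj x : U) = pdist x (pzero P).
Proof. exact: cnorm_pinj. Qed.

Lemma pinj_eq x y : pdist x y = 0 -> pinj x = pinj y :> U.
Proof. by move=> xy; apply: cls_pt. Qed.

Lemma pinj_dense (u : U) (e : R) : 0 < e -> exists x, nrm (u - pinj x) < e.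
Proof.
move=> e0; have e2 : 0 < e / 2 by rewrite divr_gt0.
have [s ->] := cls_surj u; have [N /(_ N (leqnn _)) HN] := pinj_cvg s e2.
by exists (s N); rewrite (le_lt_trans HN) // ltr_pdivrMr // ltr_pMr // ltr1n.
Qed.

End CompletionMap.

(** * Universal C*-algebras *)

Lemma starHom_of (R : realType) (A B : cstarAlgType R) (f : A -> B) :
  linear f -> f 1 = 1 -> {morph f : x y / x * y} ->
  (forall x, f (adj x) = adj (f x)) -> exists th : starHom A B, th =1 f.
Proof.
move=> fL f1 fM fadj.
pose lin := GRing.isLinear.Build R[i] A B _ f fL.
pose mon := GRing.isMonoidMorphism.Build A B f (conj f1 fM).
pose F : {lrmorphism A -> B} := HB.pack f lin mon.
by exists (@StarHom R A B F fadj).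
Qed.

(** The set where [f] and [g] agree is a C*-subalgebra; it is closed because both maps are
    contractive. *)
Lemma starHom_ext (R : realType) (A B : cstarAlgType R) (S : set A)
    (f g : starHom A B) : cstar_generated S ->
  (forall x, S x -> f x = g x) -> f =1 g.
Proof.
move=> gS fg x; have : [set: A] x by [].
rewrite -gS => /(_ [set y | f y = g y]); apply; split=> //; split.
- apply/closed_nrm => y hy; apply/subr0_eq/nrm0_eq0/eqP.
  rewrite eq_le nrm_ge0 andbT; apply/ler_addgt0Pr => e e0; rewrite add0r.
  have [z /= fgz yz] := hy _ (divr_gt0 e0 (ltr0n R 2)).
  have := nrm_triangle (f z) (f y) (g y); rewrite -raddfB /= fgz -raddfB /=.
  have := starHom_nrm_le f (y - z); have := starHom_nrm_le g (z - y).
  by rewrite (nrmBC z y); lra.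
- by rewrite /= !rmorph1.
- by move=> a y z /= fy fz; rewrite !linearP /= fy fz.
- by move=> y z /= fy fz; rewrite !rmorphM /= fy fz.
- by move=> y /= fy; rewrite !starHom_adj fy.
Qed.

Section Extend.
Variables (R : realType) (P : precstar R) (B : cstarAlgType R) (f : P -> B).
Hypothesis f_le : forall x y, nrm (f x - f y) <= pdist x y.
Hypothesis f1 : f (pone P) = 1.
Hypothesis fD : forall x y, f (padd x y) = f x + f y.
Hypothesis fM : forall x y, f (pmul x y) = f x * f y.
Hypothesis fZ : forall c x, f (pscale c x) = c *: f x.
Hypothesis f_adj : forall x, f (padj x) = adj (f x).

(** [f] is contractive for [pdist], so it maps Cauchy sequences to convergent ones, and every
    algebraic identity passes to the limit. *)
Lemma completion_extend :
  exists th : starHom (completion P) B, forall x, th (pinj x) = f x.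
Proof.
have lims (s : cseq P) : exists l, ncvg (fun n => f (s n)) l.
  apply: ncauchy_cvg => e /(svalP s)[N HN]; exists N => m n Nm Nn.
  exact: le_lt_trans (f_le _ _) (HN m n Nm Nn).
pose th (u : completion P) : B := sval (cid (lims (crepr u))).
have thE (s : cseq P) : ncvg (fun n => f (s n)) (th (cls s)).
  rewrite /th; case: cid => l /= hl e e0; have e2 : 0 < e / 2 by rewrite divr_gt0.
  have [N HN] := hl _ e2; have [M HM] := @cequiv_repr _ _ s _ e2.
  exists (maxn N M) => n; rewrite geq_max => /andP[/HN h1 /HM h2].
  have := nrm_triangle (f (crepr (cls s) n)) (f (s n)) l.
  by have := f_le (crepr (cls s) n) (s n); rewrite (nrmBC (f (s n)) (f (crepr _ _))); lra.
have th_inj x : th (pinj x) = f x.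
  exact: (ncvg_unique (thE (exist _ _ (@cst_cauchy R P x))) (@ncvg_cst _ _ (f x))).
have thU (s : cseq P) l : ncvg (fun n => f (s n)) l -> th (cls s) = l.
  exact: ncvg_unique (thE s).
have [|||u|F FE] := @starHom_of R (completion P) B th.
- move=> c u v; have [s ->] := cls_surj u; have [t ->] := cls_surj v.
  rewrite [_ *: _]cscaleE [X in th X]caddE; apply: thU => /=.
  under [X in ncvg X _]eq_fun do rewrite fD fZ.
  by apply: ncvgD (ncvgZ _ _) _; exact: thE.
- by rewrite -f1 -th_inj.
- move=> u v; have [s ->] := cls_surj u; have [t ->] := cls_surj v.
  rewrite [X in th X]cmulE; apply: thU => /=.
  under [X in ncvg X _]eq_fun do rewrite fM.
  by apply: ncvgM; exact: thE.
- have [s ->] := cls_surj u; rewrite [X in th X]cadjE; apply: thU => /=.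
  under [X in ncvg X _]eq_fun do rewrite f_adj.
  by apply: ncvg_adj; exact: thE.
by exists F => x; rewrite FE.
Qed.

End Extend.

(** Elements of [A] are mere atoms. The algebraic laws of [A] are not imposed on terms; they
    reappear in the seminorm because constants are always evaluated by a homomorphism. *)
Inductive term (R : realType) (A J : Type) :=
| TCst of A
| TGen of J
| TAdd of term R A J & term R A J
| TMul of term R A J & term R A J
| TScale of R[i] & term R A J
| TAdj of term R A J.
Arguments TCst {R A J} _.
Arguments TGen {R A J} _.

Section Universal.
Variables (R : realType) (A : cstarAlgType R) (J : Type).
Local Notation term := (term R A J).
Implicit Types (B : cstarAlgType R) (t : term).

Fixpoint teval B (rho : A -> B) (phi : J -> B) t : B :=
  match t with
  | TCst a => rho a
  | TGen j => phi j
  | TAdd t1 t2 => teval rho phi t1 + teval rho phi t2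
  | TMul t1 t2 => teval rho phi t1 * teval rho phi t2
  | TScale c t1 => c *: teval rho phi t1
  | TAdj t1 => adj (teval rho phi t1)
  end.

Definition satisfies (E : term -> term -> Prop) B (rho : starHom A B)
  (phi : J -> B) := forall t t', E t t' -> teval rho phi t = teval rho phi t'.

Variables (E : term -> term -> Prop) (K : J -> R).
Hypothesis E_bound : forall B (rho : starHom A B) phi, satisfies E rho phi ->
  forall j, nrm (phi j) <= K j.
Hypothesis E_consistent : exists B (rho : starHom A B) phi, satisfies E rho phi.

(** A bound depending on the term only, hence uniform over all representations: it makes the
    supremum [tdist] finite. *)
Fixpoint tbound t : R :=
  match t with
  | TCst a => nrm a
  | TGen j => K j
  | TAdd t1 t2 => tbound t1 + tbound t2
  | TMul t1 t2 => tbound t1 * tbound t2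
  | TScale c t1 => nrm c * tbound t1
  | TAdj t1 => tbound t1
  end.

Lemma teval_bound B (rho : starHom A B) phi t : satisfies E rho phi ->
  nrm (teval rho phi t) <= tbound t.
Proof.
move=> sat; elim: t => /= [a|j|t1 h1 t2 h2|t1 h1 t2 h2|c t1 h1|t1 h1].
- exact: starHom_nrm_le.
- exact: E_bound sat j.
- by rewrite (le_trans (nrmD _ _)) // lerD.
- by rewrite (le_trans (nrmM _ _)) // ler_pM ?nrm_ge0.
- by rewrite nrmZ ler_wpM2l ?nrm_ge0.
- by rewrite nrm_adj.
Qed.

(** The representations range over all C*-algebras, but what is collected is a set of reals. It is
    bounded by [E_bound] and nonempty by [E_consistent], the two conditions under which [sup] is
    meaningful. *)
Definition tdist t t' : R := sup [set r | exists B (rho : starHom A B) phi,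
  satisfies E rho phi /\ r = nrm (teval rho phi t - teval rho phi t')].

Lemma tdist_ub B (rho : starHom A B) phi t t' : satisfies E rho phi ->
  nrm (teval rho phi t - teval rho phi t') <= tdist t t'.
Proof.
move=> sat; apply: ub_le_sup; last by exists B, rho, phi.
exists (tbound t + tbound t') => _ [B' [rho' [phi' [sat' ->]]]].
by rewrite (le_trans (nrmB _ _)) // lerD // teval_bound.
Qed.

Lemma tdist_le t t' k :
  (forall B (rho : starHom A B) phi, satisfies E rho phi ->
    nrm (teval rho phi t - teval rho phi t') <= k) -> tdist t t' <= k.
Proof.
move=> le_k; apply: ge_sup.
  have [B [rho [phi sat]]] := E_consistent.
  by exists (nrm (teval rho phi t - teval rho phi t')), B, rho, phi.
by move=> _ [B [rho [phi [sat ->]]]]; exact: le_k.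
Qed.

Lemma tdist_eq0 t t' :
  (forall B (rho : starHom A B) phi, satisfies E rho phi ->
    teval rho phi t = teval rho phi t') -> tdist t t' = 0.
Proof.
move=> eq_t; apply/eqP; rewrite eq_le; apply/andP; split.
  by apply: tdist_le => B rho phi /eq_t ->; rewrite subrr nrm0.
have [B [rho [phi sat]]] := E_consistent.
exact: le_trans (nrm_ge0 _) (tdist_ub _ _ sat).
Qed.

Lemma tdist_le_eq t1 t1' t2 t2' :
  (forall B (rho : starHom A B) phi, satisfies E rho phi ->
    nrm (teval rho phi t1 - teval rho phi t1') =
    nrm (teval rho phi t2 - teval rho phi t2')) -> tdist t1 t1' = tdist t2 t2'.
Proof.
by move=> h; apply/eqP; rewrite eq_le; apply/andP; split;
  apply: tdist_le => B rho phi sat; rewrite (h, esym (h _ _ _ _)) //; exact: tdist_ub.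
Qed.

Let T0 : term := TCst 0.
Let T1 : term := TCst 1.

Let tnorm_ub B (rho : starHom A B) phi t : satisfies E rho phi ->
  nrm (teval rho phi t) <= tdist t T0.
Proof. by move=> /(tdist_ub t T0) /=; rewrite raddf0 subr0. Qed.

Let tdist_ge0 t t' : 0 <= tdist t t'.
Proof.
have [B [rho [phi sat]]] := E_consistent.
exact: le_trans (nrm_ge0 _) (tdist_ub _ _ sat).
Qed.

(** Every law holds, as an equality or an inequality of norms, in each representation separately,
    and is inherited by the supremum. *)
Definition tprecstar : precstar R.
Proof.
refine (@PreCStar R term T0 T1 (@TAdd R A J) (@TMul R A J) (@TScale R A J)
  (@TAdj R A J) tdist _ _ _ _ _ _ _ _ _ _ _ _ _ _ _ _ _ _ _ _ _ _ _ _ _ _ _ _ _ _).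
- by move=> x; apply: tdist_eq0.
- by move=> x y; apply: tdist_le_eq => *; rewrite nrmBC.
- move=> y x z; apply: tdist_le => B rho phi sat.
  by rewrite (le_trans (nrm_triangle (teval rho phi y) _ _)) // lerD // tdist_ub.
- move=> x y x' y'; apply: tdist_le => B rho phi sat /=.
  by rewrite opprD addrACA (le_trans (nrmD _ _)) // lerD // tdist_ub.
- move=> c x y; have [->|c0] := eqVneq c 0.
    rewrite nrm0 mul0r; apply: tdist_eq0 => B rho phi sat /=.
    by rewrite !scale0r.
  have nc0 : 0 < nrm c.
    by rewrite lt_neqAle nrm_ge0 andbT eq_sym; apply: contra_neq c0 => /nrm0_eq0.
  apply/eqP; rewrite eq_le; apply/andP; split.
    apply: tdist_le => B rho phi sat /=.
    by rewrite -scalerBr nrmZ ler_wpM2l ?nrm_ge0 // tdist_ub.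
  rewrite -ler_pdivlMl //; apply: tdist_le => B rho phi sat.
  rewrite ler_pdivlMl // -nrmZ scalerBr.
  exact: (tdist_ub (TScale c x) (TScale c y) sat).
- move=> x y x' y'; apply: tdist_le => B rho phi sat /=.
  rewrite -[_ - _](subrKA (teval rho phi x * teval rho phi y')) -mulrBr -mulrBl.
  rewrite (le_trans (nrmD _ _)) // lerD // (le_trans (nrmM _ _)) //.
    by rewrite ler_pM ?nrm_ge0 // ?tnorm_ub // tdist_ub.
  by rewrite ler_pM ?nrm_ge0 // ?tnorm_ub // tdist_ub.
- by move=> x y; apply: tdist_le_eq => B rho phi sat /=; rewrite -adjB nrm_adj.
- move=> x y; apply: tdist_le_eq => B rho phi sat /=.
  by rewrite raddf0 subr0 scaleN1r.
- move=> x y; apply: tdist_le => B rho phi sat /=.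
  rewrite raddf0 subr0 (le_trans (nrmM _ _)) // ler_pM ?nrm_ge0 // tnorm_ub //.
- move=> x; apply/eqP; rewrite eq_le; apply/andP; split.
    apply: tdist_le => B rho phi sat /=.
    by rewrite raddf0 subr0 nrm_star ler_sqr ?nnegrE ?nrm_ge0 // tnorm_ub.
  (* To compare the square of a supremum with a supremum, the seminorm of [x] is bounded by the root
     of that of [adj x * x], one representation at a time. *)
  rewrite -[leRHS]sqr_sqrtr ?tdist_ge0 // ler_sqr ?nnegrE ?sqrtr_ge0 //.
  apply: tdist_le => B rho phi sat /=; rewrite raddf0 subr0.
  rewrite -ler_sqr ?nnegrE ?nrm_ge0 ?sqrtr_ge0 // sqr_sqrtr //.
  by rewrite -nrm_star; exact: (@tnorm_ub _ _ _ (TMul (TAdj x) x) sat).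
- apply/eqP; rewrite eq_le; apply/andP; split.
    by apply: tdist_le => B rho phi sat /=; rewrite raddf0 rmorph1 subr0 nrm1.
  have [B [rho [phi sat]]] := E_consistent.
  by have := @tnorm_ub _ _ _ T1 sat; rewrite /= rmorph1 nrm1.
- by move=> x y z; apply: tdist_eq0 => B rho phi sat /=; rewrite addrA.
- by move=> x y; apply: tdist_eq0 => B rho phi sat /=; rewrite addrC.
- by move=> x; apply: tdist_eq0 => B rho phi sat /=; rewrite raddf0 add0r.
- by move=> a b x; apply: tdist_eq0 => B rho phi sat /=; rewrite scalerA.
- by move=> a; apply: tdist_eq0 => B rho phi sat /=; rewrite raddf0 scaler0.
- by move=> x; apply: tdist_eq0 => B rho phi sat /=; rewrite scale1r.
- by move=> a x y; apply: tdist_eq0 => B rho phi sat /=; rewrite scalerDr.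
- by move=> a b x; apply: tdist_eq0 => B rho phi sat /=; rewrite scalerDl.
- by move=> x y z; apply: tdist_eq0 => B rho phi sat /=; rewrite mulrA.
- by move=> x; apply: tdist_eq0 => B rho phi sat /=; rewrite rmorph1 mul1r.
- by move=> x; apply: tdist_eq0 => B rho phi sat /=; rewrite rmorph1 mulr1.
- by move=> x y z; apply: tdist_eq0 => B rho phi sat /=; rewrite mulrDl.
- by move=> x y z; apply: tdist_eq0 => B rho phi sat /=; rewrite mulrDr.
- by move=> a x y; apply: tdist_eq0 => B rho phi sat /=; rewrite scalerAl.
- by move=> a x y; apply: tdist_eq0 => B rho phi sat /=; rewrite scalerAr.
- by move=> x; apply: tdist_eq0 => B rho phi sat /=; rewrite adjK.
- by move=> x y; apply: tdist_eq0 => B rho phi sat /=; rewrite adjD.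
- by move=> a x; apply: tdist_eq0 => B rho phi sat /=; rewrite adjZ.
- by move=> x y; apply: tdist_eq0 => B rho phi sat /=; rewrite adj_mul.
Defined.

(** Density of the terms is kept as a separate conclusion: it later extends a norm estimate from
    terms to the whole algebra. *)
Lemma universal_exists : exists (U : cstarAlgType R) (iota : starHom A U)
  (psi : J -> U), universal_cstar (fun B => @satisfies E B) iota psi /\
  forall u (e : R), 0 < e -> exists t, nrm (u - teval iota psi t) < e.
Proof.
pose U : cstarAlgType R := completion tprecstar.
pose inj : term -> U := @pinj R tprecstar.
have injE t t' : (forall B (rho : starHom A B) phi, satisfies E rho phi ->
    teval rho phi t = teval rho phi t') -> inj t = inj t'.
  by move=> h; apply: pinj_eq; exact: tdist_eq0.
have [|||x|iota iotaE] := @starHom_of R A U (fun a => inj (TCst a)).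
- move=> c x y; rewrite -[c *: inj _](@pinjZ R tprecstar) -[RHS](@pinjD R tprecstar).
  by apply: injE => B rho phi sat /=; rewrite linearP.
- by [].
- move=> x y; rewrite -[RHS](@pinjM R tprecstar).
  by apply: injE => B rho phi sat /=; rewrite rmorphM.
- rewrite -[RHS](@pinj_adj R tprecstar).
  by apply: injE => B rho phi sat /=; rewrite starHom_adj.
pose psi j := inj (TGen j).
have evalU t : teval iota psi t = inj t.
  elim: t => //= [t1 -> t2 ->|t1 -> t2 ->|c t1 ->|t1 ->].
  - by rewrite -[LHS](@pinjD R tprecstar).
  - by rewrite -[LHS](@pinjM R tprecstar).
  - by rewrite -[LHS](@pinjZ R tprecstar).
  - by rewrite -[LHS](@pinj_adj R tprecstar).
have gen : cstar_generated (range iota `|` range psi).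
  apply/seteqP; split=> // u _ S [[clS S1 SZ SM Sadj] genS].
  have S0 : S 0 by have := SZ (-1) 1 1 S1 S1; rewrite scaleN1r addNr.
  have Sinj t : S (inj t).
    rewrite -evalU; elim: t => /= [a|j|t1 h1 t2 h2|t1 h1 t2 h2|c t1 h1|t1 h1].
    - by apply: genS; left; exists a.
    - by apply: genS; right; exists j.
    - by rewrite -[teval _ _ t1]scale1r; exact: SZ.
    - exact: SM.
    - by rewrite -[_ *: _]addr0; exact: SZ.
    - exact: Sadj.
  move/closed_nrm : clS; apply=> e e0.
  by have [t ut] := @pinj_dense R tprecstar u _ e0; exists (inj t).
exists U, iota, psi; split; last first.
  move=> u e e0; have [t ut] := @pinj_dense R tprecstar u _ e0.
  by exists t; rewrite evalU.
split=> //.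
  by move=> t t' Ett'; rewrite !evalU; apply: injE => B rho phi; exact.
move=> B rho phi sat compatible.
have [th thE] : exists th : starHom U B, forall t, th (inj t) = teval rho phi t.
  by apply: completion_extend => //= [x y|]; [exact: tdist_ub|rewrite rmorph1].
have thc : compatible th by split=> [a|j]; rewrite ?iotaE [LHS]thE.
exists th => // th' th'c; apply: starHom_ext gen _ => x [[a _ <-]|[j _ <-]].
  by rewrite th'c.1 thc.1.
by rewrite th'c.2 thc.2.
Qed.

End Universal.

(** * Adjointable operators on pre-Hilbert modules *)

Section AdjointableOperators.
Variables (R : realType) (B : cstarAlgType R) (M : lmodType R[i]).
Variables (fin : M -> Prop) (dot : M -> M -> B).
Implicit Types f g h : M.
Hypothesis finP : forall c f g, fin f -> fin g -> fin (c *: f + g).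
Hypothesis dotP : forall c f g h, fin f -> fin g -> fin h ->
  dot f (c *: g + h) = c *: dot f g + dot f h.
Hypothesis dotC : forall f g, fin f -> fin g -> adj (dot f g) = dot g f.
Hypothesis dot_cs : forall f g, fin f -> fin g ->
  nrm (dot f g) ^+ 2 <= nrm (dot f f) * nrm (dot g g).
Variable e0 : M.
Hypothesis fin_e0 : fin e0.
Hypothesis dot_e0 : dot e0 e0 = 1.

Let fin0 : fin 0.
Proof. by have := finP (-1) fin_e0 fin_e0; rewrite scaleN1r addNr. Qed.
Let finZ c f : fin f -> fin (c *: f).
Proof. by move=> hf; rewrite -[_ *: _]addr0; exact: finP. Qed.
Let finD f g : fin f -> fin g -> fin (f + g).
Proof. by move=> hf hg; rewrite -[f]scale1r; exact: finP. Qed.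
Let dotD f g h : fin f -> fin g -> fin h -> dot f (g + h) = dot f g + dot f h.
Proof. by move=> hf hg hh; rewrite -[g]scale1r dotP // !scale1r. Qed.
Let dot0 f : fin f -> dot f 0 = 0.
Proof.
move=> hf; have := dotD hf fin0 fin0; rewrite addr0 => /eqP.
by rewrite -{1}[dot f 0]addr0 => /eqP/addrI.
Qed.
Let dotZ c f g : fin f -> fin g -> dot f (c *: g) = c *: dot f g.
Proof. by move=> hf hg; rewrite -[c *: g]addr0 dotP // dot0 // addr0. Qed.
Let dotDl f g h : fin f -> fin g -> fin h -> dot (g + h) f = dot g f + dot h f.
Proof.
by move=> hf hg hh; rewrite -(dotC hf (finD hg hh)) dotD // adjD !dotC.
Qed.
Let dotZl c f g : fin f -> fin g -> dot (c *: g) f = Num.conj c *: dot g f.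
Proof. by move=> hf hg; rewrite -(dotC hf (finZ c hg)) dotZ // adjZ dotC. Qed.

Definition hnorm f : R := Num.sqrt (nrm (dot f f)).

Let hnorm_ge0 f : 0 <= hnorm f. Proof. exact: sqrtr_ge0. Qed.
Let hnorm_sq f : hnorm f ^+ 2 = nrm (dot f f).
Proof. by rewrite sqr_sqrtr ?nrm_ge0. Qed.

Let hnorm_dot f g : fin f -> fin g -> nrm (dot f g) <= hnorm f * hnorm g.
Proof.
move=> hf hg; rewrite -ler_sqr ?nnegrE ?nrm_ge0 ?mulr_ge0 // exprMn !hnorm_sq.
exact: dot_cs.
Qed.

Let hnormD f g : fin f -> fin g -> hnorm (f + g) <= hnorm f + hnorm g.
Proof.
move=> hf hg; rewrite -ler_sqr ?nnegrE ?addr_ge0 // hnorm_sq.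
rewrite dotD ?dotDl //; last exact: finD.
rewrite (le_trans (nrmD _ _)) // (le_trans (lerD (nrmD _ _) (nrmD _ _))) //.
rewrite -!hnorm_sq sqrrD mulr2n.
have := hnorm_dot hf hg; have := hnorm_dot hg hf; rewrite (mulrC (hnorm g)).
set a := nrm (dot g f); set b := nrm (dot f g); lra.
Qed.

Let hnormZ c f : fin f -> hnorm (c *: f) = nrm c * hnorm f.
Proof.
move=> hf; apply/eqP; rewrite -(@eqrXn2 _ 2) ?mulr_ge0 ?nrm_ge0 // exprMn !hnorm_sq.
by rewrite dotZ ?dotZl //; [rewrite !nrmZ nrm_conj mulrA | exact: finZ].
Qed.

Let hnorm_e0 : hnorm e0 = 1.
Proof. by rewrite /hnorm dot_e0 nrm1 sqrtr1. Qed.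

Definition hbounded (T : M -> M) (k : R) :=
  0 <= k /\ forall f, fin f -> hnorm (T f) <= k * hnorm f.

(** The adjoint is part of the data, so its existence never has to be derived from completeness.
    Boundedness is asked of [opT] alone and passes to [opS] by [hbounded_adj]. *)
Record adjop := AdjOp {
  opT : M -> M;
  opS : M -> M;
  opT_lin : linear opT;
  opS_lin : linear opS;
  opT_fin : forall f, fin f -> fin (opT f);
  opS_fin : forall f, fin f -> fin (opS f);
  op_adj : forall f g, fin f -> fin g -> dot (opT f) g = dot f (opS g);
  op_bounded : exists k, hbounded opT k
}.

Definition onorm (T : M -> M) : R := inf (hbounded T).

Let onorm_le T k : hbounded T k -> onorm T <= k.
Proof. by move=> hk; apply: ge_inf => //; exists 0 => l []. Qed.

Let onormP T f : (exists k, hbounded T k) -> fin f ->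
  hnorm (T f) <= onorm T * hnorm f.
Proof.
move=> [k hk] hf; have [f0|f0] := eqVneq (hnorm f) 0.
  by have := hk.2 f hf; rewrite f0 !mulr0.
have {}f0 : 0 < hnorm f by rewrite lt0r f0 hnorm_ge0.
rewrite -ler_pdivrMr //; apply: lb_le_inf; first by exists k.
by move=> l [_ hl]; rewrite ler_pdivrMr //; exact: hl.
Qed.

Let onorm_ge0 T : (exists k, hbounded T k) -> 0 <= onorm T.
Proof. by move=> [k hk]; apply: lb_le_inf; [exists k|move=> l []]. Qed.

Let hboundedP T : (exists k, hbounded T k) -> hbounded T (onorm T).
Proof. by move=> hT; split=> [|f hf]; [exact: onorm_ge0|exact: onormP]. Qed.

Let hbounded_sub T T' k k' : (forall f, fin f -> fin (T f)) ->
  (forall f, fin f -> fin (T' f)) -> hbounded T k -> hbounded T' k' ->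
  hbounded (fun f => T f + T' f) (k + k').
Proof.
move=> fT fT' [k0 hk] [k'0 hk']; split=> [|f hf]; first exact: addr_ge0.
by rewrite (le_trans (hnormD _ _)) ?mulrDl ?lerD ?hk ?hk' //; auto.
Qed.

Let hboundedZ c T k : (forall f, fin f -> fin (T f)) -> hbounded T k ->
  hbounded (fun f => c *: T f) (nrm c * k).
Proof.
move=> fT [k0 hk]; split=> [|f hf]; first by rewrite mulr_ge0 ?nrm_ge0.
by rewrite hnormZ -?mulrA ?ler_wpM2l ?nrm_ge0 ?hk //; auto.
Qed.

Let hbounded_comp T T' k k' : (forall f, fin f -> fin (T' f)) ->
  hbounded T k -> hbounded T' k' -> hbounded (T \o T') (k * k').
Proof.
move=> fT' [k0 hk] [k'0 hk']; split=> [|f hf]; first exact: mulr_ge0.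
by rewrite (le_trans (hk _ _)) -?mulrA ?ler_wpM2l ?hk' //; exact: fT'.
Qed.

(* [|Sf|^2 = <TSf, f>] *)
Let hbounded_adj (T S : M -> M) k : (forall f, fin f -> fin (S f)) ->
  (forall f, fin f -> fin (T f)) ->
  (forall f g, fin f -> fin g -> dot (T f) g = dot f (S g)) ->
  hbounded T k -> hbounded S k.
Proof.
move=> fS fT TS [k0 hk]; split=> // f hf; have hSf := fS f hf.
have [->|s0] := eqVneq (hnorm (S f)) 0; first by rewrite mulr_ge0.
rewrite -(ler_pM2l (x := hnorm (S f))) ?lt0r ?s0 ?hnorm_ge0 //.
rewrite -expr2 hnorm_sq -TS // (le_trans (hnorm_dot (fT _ hSf) hf)) //.
by rewrite mulrA ler_wpM2r // mulrC; exact: hk.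
Qed.

Let onorm_adj (T S : M -> M) : (forall f, fin f -> fin (S f)) ->
  (forall f, fin f -> fin (T f)) ->
  (forall f g, fin f -> fin g -> dot (T f) g = dot f (S g)) ->
  (exists k, hbounded T k) -> onorm S = onorm T.
Proof.
move=> fS fT TS bT; have bS : exists k, hbounded S k.
  by exists (onorm T); apply: hbounded_adj TS _ => //; exact: hboundedP.
have ST f g : fin f -> fin g -> dot (S f) g = dot f (T g).
  by move=> hf hg; rewrite -(dotC hg (fS _ hf)) -TS // dotC //; exact: fT.
apply/eqP; rewrite eq_le; apply/andP; split; apply: onorm_le.
  by apply: hbounded_adj TS _ => //; exact: hboundedP.
by apply: hbounded_adj ST _ => //; exact: hboundedP.
Qed.

Definition op_zero : adjop.
Proof.
refine (@AdjOp (fun=> 0) (fun=> 0) _ _ _ _ _ _).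
- by move=> c f g; rewrite scaler0 addr0.
- by move=> c f g; rewrite scaler0 addr0.
- by [].
- by [].
- by move=> f g hf hg; rewrite dot0 // -(dotC hg fin0) dot0 // adj0.
- exists 0; split=> // f hf; rewrite mul0r.
  by rewrite /hnorm dot0 ?nrm0 ?sqrtr0.
Defined.

Definition op_one : adjop.
Proof.
refine (@AdjOp id id _ _ _ _ _ _) => //.
by exists 1; split=> // f hf; rewrite mul1r.
Defined.

Definition op_add (a b : adjop) : adjop.
Proof.
refine (@AdjOp (fun f => opT a f + opT b f) (fun f => opS a f + opS b f)
  _ _ _ _ _ _).
- by move=> c f g; rewrite !opT_lin scalerDr addrACA.
- by move=> c f g; rewrite !opS_lin scalerDr addrACA.
- by move=> f hf; apply: finD; exact: opT_fin.
- by move=> f hf; apply: finD; exact: opS_fin.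
- move=> f g hf hg; rewrite dotD ?dotDl ?op_adj //; by [exact: opT_fin|exact: opS_fin].
- have [k hk] := op_bounded a; have [l hl] := op_bounded b; exists (k + l).
  by apply: hbounded_sub => //; exact: opT_fin.
Defined.

Definition op_scale (c : R[i]) (a : adjop) : adjop.
Proof.
refine (@AdjOp (fun f => c *: opT a f) (fun f => Num.conj c *: opS a f)
  _ _ _ _ _ _).
- by move=> d f g; rewrite opT_lin scalerDr !scalerA mulrC.
- by move=> d f g; rewrite opS_lin scalerDr !scalerA mulrC.
- by move=> f hf; apply: finZ; exact: opT_fin.
- by move=> f hf; apply: finZ; exact: opS_fin.
- move=> f g hf hg; rewrite dotZ ?dotZl ?op_adj //; by [exact: opT_fin|exact: opS_fin].
- have [k hk] := op_bounded a; exists (nrm c * k).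
  by apply: hboundedZ => //; exact: opT_fin.
Defined.

Definition op_mul (a b : adjop) : adjop.
Proof.
refine (@AdjOp (opT a \o opT b) (opS b \o opS a) _ _ _ _ _ _).
- by move=> d f g /=; rewrite !opT_lin.
- by move=> d f g /=; rewrite !opS_lin.
- by move=> f hf; do 2!apply: opT_fin.
- by move=> f hf; do 2!apply: opS_fin.
- move=> f g hf hg /=; rewrite !op_adj //; by [exact: opT_fin|exact: opS_fin].
- have [k hk] := op_bounded a; have [l hl] := op_bounded b; exists (k * l).
  by apply: hbounded_comp => //; exact: opT_fin.
Defined.

Lemma op_adjS (a : adjop) f g : fin f -> fin g ->
  dot (opS a f) g = dot f (opT a g).
Proof.
by move=> hf hg; rewrite -(dotC hg (opS_fin a hf)) -op_adj // dotC //; exact: opT_fin.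
Qed.

Definition op_star (a : adjop) : adjop.
Proof.
refine (@AdjOp (opS a) (opT a) (opS_lin a) (opT_lin a) (@opS_fin a)
  (@opT_fin a) (op_adjS a) _).
have [k hk] := op_bounded a; exists k.
apply: hbounded_adj hk; [exact: opS_fin|exact: opT_fin|exact: op_adj].
Defined.

Definition op_dist (a b : adjop) : R := onorm (fun f => opT a f - opT b f).

Let op_sub (a b : adjop) : adjop := op_add a (op_scale (-1) b).

Let op_distE a b : op_dist a b = onorm (opT (op_sub a b)).
Proof.
by congr onorm; apply/funext => f; rewrite /= scaleN1r.
Qed.

Let op_dist0 a : op_dist a op_zero = onorm (opT a).
Proof. by congr onorm; apply/funext => f; rewrite /= subr0. Qed.

Let op_hnorm a f : fin f -> hnorm (opT a f) <= onorm (opT a) * hnorm f.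
Proof. by move=> hf; apply: onormP => //; exact: op_bounded. Qed.

Let op_onorm_ge0 a : 0 <= onorm (opT a).
Proof. by apply: onorm_ge0; exact: op_bounded. Qed.

Let op_dist_eq (a b : adjop) : opT a = opT b -> op_dist a b = 0.
Proof.
move=> ab; rewrite op_distE.
have -> : opT (op_sub a b) = opT op_zero.
  by apply/funext => f /=; rewrite ab scaleN1r subrr.
apply/eqP; rewrite eq_le op_onorm_ge0 andbT; apply: onorm_le; split=> // f hf.
by rewrite mul0r /hnorm /= dot0 // nrm0 sqrtr0.
Qed.

Let op_onormD a b : onorm (opT (op_add a b)) <= onorm (opT a) + onorm (opT b).
Proof.
apply: onorm_le; apply: hbounded_sub;
  by [exact: opT_fin|apply: hboundedP; exact: op_bounded].
Qed.

Let op_onormM a b : onorm (opT (op_mul a b)) <= onorm (opT a) * onorm (opT b).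
Proof.
apply: onorm_le; apply: hbounded_comp;
  by [exact: opT_fin|apply: hboundedP; exact: op_bounded].
Qed.

Let op_onormZ_le c a : onorm (opT (op_scale c a)) <= nrm c * onorm (opT a).
Proof.
apply: onorm_le; apply: hboundedZ; first exact: opT_fin.
by apply: hboundedP; exact: op_bounded.
Qed.

Let nrm_inv (c : R[i]) : nrm c^-1 = (nrm c)^-1.
Proof. by apply: complexI; rewrite fmorphV /= -!nrmE normfV. Qed.

Let op_onormZ c a : onorm (opT (op_scale c a)) = nrm c * onorm (opT a).
Proof.
apply/eqP; rewrite eq_le op_onormZ_le /=.
have [c0|c0] := eqVneq c 0.
  by rewrite c0 nrm0 mul0r; exact: op_onorm_ge0 (op_scale 0 a).
have nc0 : 0 < nrm c.
  by rewrite lt_neqAle nrm_ge0 andbT eq_sym; apply: contra_neq c0 => /nrm0_eq0.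
rewrite -ler_pdivlMl //; have := op_onormZ_le c^-1 (op_scale c a).
rewrite nrm_inv; apply: le_trans.
rewrite le_eqVlt; apply/orP; left; apply/eqP; congr onorm; apply/funext => f /=.
by rewrite scalerA mulVf // scale1r.
Qed.

Let op_onorm_star a : onorm (opT (op_star a)) = onorm (opT a).
Proof.
apply: onorm_adj; [exact: opS_fin|exact: opT_fin|exact: op_adj|exact: op_bounded].
Qed.

Let opT_sub a f g : opT a (f - g) = opT a f - opT a g.
Proof. by rewrite addrC -scaleN1r opT_lin scaleN1r addrC. Qed.

Let opTZ a c f : opT a (c *: f) = c *: opT a f.
Proof.
have a0 : opT a 0 = 0 by rewrite -[X in opT a X](subrr 0) opT_sub subrr.
by rewrite -[c *: f]addr0 opT_lin a0 addr0.
Qed.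

Definition op_precstar : precstar R.
Proof.
refine (@PreCStar R adjop op_zero op_one op_add op_mul op_scale op_star op_dist
  _ _ _ _ _ _ _ _ _ _ _ _ _ _ _ _ _ _ _ _ _ _ _ _ _ _ _ _ _ _) => [|a b|b a c
  |a b a' b'|c a b|a b a' b'|a b|a b|a b|a||||||||||||||||||||].
- by move=> a; exact: op_dist_eq.
- rewrite !op_distE.
  rewrite (_ : opT (op_sub a b) = opT (op_scale (-1) (op_sub b a))).
    by rewrite op_onormZ nrmN /nrm normr1 mul1r.
  by apply/funext => f /=; rewrite !scaleN1r opprB.
- rewrite !op_distE; apply: le_trans (op_onormD _ _).
  rewrite le_eqVlt; apply/orP; left; apply/eqP; congr onorm; apply/funext => f /=.
  by rewrite !scaleN1r subrKA.
- rewrite !op_distE; apply: le_trans (op_onormD _ _).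
  rewrite le_eqVlt; apply/orP; left; apply/eqP; congr onorm; apply/funext => f /=.
  by rewrite !scaleN1r opprD addrACA.
- rewrite !op_distE -op_onormZ; congr onorm; apply/funext => f /=.
  by rewrite !scaleN1r scalerBr.
- rewrite !op_dist0 !op_distE.
  apply: le_trans (lerD (op_onormM _ _) (op_onormM _ _)).
  apply: le_trans (op_onormD _ _).
  rewrite le_eqVlt; apply/orP; left; apply/eqP; congr onorm; apply/funext => f /=.
  by rewrite !scaleN1r opT_sub subrKA.
- rewrite !op_distE -(op_onorm_star (op_sub a b)); congr onorm.
  by apply/funext => f /=; rewrite rmorphN1.
- by rewrite op_dist0 op_distE.
- by rewrite !op_dist0 op_onormM.
- rewrite !op_dist0; apply/eqP; rewrite eq_le; apply/andP; split.
    by rewrite expr2 -[X in X * _]op_onorm_star op_onormM.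
  (* The nontrivial half of the C*-identity: [|Tf|^2] is the norm of [<f, T^* T f>], which
     Cauchy-Schwarz bounds by [|T^* T| |f|^2]. *)
  rewrite -[leRHS]sqr_sqrtr ?op_onorm_ge0 // ler_sqr ?nnegrE ?sqrtr_ge0 //.
  apply: onorm_le; split=> [|f hf]; first exact: sqrtr_ge0.
  rewrite -ler_sqr ?nnegrE ?mulr_ge0 ?sqrtr_ge0 // exprMn.
  rewrite (sqr_sqrtr (op_onorm_ge0 (op_mul (op_star a) a))).
  have hTf := opT_fin a hf.
  rewrite hnorm_sq op_adj // (le_trans (hnorm_dot hf (opS_fin a hTf))) //.
  rewrite (expr2 (hnorm f)) mulrA [leRHS]mulrC ler_wpM2l //.
  exact: (op_hnorm (op_mul (op_star a) a) hf).
- rewrite op_dist0; apply/eqP; rewrite eq_le; apply/andP; split.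
    by apply: onorm_le; split=> // f hf; rewrite mul1r.
  (* The unit vector [e0] keeps the norm of the identity from being smaller than 1. *)
  by have := @op_hnorm op_one e0 fin_e0; rewrite /= hnorm_e0 mulr1.
- by move=> a b c; apply: op_dist_eq; apply/funext => f /=; rewrite addrA.
- by move=> a b; apply: op_dist_eq; apply/funext => f /=; rewrite addrC.
- by move=> a; apply: op_dist_eq; apply/funext => f /=; rewrite add0r.
- by move=> a b c; apply: op_dist_eq; apply/funext => f /=; rewrite scalerA.
- by move=> a; apply: op_dist_eq; apply/funext => f /=; rewrite scaler0.
- by move=> a; apply: op_dist_eq; apply/funext => f /=; rewrite scale1r.
- by move=> a b c; apply: op_dist_eq; apply/funext => f /=; rewrite scalerDr.
- by move=> a b c; apply: op_dist_eq; apply/funext => f /=; rewrite scalerDl.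
- by move=> a b c; apply: op_dist_eq; apply/funext => f.
- by move=> a; apply: op_dist_eq; apply/funext => f.
- by move=> a; apply: op_dist_eq; apply/funext => f.
- by move=> a b c; apply: op_dist_eq; apply/funext => f.
- move=> a b c; apply: op_dist_eq; apply/funext => f /=.
  by rewrite -[opT b f]scale1r opT_lin !scale1r.
- by move=> a b c; apply: op_dist_eq; apply/funext => f /=.
- move=> c a b; apply: op_dist_eq; apply/funext => f /=.
  by rewrite opTZ.
- by move=> a; apply: op_dist_eq; apply/funext => f.
- by move=> a b; apply: op_dist_eq; apply/funext => f.
- by move=> c a; apply: op_dist_eq; apply/funext => f.
- by move=> a b; apply: op_dist_eq; apply/funext => f.
Defined.

Lemma op_pinj_eq (a b : adjop) : opT a = opT b ->
  @pinj R op_precstar a = @pinj R op_precstar b.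
Proof. by move=> ab; apply: pinj_eq; exact: op_dist_eq. Qed.

Lemma op_pinj_norm (a : adjop) f : fin f ->
  hnorm (opT a f) <= nrm (@pinj R op_precstar a : completion op_precstar) * hnorm f.
Proof. by move=> hf; rewrite nrm_pinj /= op_dist0; exact: op_hnorm. Qed.

Lemma op_pinj_sum (I : Type) (s : seq I) (F : I -> adjop) :
  \sum_(i <- s) (@pinj R op_precstar (F i) : completion op_precstar) =
  @pinj R op_precstar (foldr op_add op_zero [seq F i | i <- s]).
Proof.
elim: s => [|i s IHs]; first by rewrite big_nil.
by rewrite big_cons IHs /= -(@pinjD R op_precstar).
Qed.

Lemma opT_sum (I : Type) (s : seq I) (F : I -> adjop) f :
  opT (foldr op_add op_zero [seq F i | i <- s]) f = \sum_(i <- s) opT (F i) f.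
Proof. by elim: s => [|i s IHs]; rewrite ?big_nil // big_cons /= IHs. Qed.

End AdjointableOperators.

(** * The module of finitely supported functions and two kinds of operators on it *)

Section FiniteSupport.
Variables (R : realType) (B : cstarAlgType R) (X : eqType).
Local Notation M := (X -> B).
Implicit Types (f g h : M) (s : seq X) (x y : X).

Definition supported s f := forall x, f x != 0 -> x \in s.

Definition fin_supp f : Prop := exists s, supported s f.

Definition supp_seq f : seq X :=
  if pselect (fin_supp f) is left h then undup (sval (cid h)) else [::].

Lemma supp_seq_uniq f : uniq (supp_seq f).
Proof. by rewrite /supp_seq; case: pselect => // h; exact: undup_uniq. Qed.

Lemma supp_seqP f : fin_supp f -> supported (supp_seq f) f.
Proof.
rewrite /supp_seq; case: pselect => // h _ x; rewrite mem_undup.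
by case: cid => s /=; apply.
Qed.

(** Only the support of [f] is enumerated, since the other terms vanish whatever [g] is. Outside
    [fin_supp] the enumeration defaults to the empty list. *)
Definition fdot f g : B := sdot (supp_seq f) f g.

(** Discarding the zeros of [f] turns both lists into enumerations of its exact support, which
    differ by a permutation. *)
Lemma sdot_supp s s' f g : uniq s -> uniq s' -> supported s f ->
  supported s' f -> sdot s f g = sdot s' f g.
Proof.
have aux r : sdot r f g = sdot [seq x <- r | f x != 0] f g.
  rewrite /sdot big_filter [RHS]big_mkcond /=; apply: eq_bigr => x _.
  by case: eqVneq => //= ->; rewrite adj0 mul0r.
move=> us us' sf s'f; rewrite aux [RHS]aux; apply: perm_big; apply: uniq_perm.
- exact: filter_uniq.
- exact: filter_uniq.
- move=> x; rewrite !mem_filter; have [//|fx /=] := eqVneq (f x) 0.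
  by rewrite sf ?s'f.
Qed.

Lemma fdotE s f g : uniq s -> supported s f -> fdot f g = sdot s f g.
Proof.
move=> us sf; apply: sdot_supp => //; first exact: supp_seq_uniq.
by apply: supp_seqP; exists s.
Qed.

Lemma fin_supp2 f g : fin_supp f -> fin_supp g ->
  exists s, [/\ uniq s, supported s f & supported s g].
Proof.
move=> [s sf] [s' s'g]; exists (undup (s ++ s')); split; first exact: undup_uniq.
  by move=> x /sf xs; rewrite mem_undup mem_cat xs.
by move=> x /s'g xs; rewrite mem_undup mem_cat xs orbT.
Qed.

Lemma fin_suppP (c : R[i]) f g :
  fin_supp f -> fin_supp g -> fin_supp (c *: f + g).
Proof.
move=> hf hg; have [s [_ sf sg]] := fin_supp2 hf hg; exists s => x.
apply: contraR => xs; rewrite !fctE.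
have -> : f x = 0 by apply/eqP; apply: contraR xs => /sf.
have -> : g x = 0 by apply/eqP; apply: contraR xs => /sg.
by rewrite scaler0 addr0.
Qed.

Lemma fdotP (c : R[i]) f g h : fin_supp f -> fin_supp g -> fin_supp h ->
  fdot f (c *: g + h) = c *: fdot f g + fdot f h.
Proof.
move=> _ _ _; rewrite /fdot /sdot scaler_sumr -big_split /=.
by apply: eq_bigr => x _; rewrite mulrDr scalerAr.
Qed.

Lemma fdotC f g : fin_supp f -> fin_supp g -> adj (fdot f g) = fdot g f.
Proof.
move=> hf hg; have [s [us sf sg]] := fin_supp2 hf hg.
by rewrite !(fdotE (s := s)) // sdotC.
Qed.

Lemma fdot_cs f g : fin_supp f -> fin_supp g ->
  nrm (fdot f g) ^+ 2 <= nrm (fdot f f) * nrm (fdot g g).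
Proof.
move=> hf hg; have [s [us sf sg]] := fin_supp2 hf hg.
by rewrite !(fdotE (s := s)) // sdot_cauchy_schwarz.
Qed.

Definition fdelta x (z : B) : M := fun y => if y == x then z else 0.

Lemma supported_fdelta x z : supported [:: x] (fdelta x z).
Proof. by move=> y; rewrite /fdelta inE; case: (y =P x) => //; rewrite eqxx. Qed.

Lemma fin_fdelta x z : fin_supp (fdelta x z).
Proof. by exists [:: x]; exact: supported_fdelta. Qed.

Lemma fdot_fdelta x z : fdot (fdelta x z) (fdelta x z) = adj z * z.
Proof.
rewrite (fdotE (s := [:: x])) //; last exact: supported_fdelta.
by rewrite /sdot big_seq1 /fdelta eqxx.
Qed.

Variable x0 : X.
Let e0 := fdelta x0 1.
Let fin_e0 : fin_supp e0. Proof. exact: fin_fdelta. Qed.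
Let dot_e0 : fdot e0 e0 = 1.
Proof. by rewrite fdot_fdelta adj1 mulr1. Qed.

Definition fop := adjop fin_supp fdot.

Definition fop_precstar : precstar R :=
  op_precstar fin_suppP fdotP fdotC fdot_cs fin_e0 dot_e0.

Lemma hnorm_fdelta x z : hnorm fdot (fdelta x z) = nrm z.
Proof. by rewrite /hnorm fdot_fdelta nrm_star sqrtr_sqr ger0_norm ?nrm_ge0. Qed.

Definition fop_one : fop := pone fop_precstar.
Definition fop_add (a c : fop) : fop := @padd R fop_precstar a c.
Definition fop_mul (a c : fop) : fop := @pmul R fop_precstar a c.
Definition fop_scale (k : R[i]) (a : fop) : fop := @pscale R fop_precstar k a.
Definition fop_star (a : fop) : fop := @padj R fop_precstar a.

(** What the construction of the model uses of the completed operator algebra. [fop_norm_ge] is the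
    source of all lower bounds of norms: it tests an operator on functions concentrated at one
    point. *)
Record fop_model := FopModel {
  fop_alg :> cstarAlgType R;
  fop_inj : fop -> fop_alg;
  fop_inj1 : fop_inj fop_one = 1;
  fop_injD : forall a c, fop_inj (fop_add a c) = fop_inj a + fop_inj c;
  fop_injM : forall a c, fop_inj (fop_mul a c) = fop_inj a * fop_inj c;
  fop_injZ : forall k a, fop_inj (fop_scale k a) = k *: fop_inj a;
  fop_inj_adj : forall a, fop_inj (fop_star a) = adj (fop_inj a);
  fop_inj_eq : forall a c : fop, opT a = opT c -> fop_inj a = fop_inj c;
  fop_inj_sum : forall (I : Type) (s : seq I) (F : I -> fop) (a : fop),
    (forall f, \sum_(i <- s) opT (F i) f = opT a f) ->
    \sum_(i <- s) fop_inj (F i) = fop_inj a;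
  fop_norm_ge : forall (a : fop) x z w, opT a (fdelta x z) = fdelta x w ->
    nrm w <= nrm (fop_inj a) * nrm z
}.

(* Opaque, so that unification does not unfold the completion. *)
Definition fop_completion : fop_model.
Proof.
refine (@FopModel (completion fop_precstar) (@pinj R fop_precstar)
  _ _ _ _ _ _ _ _).
- by [].
- exact: (@pinjD R fop_precstar).
- exact: (@pinjM R fop_precstar).
- exact: (@pinjZ R fop_precstar).
- exact: (@pinj_adj R fop_precstar).
- exact: op_pinj_eq.
- move=> I s F a Fa; rewrite op_pinj_sum; apply: op_pinj_eq; apply/funext => f.
  by rewrite opT_sum.
- move=> a x z w aw; rewrite -(hnorm_fdelta x w) -(hnorm_fdelta x z) -aw.
  exact: op_pinj_norm (fin_fdelta x z).
Qed.

Section Diagonal.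
Variables (c : X -> B) (k : R).
Hypothesis ck : forall x, nrm (c x) <= k.

Let mulc (c : X -> B) f : M := fun x => c x * f x.

Let mulc_lin c' : linear (mulc c').
Proof.
move=> a f g; apply/funext => x; rewrite /mulc !fctE mulrDr scalerAr.
by [].
Qed.

Let mulc_supp c' s f : supported s f -> supported s (mulc c' f).
Proof.
move=> sf x fx; apply: sf; apply: contraNneq fx => fx0.
by rewrite /mulc fx0 mulr0.
Qed.

Let mulc_fin c' f : fin_supp f -> fin_supp (mulc c' f).
Proof. by move=> [s sf]; exists s; exact: mulc_supp. Qed.

Let mulc_adj f g : fin_supp f -> fin_supp g ->
  fdot (mulc c f) g = fdot f (mulc (fun x => adj (c x)) g).
Proof.
move=> hf hg; have [s [us sf _]] := fin_supp2 hf hg.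
rewrite !(fdotE (s := s)) //; last exact: mulc_supp.
by apply: eq_bigr => x _; rewrite /mulc adj_mul mulrA.
Qed.

(** The bound is checked in the order of [B]: [k^2 - adj (c x) * c x] is positive at every point,
    and stays so after conjugation by [f x] and summation. *)
Let mulc_bounded : exists k, hbounded fin_supp fdot (mulc c) k.
Proof.
exists k; have k0 : 0 <= k by exact: le_trans (nrm_ge0 _) (ck x0).
split=> // f [s' s'f]; pose s := undup s'.
have us : uniq s by exact: undup_uniq.
have sf : supported s f by move=> x /s'f; rewrite mem_undup.
rewrite -ler_sqr ?nnegrE ?mulr_ge0 ?sqrtr_ge0 // exprMn /hnorm !sqr_sqrtr ?nrm_ge0 //.
rewrite !(fdotE (s := s)) //; last exact: mulc_supp.
rewrite -[k ^+ 2]ger0_norm ?sqr_ge0 // -nrmZr; apply: pos_le_nrm.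
  exact: pos_sdot.
rewrite /sdot scaler_sumr -sumrB; apply: pos_sum => x.
rewrite /mulc adj_mul -mulrA (mulrA (adj (c x))).
rewrite -[X in X - _](_ : adj (f x) * ((k ^+ 2)%:C%C *: 1 * f x) = _); last first.
  by rewrite -scalerAl mul1r scalerAr.
rewrite -mulrBr -mulrBl mulrA; apply: pos_conj; apply: pos_nrm_sub.
  exact: sa_star.
by rewrite nrm_star ler_sqr ?nnegrE ?nrm_ge0.
Qed.

Definition fop_diag : fop := @AdjOp _ _ _ _ _ (mulc c) (mulc (fun x => adj (c x)))
  (mulc_lin c) (mulc_lin _) (mulc_fin c) (mulc_fin _) mulc_adj mulc_bounded.

End Diagonal.

Section Shift.
Variables (up down : X -> X) (dom : pred X).
Hypothesis upK : cancel up down.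
Hypothesis up_dom : forall x, dom (up x).
Hypothesis downK : forall x, dom x -> up (down x) = x.

(** The isometry induced by the injection [up]; its range consists of the functions vanishing
    outside [dom], the image of [up], and [unshift] is its adjoint. *)
Let shift f : M := fun x => if dom x then f (down x) else 0.
Let unshift f : M := fun x => f (up x).

Let shift_supp s f : supported s f -> supported (map up s) (shift f).
Proof.
move=> sf x; rewrite /shift; case: ifPn => [dx /sf xs|_]; last by rewrite eqxx.
by rewrite -(downK dx) map_f.
Qed.

Let shift_adj f g : fin_supp f -> fin_supp g ->
  fdot (shift f) g = fdot f (unshift g).
Proof.
move=> hf hg; have [s [us sf _]] := fin_supp2 hf hg.
rewrite (fdotE (s := map up s)); first 1 last.
- by rewrite map_inj_uniq //; exact: can_inj upK.
- exact: shift_supp.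
rewrite (fdotE (s := s)) // /sdot big_map; apply: eq_bigr => x _.
by rewrite /shift up_dom upK.
Qed.

Let shift_fin f : fin_supp f -> fin_supp (shift f).
Proof. by move=> [s sf]; exists (map up s); exact: shift_supp. Qed.

Let unshift_fin f : fin_supp f -> fin_supp (unshift f).
Proof.
by move=> [s sf]; exists (map down s) => x /sf xs; rewrite -[x]upK map_f.
Qed.

Let shift_bounded : exists k, hbounded fin_supp fdot shift k.
Proof.
exists 1; split=> // f hf; rewrite mul1r /hnorm shift_adj //; last exact: shift_fin.
rewrite (_ : unshift (shift f) = f) //.
by apply/funext => x; rewrite /unshift /shift up_dom upK.
Qed.

Definition fop_shift : fop.
Proof.
refine (@AdjOp _ _ _ _ _ shift unshift _ _ shift_fin unshift_fin shift_adj shift_bounded).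
- move=> a f g; apply/funext => x; rewrite /shift !fctE; case: ifP => // _.
  by rewrite scaler0 addr0.
- by move=> a f g; apply/funext => x; rewrite /unshift !fctE.
Defined.

End Shift.

End FiniteSupport.

(** * A model of the crossed product relations *)

Lemma starHom_id (R : realType) (A : cstarAlgType R) :
  exists h : starHom A A, h =1 id.
Proof. by have [|||x|h hE] := @starHom_of R A A id => //; exists h. Qed.

Lemma starHom_comp (R : realType) (A B D : cstarAlgType R) (f : starHom B D)
  (g : starHom A B) : exists h : starHom A D, forall x, h x = f (g x).
Proof.
have [|||x|h hE] := @starHom_of R A D (f \o g); last by exists h.
- by move=> c x y /=; rewrite !linearP.
- by rewrite /= !rmorph1.
- by move=> x y /=; rewrite !rmorphM.
- by rewrite /= !starHom_adj.
Qed.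

Lemma starAut_inv (R : realType) (A : cstarAlgType R) (f : starAut A) :
  exists g : starHom A A, cancel f g /\ cancel g f.
Proof.
have [g fK gK] := starAut_bij f; have fI := can_inj fK.
have [|||x|h hE] := @starHom_of R A A g.
- by move=> c x y; apply: fI; rewrite linearP /= !gK.
- by apply: fI; rewrite gK rmorph1.
- by move=> x y; apply: fI; rewrite rmorphM /= !gK.
- by apply: fI; rewrite starHom_adj !gK.
by exists h; split=> x; rewrite hE.
Qed.

Lemma cuntz_nrm (R : realType) (B : cstarAlgType R) (x : B) :
  adj x * x = 1 -> nrm x = 1.
Proof.
move=> xx; apply/eqP; rewrite -(@eqrXn2 _ 2) ?nrm_ge0 ?ler01 //.
by rewrite -nrm_star xx nrm1 expr1n.
Qed.

Section Model.
Variables (R : realType) (G : topologicalGroupType) (A : cstarAlgType R).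
Variable alpha : chain_group R G -> starAut A.
Variables (GG : Type) (V : GG -> urep R G) (b : forall v, adapted_basis (V v)).
Local Notation dim v := (ab_dim (b v)).
Local Notation al v i := (alpha (chain_of (ab_class (b v) i))).
Hypothesis dim_gt0 : forall v, (0 < dim v)%N.
Hypothesis al_comm : forall v w (i : 'I_(dim v)) (j : 'I_(dim w)) x,
  al v i (al w j x) = al w j (al v i x).
Variables (B : cstarAlgType R) (rho : starHom A B) (K : GG -> Prop).
Variable phi : gen b -> B.
Hypothesis K_sub : forall v w, K v -> K w -> v = w.
Hypothesis phiK : forall v, K v ->
  cuntz_relations alpha (ab_class (b v)) rho (fun i => phi (Tagged _ i)).

Let ai v (i : 'I_(dim v)) : starHom A A := sval (cid (starAut_inv (al v i))).

Let alK v (i : 'I_(dim v)) : cancel (al v i) (ai i).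
Proof. by rewrite /ai; case: cid => g []. Qed.
Let aiK v (i : 'I_(dim v)) : cancel (ai i) (al v i).
Proof. by rewrite /ai; case: cid => g []. Qed.

Let ai_al_comm v w (i : 'I_(dim v)) (j : 'I_(dim w)) x :
  ai i (al w j x) = al w j (ai i x).
Proof. by apply: (can_inj (alK i)); rewrite aiK al_comm aiK. Qed.

(* The pairs [(y, d)] above, with letters coded as natural numbers. *)
Definition is_point (p : (GG -> nat -> nat) * (A -> A)) :=
  [/\ forall v n, (p.1 v n < dim v)%N,
      exists h : starHom A A, h =1 p.2
    & forall v (i : 'I_(dim v)) x, K v -> p.2 (al v i x) = al v i (p.2 x)].

Definition point := {p | is_point p}.

HB.instance Definition _ := gen_eqMixin point.

Lemma point_eq (x y : point) : sval x = sval y -> x = y.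
Proof. by case: x y => [x px] [y py] /= xy; apply/eq_exist. Qed.

Let update (y : GG -> nat -> nat) v (u : nat -> nat) : GG -> nat -> nat :=
  fun w => if pselect (w = v) then u else y w.

Let updateE y v u : update y v u v = u.
Proof. by rewrite /update; case: pselect. Qed.

Let update_neq y v u w : w <> v -> update y v u w = y w.
Proof. by rewrite /update; case: pselect. Qed.

Let update_update y v u u' : update (update y v u) v u' = update y v u'.
Proof. by apply/funext => w; rewrite /update; case: pselect. Qed.

Let update_id y v : update y v (y v) = y.
Proof. by apply/funext => w; rewrite /update; case: pselect => //= wv; rewrite wv. Qed.

Let update_comm y v w u u' : v <> w ->
  update (update y v u) w u' = update (update y w u') v u.
Proof.
move=> vw; apply/funext => z; rewrite /update.
by case: pselect => //= zw; case: pselect => //= zv; case: vw; rewrite -zv.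
Qed.

Let pcons (i : nat) (u : nat -> nat) n := if n is m.+1 then u m else i.

Let up_subproof v (i : 'I_(dim v)) (x : point) :
  is_point (update (sval x).1 v (pcons i ((sval x).1 v)), (sval x).2 \o ai i).
Proof.
case: x => [[y de] [/= yd [h hE] dK]]; split=> [w n||w j x Kw] /=.
- rewrite /update; case: pselect => //= wv; rewrite wv.
  by case: n => [|n] //=; exact: ltn_ord.
- have [g gE] := starHom_comp h (ai i).
  by exists g => x; rewrite gE hE.
- by rewrite ai_al_comm dK.
Qed.
(** The inverse automorphism is forced by the twist relation. The shift reads [f] at [down i x],
    whose endomorphism is [d \o al v i]; hence the constant [a] acts there as [al v i a] acts at
    [x]. *)
Let up v (i : 'I_(dim v)) (x : point) : point := exist _ _ (up_subproof i x).

Let down_subproof v (i : 'I_(dim v)) (x : point) :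
  is_point (update (sval x).1 v (fun n => (sval x).1 v n.+1), (sval x).2 \o al v i).
Proof.
case: x => [[y de] [/= yd [h hE] dK]]; split=> [w n||w j x Kw] /=.
- by rewrite /update; case: pselect => //= wv; rewrite wv.
- have [g gE] := starHom_comp h (al v i).
  by exists g => x; rewrite gE hE.
- by rewrite al_comm dK.
Qed.
Let down v (i : 'I_(dim v)) (x : point) : point :=
  exist _ _ (down_subproof i x).

Let dom v (i : 'I_(dim v)) : pred point := fun x => (sval x).1 v 0%N == i.

Let upK v (i : 'I_(dim v)) : cancel (up i) (down i).
Proof.
move=> x; apply: point_eq; case: x => [[y de] px] /=; congr (_, _).
  by rewrite update_update updateE /= update_id.
by apply/funext => a /=; rewrite alK.
Qed.

Let up_dom v (i : 'I_(dim v)) x : dom i (up i x).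
Proof. by rewrite /dom /= updateE. Qed.

Let downK v (i : 'I_(dim v)) x : dom i x -> up i (down i x) = x.
Proof.
rewrite /dom => /eqP xi; apply: point_eq; case: x xi => [[y de] px] /= yi.
congr (_, _); last by apply/funext => a /=; rewrite aiK.
rewrite update_update updateE -[RHS](update_id y v); congr update.
by apply/funext => -[|n].
Qed.

Let down_up v w (i : 'I_(dim v)) (j : 'I_(dim w)) x : v <> w ->
  down i (up j x) = up j (down i x).
Proof.
move=> vw; apply: point_eq => /=; congr (_, _).
  by rewrite update_comm 1?update_neq 1?[in RHS]update_neq //; exact: nesym.
by apply/funext => a /=; rewrite ai_al_comm.
Qed.

Let down_down v w (i : 'I_(dim v)) (j : 'I_(dim w)) x : v <> w ->
  down i (down j x) = down j (down i x).
Proof.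
move=> vw; apply: point_eq => /=; congr (_, _).
  by rewrite update_comm 1?update_neq 1?[in RHS]update_neq //; exact: nesym.
by apply/funext => a /=; rewrite al_comm.
Qed.

Let dom_up v w (i : 'I_(dim v)) (j : 'I_(dim w)) x : v <> w ->
  dom i (up j x) = dom i x.
Proof. by move=> vw; rewrite /dom /= update_neq. Qed.

Let dom_down v w (i : 'I_(dim v)) (j : 'I_(dim w)) x : v <> w ->
  dom i (down j x) = dom i x.
Proof. by move=> vw; rewrite /dom /= update_neq. Qed.

(** The constant word 0 is available because every dimension is positive. *)
Let base_subproof : is_point (fun _ _ => 0%N, id).
Proof.
split=> //=.
exact: starHom_id.
Qed.
Let base : point := exist _ _ base_subproof.

Let phi_bound v (i : 'I_(dim v)) : K v -> nrm (phi (Tagged _ i)) <= 1.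
Proof.
by move=> /phiK[_ orth _]; rewrite cuntz_nrm // orth eqxx.
Qed.

Let cst_bound a (x : point) : nrm (rho ((sval x).2 a)) <= nrm a.
Proof.
case: x => [[y de] [/= _ [h <-] _]].
exact: le_trans (starHom_nrm_le _ _) (starHom_nrm_le _ _).
Qed.

Let ocst a : fop B point := fop_diag base (cst_bound a).

Let ogen v (i : 'I_(dim v)) : fop B point :=
  match pselect (K v) with
  | left Kv => fop_diag base (fun=> phi_bound i Kv)
  | right _ => fop_shift B (@upK v i) (@up_dom v i) (@downK v i)
  end.

Let ogenK v (i : 'I_(dim v)) : K v ->
  opT (ogen i) = (fun f x => phi (Tagged _ i) * f x) /\
  opS (ogen i) = (fun f x => adj (phi (Tagged _ i)) * f x).
Proof. by rewrite /ogen; case: pselect. Qed.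

Let ogenN v (i : 'I_(dim v)) : ~ K v ->
  opT (ogen i) = (fun f x => if dom i x then f (down i x) else 0) /\
  opS (ogen i) = (fun f x => f (up i x)).
Proof. by rewrite /ogen; case: pselect. Qed.

Local Notation E := (fop_completion B base).
Local Notation inj := (fop_inj (fop_completion B base)).

Let iota_exists : exists iota : starHom A E, forall a, iota a = inj (ocst a).
Proof.
have dP (x : point) : exists h : starHom A A, h =1 (sval x).2 by case: x => p [].
have [|||a|iota iotaE] := @starHom_of R A E (fun a => inj (ocst a)).
- move=> c a a'; rewrite -fop_injZ -fop_injD; apply: fop_inj_eq.
  apply/funext => f; apply/funext => x; have [h hE] := dP x.
  by rewrite /= !fctE -!hE !linearP /= mulrDl scalerAl.
- rewrite -fop_inj1; apply: fop_inj_eq.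
  apply/funext => f; apply/funext => x; have [h hE] := dP x.
  by rewrite /= -hE !rmorph1 mul1r.
- move=> a a'; rewrite -fop_injM; apply: fop_inj_eq.
  apply/funext => f; apply/funext => x; have [h hE] := dP x.
  by rewrite /= -!hE !rmorphM /= mulrA.
- rewrite -fop_inj_adj; apply: fop_inj_eq.
  apply/funext => f; apply/funext => x; have [h hE] := dP x.
  by rewrite /= -!hE !starHom_adj.
by exists iota.
Qed.

Let iota : starHom A E := sval (cid iota_exists).
Let iotaE a : iota a = inj (ocst a). Proof. by rewrite /iota; case: cid. Qed.

Let psi (j : gen b) : E := inj (ogen (tagged j)).

Let ogen_sum v f : \sum_(i < dim v) opT (ogen i) (opS (ogen i) f) = f.
Proof.
apply/funext => x; rewrite fct_sumE; have [Kv|Kv] := pselect (K v).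
  under eq_bigr => i _ do
    rewrite (ogenK i Kv).1 (ogenK i Kv).2 mulrA.
  by rewrite -mulr_suml; have [-> _ _] := phiK Kv; rewrite mul1r.
have xd : ((sval x).1 v 0%N < dim v)%N by case: x => p [].
(* Only the first letter of the word of [v] at [x] contributes to the sum. *)
rewrite (bigD1 (Ordinal xd)) //= big1 ?addr0 => [|i ix].
  by rewrite (ogenN _ Kv).1 (ogenN _ Kv).2 /dom eqxx downK // /dom eqxx.
rewrite (ogenN _ Kv).1 /dom; case: eqP => // xi.
by case/eqP: ix; apply: val_inj.
Qed.

Let ogen_orth v (i j : 'I_(dim v)) f :
  opS (ogen i) (opT (ogen j) f) = (i == j)%:R *: f.
Proof.
apply/funext => x; have [Kv|Kv] := pselect (K v).
  rewrite (ogenK i Kv).2 (ogenK j Kv).1 mulrA; have [_ -> _] := phiK Kv.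
  by rewrite fctE; case: (i == j); rewrite ?mul0r ?scale0r ?mul1r ?scale1r.
rewrite (ogenN i Kv).2 (ogenN j Kv).1 /dom /= updateE /= fctE.
have [->|ij] := eqVneq i j; first by rewrite eqxx upK scale1r.
by rewrite ifN ?scale0r.
Qed.

Let ogen_cst v (i : 'I_(dim v)) a f :
  opT (ogen i) (opT (ocst a) f) = opT (ocst (al v i a)) (opT (ogen i) f).
Proof.
apply/funext => x; have [Kv|Kv] := pselect (K v).
  rewrite (ogenK i Kv).1 /= !mulrA; have [_ _ ->] := phiK Kv.
  (* For [v] in [K] the relation available in [rho] and [phi] concerns the constant [d(a)]; it
     applies since [d] commutes with the automorphisms of [K]. *)
  by case: (svalP x) => _ _ ->.
by rewrite (ogenN i Kv).1 /=; case: ifP => _; rewrite ?mulr0.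
Qed.

Let ogen_comm v w (i : 'I_(dim v)) (j : 'I_(dim w)) f : v <> w ->
  opT (ogen i) (opT (ogen j) f) = opT (ogen j) (opT (ogen i) f).
Proof.
move=> vw; apply/funext => x.
have [Kv|Kv] := pselect (K v); have [Kw|Kw] := pselect (K w).
(* Two different members of [K] would both act by multiplication, and their generators need not
   commute in [B]. In the mixed cases one operator multiplies values and the other moves points. *)
- by case: vw; exact: K_sub.
- by rewrite (ogenK i Kv).1 (ogenN j Kw).1; case: ifP => _; rewrite ?mulr0.
- by rewrite (ogenN i Kv).1 (ogenK j Kw).1; case: ifP => _; rewrite ?mulr0.
- rewrite (ogenN i Kv).1 (ogenN j Kw).1 dom_down ?[in RHS]dom_down //; last exact: nesym.
  by rewrite (down_down j i); [case: (dom i x); case: (dom j x)|exact: nesym].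
Qed.

Let ogen_star_comm v w (i : 'I_(dim v)) (j : 'I_(dim w)) f : v <> w ->
  opS (ogen i) (opT (ogen j) f) = opT (ogen j) (opS (ogen i) f).
Proof.
move=> vw; apply/funext => x.
have [Kv|Kv] := pselect (K v); have [Kw|Kw] := pselect (K w).
- by case: vw; exact: K_sub.
- by rewrite (ogenK i Kv).2 (ogenN j Kw).1; case: ifP => _; rewrite ?mulr0.
- by rewrite (ogenN i Kv).2 (ogenK j Kw).1.
- rewrite (ogenN i Kv).2 (ogenN j Kw).1 dom_up; last exact: nesym.
  by rewrite (down_up j i) //; exact: nesym.
Qed.

Let inj_mul_eq (a c a' c' : fop B point) :
  (forall f, opT a (opT c f) = opT a' (opT c' f)) ->
  inj a * inj c = inj a' * inj c'.
Proof.
move=> h; rewrite -!fop_injM.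
by apply: fop_inj_eq; apply/funext => f; exact: h.
Qed.

Let inj_star_mul_eq (a c a' c' : fop B point) :
  (forall f, opS a (opT c f) = opT c' (opS a' f)) ->
  adj (inj a) * inj c = inj c' * adj (inj a').
Proof.
move=> h; rewrite -!fop_inj_adj.
exact: inj_mul_eq.
Qed.

Let psi_orth v (i j : 'I_(dim v)) : adj (inj (ogen i)) * inj (ogen j) = (i == j)%:R.
Proof.
have -> : (i == j)%:R = inj (fop_scale base (i == j)%:R (fop_one B base)).
  by rewrite fop_injZ fop_inj1 scaler_nat.
rewrite -fop_inj_adj -fop_injM.
by apply: fop_inj_eq; apply/funext => f; exact: ogen_orth.
Qed.

Let psi_sum v : \sum_(i < dim v) inj (ogen i) * adj (inj (ogen i)) = 1.
Proof.
rewrite -fop_inj1; under eq_bigr => i _ do rewrite -fop_inj_adj -fop_injM.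
by apply: fop_inj_sum => f; exact: ogen_sum.
Qed.

Let psi_rel : crossed_relations alpha iota psi.
Proof.
split=> [v|v w i j vw].
  split=> [|i j|i a]; first exact: psi_sum.
    exact: psi_orth.
  rewrite !iotaE; apply: inj_mul_eq => f; exact: ogen_cst.
split.
  by apply: inj_mul_eq => f; exact: ogen_comm.
by apply: inj_star_mul_eq => f; exact: ogen_star_comm.
Qed.

(** Terms are interpreted by operators before the completion, so that they can be applied to a
    vector. *)
Fixpoint oeval v (t : term R A 'I_(dim v)) : fop B point :=
  match t with
  | TCst a => ocst a
  | TGen i => ogen i
  | TAdd t1 t2 => fop_add base (oeval t1) (oeval t2)
  | TMul t1 t2 => fop_mul base (oeval t1) (oeval t2)
  | TScale c t1 => fop_scale base c (oeval t1)
  | TAdj t1 => fop_star base (oeval t1)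
  end.

Let oevalE v (t : term R A 'I_(dim v)) :
  teval iota (fun i => psi (Tagged _ i)) t = inj (oeval t).
Proof.
elim: t => /= [a|i|t1 -> t2 ->|t1 -> t2 ->|c t1 ->|t1 ->].
- exact: iotaE.
- by [].
- by rewrite -fop_injD.
- by rewrite -fop_injM.
- by rewrite -fop_injZ.
- by rewrite -fop_inj_adj.
Qed.

(** For [v] in [K] all these operators are diagonal and keep functions concentrated at [base], where
    [d] is the identity. The operator and its adjoint are followed together because [TAdj] exchanges
    them. *)
Let oeval_base v (t : term R A 'I_(dim v)) : K v -> forall z,
  opT (oeval t) (fdelta base z) =
    fdelta base (teval rho (fun i => phi (Tagged _ i)) t * z) /\
  opS (oeval t) (fdelta base z) =
    fdelta base (adj (teval rho (fun i => phi (Tagged _ i)) t) * z).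
Proof.
have deltaM (c : point -> B) z : (fun x => c x * fdelta base z x) =
    fdelta base (c base * z).
  by apply/funext => x; rewrite /fdelta; case: eqP => [->|_]; rewrite ?mulr0.
move=> Kv; elim: t => /= [a|i|t1 h1 t2 h2|t1 h1 t2 h2|c t1 h1|t1 h1] z.
- by rewrite !deltaM.
- by rewrite (ogenK i Kv).1 (ogenK i Kv).2 !deltaM.
- rewrite (h1 z).1 (h1 z).2 (h2 z).1 (h2 z).2 adjD !mulrDl.
  by split; apply/funext => x; rewrite !fctE /fdelta; case: eqP => // _; rewrite addr0.
- by rewrite (h2 z).1 (h1 _).1 (h1 z).2 (h2 _).2 adj_mul !mulrA.
- rewrite (h1 z).1 (h1 z).2 adjZ -!scalerAl.
  by split; apply/funext => x; rewrite !fctE /fdelta; case: eqP => // _; rewrite scaler0.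
- by rewrite adjK (h1 z).1 (h1 z).2.
Qed.

(** The last two clauses say that the model loses no norm of [B] on constants and on terms of [v] in
    [K]. They come from evaluation at [base] and yield the injectivity statements about universal
    algebras. *)
Lemma crossed_model : exists (E : cstarAlgType R) (iota : starHom A E)
  (psi : gen b -> E), [/\ crossed_relations alpha iota psi,
    forall a, nrm (rho a) <= nrm (iota a)
  & forall v (t : term R A 'I_(dim v)), K v ->
      nrm (teval rho (fun i => phi (Tagged _ i)) t) <=
      nrm (teval iota (fun i => psi (Tagged _ i)) t)].
Proof.
exists E, iota, psi; split=> [|a|v t Kv]; first exact: psi_rel.
  have : opT (ocst a) (fdelta base 1) = fdelta base (rho a).
    by apply/funext => x; rewrite /= /fdelta; case: eqP => [->|_];
      rewrite ?mulr0 ?mulr1.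
  by move=> /(fop_norm_ge (fop_completion B base)); rewrite nrm1 mulr1 iotaE.
have := (oeval_base t Kv 1).1; rewrite mulr1 => /(fop_norm_ge (fop_completion B base)).
by rewrite nrm1 mulr1 oevalE.
Qed.

End Model.

(** * Finite-dimensional Hilbert spaces and representations *)

Section Hermitian.
Variables (R : realType) (M : lmodType R[i]) (f : M -> M -> R[i]).
Hypothesis f_lin : forall y, scalar (f^~ y).
Hypothesis fC : forall x y, f x y = Num.conj (f y x).
Hypothesis f_gt0 : forall x, x != 0 -> 0 < f x x.

Let f0 y : f 0 y = 0.
Proof. by have := f_lin y (-1) 0 0; rewrite scaler0 addr0 mulN1r addNr. Qed.
Let fD x x' y : f (x + x') y = f x y + f x' y.
Proof. by have := f_lin y 1 x x'; rewrite scale1r mul1r. Qed.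
Let fZ a x y : f (a *: x) y = a * f x y.
Proof. by have := f_lin y a x 0; rewrite !addr0 f0 addr0. Qed.
Let fZr a x y : f x (a *: y) = Num.conj a * f x y.
Proof. by rewrite fC fZ rmorphM /= -fC. Qed.
Let fDr x y y' : f x (y + y') = f x y + f x y'.
Proof. by rewrite fC fD rmorphD /= -!fC. Qed.

Lemma form_ge0 x : 0 <= f x x.
Proof. by have [->|/f_gt0/ltW] := eqVneq x 0; rewrite ?f0. Qed.

Lemma form_cs x y : `|f x y| ^+ 2 <= f x x * f y y.
Proof.
have [->|y0] := eqVneq y 0.
  by rewrite (fC x 0) !f0 conjC0 normr0 expr0n mulr0.
have n0 := f_gt0 y0; set c := f x y; set n := f y y in n0 *.
have nr : Num.conj n = n by apply: conj_Creal; exact: gtr0_real.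
(* [n x - c y] is [n] times the component of [x] orthogonal to [y]. *)
have : 0 <= f (n *: x + (- c) *: y) (n *: x + (- c) *: y) by exact: form_ge0.
have -> : f (n *: x + (- c) *: y) (n *: x + (- c) *: y) =
    n * (f x x * n - c * Num.conj c).
  rewrite fD !fDr !fZ !fZr (fC y x) -/c -/n rmorphN /= nr; ring.
by rewrite pmulr_rge0 // subr_ge0 normCK.
Qed.

Definition form_norm x : R := Num.sqrt (complex.Re (f x x)).

Lemma form_normE x : (form_norm x ^+ 2)%:C%C = f x x.
Proof.
rewrite sqr_sqrtr; first by rewrite RRe_real // ger0_real // form_ge0.
by have := form_ge0 x; rewrite lecE => /andP[].
Qed.

Lemma form_norm_ge0 x : 0 <= form_norm x. Proof. exact: sqrtr_ge0. Qed.

Lemma form_norm_dot x y : nrm (f x y) <= form_norm x * form_norm y.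
Proof.
rewrite -ler_sqr ?nnegrE ?nrm_ge0 ?mulr_ge0 ?form_norm_ge0 //.
rewrite -lecR exprMn [leRHS]rmorphM /= !form_normE rmorphXn /= -nrmE.
exact: form_cs.
Qed.

Lemma form_normD x y : form_norm (x + y) <= form_norm x + form_norm y.
Proof.
rewrite -ler_sqr ?nnegrE ?addr_ge0 ?form_norm_ge0 //.
have -> : form_norm (x + y) ^+ 2 = nrm (f (x + y) (x + y)).
  by rewrite -form_normE nrm_scalar_real ger0_norm // sqr_ge0.
rewrite fD !fDr (le_trans (nrmD _ _)) // (le_trans (lerD (nrmD _ _) (nrmD _ _))) //.
have n2 z : nrm (f z z) = form_norm z ^+ 2.
  by rewrite -form_normE nrm_scalar_real ger0_norm // sqr_ge0.
rewrite !n2; have := form_norm_dot x y; have := form_norm_dot y x.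
set a := nrm (f x y); set a' := nrm (f y x); nra.
Qed.

Lemma form_normZ a x : form_norm (a *: x) = nrm a * form_norm x.
Proof.
apply/eqP; rewrite -(@eqrXn2 _ 2) ?mulr_ge0 ?nrm_ge0 ?form_norm_ge0 //; apply/eqP.
apply: complexI; rewrite exprMn [RHS]rmorphM /= !form_normE fZ fZr mulrA.
by rewrite -normCK rmorphXn /= -nrmE.
Qed.

Lemma form_norm0_eq0 x : form_norm x = 0 -> x = 0.
Proof.
move=> x0; apply/eqP; apply/negPn/negP => /f_gt0.
by rewrite -form_normE x0 expr0n ltxx.
Qed.

End Hermitian.

Section HilbertForm.
Variables (R : realType) (H : hilbertType R).
Implicit Types x y z : H.

Lemma hdotC x y : hdot x y = Num.conj (hdot y x).
Proof. by rewrite (hermC (hdot : {dot H for _})) /= expr0 mul1r. Qed.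

Lemma hdotPl y : scalar (fun x => hdot x y).
Proof. by move=> a x z; rewrite linearPl. Qed.

Lemma hdotDl x y z : hdot (x + y) z = hdot x z + hdot y z.
Proof. by have := hdotPl z 1 x y; rewrite scale1r mul1r. Qed.
Lemma hdot0l y : hdot 0 y = 0.
Proof. by have := hdotPl y (-1) 0 0; rewrite scaler0 addr0 mulN1r addNr. Qed.
Lemma hdotZl a x y : hdot (a *: x) y = a * hdot x y.
Proof. by have := hdotPl y a x 0; rewrite !addr0 hdot0l addr0. Qed.
Lemma hdotBl x y z : hdot (x - y) z = hdot x z - hdot y z.
Proof. by rewrite -scaleN1r hdotDl hdotZl mulN1r. Qed.
Lemma hdotDr x y z : hdot z (x + y) = hdot z x + hdot z y.
Proof. by rewrite hdotC hdotDl rmorphD /= -!hdotC. Qed.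
Lemma hdot0r y : hdot y 0 = 0.
Proof. by rewrite hdotC hdot0l conjC0. Qed.
Lemma hdotZr a x y : hdot y (a *: x) = Num.conj a * hdot y x.
Proof. by rewrite hdotC hdotZl rmorphM /= -hdotC. Qed.
Lemma hdot_suml (I : Type) (s : seq I) (P : pred I) (F : I -> H) y :
  hdot (\sum_(i <- s | P i) F i) y = \sum_(i <- s | P i) hdot (F i) y.
Proof. by apply: (big_morph (hdot^~ y)) => [u v|]; [exact: hdotDl|exact: hdot0l]. Qed.
Lemma hdot_sumr (I : Type) (s : seq I) (P : pred I) (F : I -> H) y :
  hdot y (\sum_(i <- s | P i) F i) = \sum_(i <- s | P i) hdot y (F i).
Proof. by apply: (big_morph (hdot y)) => [u v|]; [exact: hdotDr|exact: hdot0r]. Qed.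

Lemma hdot_gt0 x : x != 0 -> 0 < hdot x x.
Proof. by move=> x0; rewrite hdot_norm exprn_gt0 // normr_gt0. Qed.

Lemma nrm_hdot x y : nrm (hdot x y) <= nrm x * nrm y.
Proof.
have nE z : form_norm (@hdot R H) z = nrm z.
  apply/eqP; rewrite -(@eqrXn2 _ 2) ?nrm_ge0 ?form_norm_ge0 //; apply/eqP.
  apply: complexI; rewrite (form_normE hdotPl hdot_gt0).
  by rewrite rmorphXn /= -nrmE hdot_norm.
by rewrite -!nE; exact: (form_norm_dot hdotPl hdotC hdot_gt0).
Qed.

Lemma nrm_hdot_sq x : (nrm x ^+ 2)%:C%C = hdot x x.
Proof. by rewrite rmorphXn /= -nrmE hdot_norm. Qed.

End HilbertForm.

Lemma complex_complete (R : realType) (u : nat -> R[i]) :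
  (forall e : R, 0 < e -> exists N, forall m n, (N <= m)%N -> (N <= n)%N ->
    nrm (u m - u n) < e) ->
  exists x, forall e : R, 0 < e -> exists N, forall n, (N <= n)%N ->
    nrm (u n - x) < e.
Proof.
have ReIm (z : R[i]) : `|complex.Re z| <= nrm z /\ `|complex.Im z| <= nrm z.
  case: z => a c; rewrite /nrm normc_def /=; split; rewrite -sqrtr_sqr ler_sqrt;
    by rewrite ?addr_ge0 ?sqr_ge0 // ?lerDl ?lerDr sqr_ge0.
have nrm_ReIm (z : R[i]) : nrm z <= `|complex.Re z| + `|complex.Im z|.
  case: z => a c; rewrite /nrm normc_def /=.
  rewrite -ler_sqr ?nnegrE ?addr_ge0 ?sqrtr_ge0 // sqr_sqrtr ?addr_ge0 ?sqr_ge0 //.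
  rewrite sqrrD !real_normK ?num_real // -addrA lerD2l lerDr.
  by rewrite mulrn_wge0 // mulr_ge0.
have lim_real (v : nat -> R) : (forall e : R, 0 < e -> exists N, forall m n,
    (N <= m)%N -> (N <= n)%N -> `|v m - v n| < e) ->
    exists x, forall e : R, 0 < e -> exists N, forall n, (N <= n)%N -> `|v n - x| < e.
  move=> cv; have /cauchy_cvg/cvg_ex[x vx] : cauchy (v @ \oo).
    apply/cauchyP => e /cv[N HN]; exists (v N), N => // n Nn.
    by rewrite -ball_normE /=; exact: HN.
  exists x => e e0; move/cvgrPdist_lt : vx => /(_ e e0)[N _ HN].
  by exists N => n /HN; rewrite distrC.
move=> cu.
have [a ha] : exists a, forall e : R, 0 < e -> exists N, forall n, (N <= n)%N ->
    `|complex.Re (u n) - a| < e.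
  apply: lim_real => e /cu[N HN]; exists N => m n Nm Nn.
  by apply: le_lt_trans (HN m n Nm Nn); rewrite -raddfB; exact: (ReIm _).1.
have [c hc] : exists c, forall e : R, 0 < e -> exists N, forall n, (N <= n)%N ->
    `|complex.Im (u n) - c| < e.
  apply: lim_real => e /cu[N HN]; exists N => m n Nm Nn.
  by apply: le_lt_trans (HN m n Nm Nn); rewrite -raddfB; exact: (ReIm _).2.
exists (a +i* c)%C => e e0; have e2 : 0 < e / 2 by rewrite divr_gt0.
have [N HN] := ha _ e2; have [M HM] := hc _ e2; exists (maxn N M) => n.
rewrite geq_max => /andP[/HN h1 /HM h2]; apply: le_lt_trans (nrm_ReIm _) _.
by rewrite !raddfB /= (splitr e) ltrD.
Qed.

(** * Finite-dimensional Hilbert spaces of coordinates *)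

Definition l2 (R : realType) (J : finType) := {ffun J -> R[i]}.

Section L2.
Variables (R : realType) (J : finType).
Local Notation H := (l2 R J).

HB.instance Definition _ := GRing.Lmodule.on H.
Implicit Types x y : H.

Definition l2dot x y : R[i] := \sum_j x j * Num.conj (y j).

Lemma l2dot_lin y : scalar (l2dot^~ y).
Proof.
move=> a x z; rewrite /l2dot mulr_sumr -big_split /=; apply: eq_bigr => j _.
by rewrite !ffunE mulrDl mulrA.
Qed.

Lemma l2dotC x y : l2dot x y = Num.conj (l2dot y x).
Proof.
by rewrite rmorph_sum; apply: eq_bigr => j _; rewrite rmorphM /= conjCK mulrC.
Qed.

Lemma l2dot_gt0 x : x != 0 -> 0 < l2dot x x.
Proof.
move=> x0; have ge0 j : 0 <= x j * Num.conj (x j) by rewrite -normCK exprn_ge0.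
rewrite lt0r sumr_ge0 // andbT; apply: contra_neq x0 => s0.
apply/ffunP => j; rewrite !ffunE; apply/eqP.
have /(_ j isT)/eqP := psumr_eq0P (fun j _ => ge0 j) s0.
by rewrite mulf_eq0 conjC_eq0 orbb.
Qed.

Let nm := form_norm l2dot.

Let nmE x : (nm x ^+ 2)%:C%C = \sum_j (nrm (x j) ^+ 2)%:C%C.
Proof.
rewrite (form_normE l2dot_lin l2dot_gt0); apply: eq_bigr => j _.
by rewrite -normCK rmorphXn /= -nrmE.
Qed.

Let nm_sq x : nm x ^+ 2 = \sum_j nrm (x j) ^+ 2.
Proof. by apply: complexI; rewrite nmE rmorph_sum. Qed.

Lemma l2_coord_le x j : nrm (x j) <= nm x.
Proof.
rewrite -ler_sqr ?nnegrE ?nrm_ge0 ?form_norm_ge0 // nm_sq (bigD1 j) //=.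
by rewrite lerDl sumr_ge0 // => k _; rewrite sqr_ge0.
Qed.

Lemma l2_norm_le x : nm x <= \sum_j nrm (x j).
Proof.
have s0 : 0 <= \sum_j nrm (x j) by rewrite sumr_ge0 // => j _; exact: nrm_ge0.
rewrite -ler_sqr ?nnegrE ?form_norm_ge0 // nm_sq expr2 mulr_suml ler_sum // => j _.
rewrite expr2 ler_wpM2l ?nrm_ge0 // (bigD1 j) //= lerDl sumr_ge0 // => k _.
exact: nrm_ge0.
Qed.

Let l2_complete (u : nat -> H) :
  (forall e : R, 0 < e -> exists N, forall m n, (N <= m)%N -> (N <= n)%N ->
    nm (u m - u n) < e) ->
  exists x, forall e : R, 0 < e -> exists N, forall n, (N <= n)%N ->
    nm (u n - x) < e.
Proof.
move=> cu; have /choice[z hx] j : exists z : R[i], forall e : R, 0 < e ->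
    exists N, forall n, (N <= n)%N -> nrm (u n j - z) < e.
  apply: complex_complete => e /cu[N HN]; exists N => m n Nm Nn.
  apply: le_lt_trans (HN m n Nm Nn); apply: le_trans (l2_coord_le _ j).
  by rewrite !ffunE.
(* The successor avoids dividing by zero and makes the sum of [#|J|] copies of [d] strictly smaller
   than [e]. *)
exists [ffun j => z j] => e e0; pose d := e / #|J|.+1%:R.
have d0 : 0 < d by rewrite divr_gt0.
have /choice[N HN] j := hx j _ d0; exists (\max_j N j) => n Nn.
apply: le_lt_trans (l2_norm_le _) _.
apply: (@le_lt_trans _ _ (\sum_(j : J) d)).
  apply: ler_sum => j _; rewrite !ffunE; apply/ltW/HN.
  exact: leq_trans (leq_bigmax j) Nn.
rewrite sumr_const -mulr_natr /d mulrAC ltr_pdivrMr ?ltr0n // ltr_pM2l //.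
by rewrite ltr_nat.
Qed.

HB.instance Definition _ := @Lmodule_isBanach.Build R H nm
  (form_normD l2dot_lin l2dotC l2dot_gt0) (form_normZ l2dot_lin l2dotC l2dot_gt0)
  (form_norm0_eq0 l2dot_lin l2dot_gt0) l2_complete.

Let l2dot_bilinear :
  bilinear_for *%R (Num.conj \; *%R : R[i] -> R[i] -> R[i]) l2dot.
Proof.
split=> [y|x] a u v; first exact: l2dot_lin.
by rewrite l2dotC l2dot_lin rmorphD rmorphM /= -!l2dotC.
Qed.

HB.instance Definition _ := bilinear_isBilinear.Build R[i] H H R[i]
  *%R (Num.conj \; *%R) l2dot l2dot_bilinear.

Let l2dot_herm x y : l2dot x y = (-1) ^+ false * Num.conj (l2dot y x).
Proof. by rewrite expr0 mul1r l2dotC. Qed.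

HB.instance Definition _ :=
  isHermitianSesquilinear.Build R[i] H false Num.conj l2dot l2dot_herm.
HB.instance Definition _ := isDotProduct.Build R[i] H l2dot l2dot_gt0.

Let l2dot_norm x : l2dot x x = `|x| ^+ 2.
Proof.
by rewrite -(form_normE l2dot_lin l2dot_gt0) rmorphXn.
Qed.

HB.instance Definition _ :=
  @isHilbert.Build R H (l2dot : {dot H for @Num.conj R[i]}) l2dot_norm.

End L2.

(** * Continuity of scalar functions *)

Section ScalarContinuity.
Variables (R : realType) (G : topologicalType).
Implicit Types f h : G -> R[i].

Definition scont f := forall g0 (e : R), 0 < e ->
  \forall g \near g0, nrm (f g0 - f g) < e.

Lemma scont_cst c : scont (fun=> c).
Proof. by move=> g0 e e0; near=> g; rewrite subrr nrm0. Unshelve. all: by end_near. Qed.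

Lemma scontD f h : scont f -> scont h -> scont (fun g => f g + h g).
Proof.
move=> cf ch g0 e e0; have e2 : 0 < e / 2 by rewrite divr_gt0.
apply: filterS2 (cf g0 _ e2) (ch g0 _ e2) => g h1 h2.
by rewrite opprD addrACA (le_lt_trans (nrmD _ _)) // (splitr e) ltrD.
Qed.

Lemma scontM f h : scont f -> scont h -> scont (fun g => f g * h g).
Proof.
move=> cf ch g0 e e0; set K := nrm (f g0) + nrm (h g0) + 1.
have K0 : 0 < K by rewrite ltr_wpDl ?addr_ge0 ?nrm_ge0.
(* If both increments are below [d], that of the product is below [d (|f g0| + |h g0| + d)]; the
   minimum with 1 bounds this by [d K]. *)
pose d := Num.min 1 (e / K).
have d0 : 0 < d by rewrite lt_min ltr01 divr_gt0.
have dK : d * K <= e by rewrite -ler_pdivlMr // ge_min lexx orbT.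
have d1 : d <= 1 by rewrite ge_min lexx.
apply: filterS2 (cf g0 _ d0) (ch g0 _ d0) => g h1 h2.
rewrite -[_ - _](subrKA (f g0 * h g)) -mulrBr -mulrBl.
have nM (a c : R[i]) : nrm (a * c) = nrm a * nrm c.
  by apply: complexI; rewrite [RHS]rmorphM /= -!nrmE normrM.
rewrite (le_lt_trans (nrmD _ _)) // !nM.
have := nrm_sub (h g) (h g0); rewrite nrmBC => h3.
apply: lt_le_trans dK; rewrite /K.
have := nrm_ge0 (f g0); have := nrm_ge0 (h g); have := nrm_ge0 (h g0).
have := nrm_ge0 (f g0 - f g); nra.
Qed.

Lemma scont_sum (I : Type) (s : seq I) (F : I -> G -> R[i]) :
  (forall i, scont (F i)) -> scont (fun g => \sum_(i <- s) F i g).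
Proof.
move=> cF; elim: s => [|i s IHs].
  by under [X in scont X]eq_fun do rewrite big_nil; exact: scont_cst.
by under [X in scont X]eq_fun do rewrite big_cons; exact: scontD.
Qed.

End ScalarContinuity.

(** * Representations given by unitary matrices *)

Section MatrixRep.
Variables (R : realType) (G : topologicalGroupType) (J : finType).
Variable m : G -> J -> J -> R[i].

(** [m g j k] is the [k]-th coordinate of the image of the [j]-th basis vector. The matrices thus
    act on rows, which explains the order of the factors in the second clause. *)
Definition mrep := [/\ forall j k, m 1%g j k = (j == k)%:R,
  forall g h j k, m (g * h)%g j k = \sum_l m h j l * m g l k,
  forall g j j', \sum_k m g j k * Num.conj (m g j' k) = (j == j')%:R
  & forall j k, scont (fun g => m g j k)].

Hypothesis m_rep : mrep.

Definition mact g (x : l2 R J) : l2 R J := [ffun k => \sum_j x j * m g j k].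

Let mact_lin g : linear (mact g).
Proof.
move=> a x y; apply/ffunP => k; rewrite !ffunE scaler_sumr -big_split /=.
by apply: eq_bigr => j _; rewrite !ffunE mulrDl -scalerAl.
Qed.

HB.instance Definition _ g :=
  GRing.isLinear.Build R[i] (l2 R J) (l2 R J) _ (mact g) (mact_lin g).

Lemma sum_delta (F : J -> R[i]) k : \sum_j F j * (j == k)%:R = F k.
Proof.
by rewrite (bigD1 k) //= eqxx mulr1 big1 ?addr0 // => j /negbTE ->; rewrite mulr0.
Qed.

Let mact1 x : mact 1%g x = x.
Proof.
case: m_rep => h1 _ _ _; apply/ffunP => k; rewrite ffunE.
by under eq_bigr => j _ do rewrite h1; rewrite sum_delta.
Qed.

Let mactM g h x : mact (g * h)%g x = mact g (mact h x).
Proof.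
case: m_rep => _ hM _ _; apply/ffunP => k; rewrite !ffunE.
under eq_bigr => j _ do rewrite hM mulr_sumr.
rewrite exchange_big; apply: eq_bigr => l _; rewrite ffunE mulr_suml.
by apply: eq_bigr => j _; rewrite mulrA.
Qed.

Let mact_dot g x y : hdot (mact g x) (mact g y) = hdot x y.
Proof.
case: m_rep => _ _ hU _; rewrite -[LHS]/(l2dot _ _) -[RHS]/(l2dot _ _) /l2dot.
transitivity (\sum_j \sum_j' x j * Num.conj (y j') *
   \sum_k m g j k * Num.conj (m g j' k)).
  under eq_bigr => k _.
    rewrite !ffunE rmorph_sum big_distrlr /=.
    under eq_bigr => j _.
      under eq_bigr => j' _ do rewrite rmorphM /= mulrACA.
      over.
    over.
  rewrite exchange_big; apply: eq_bigr => j _; rewrite exchange_big.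
  by apply: eq_bigr => j' _; rewrite mulr_sumr.
apply: eq_bigr => j _; under eq_bigr => j' _ do rewrite hU eq_sym.
by rewrite (sum_delta (fun j' => x j * Num.conj (y j'))).
Qed.

Let mact_continuous x : continuous (mact^~ x).
Proof.
case: m_rep => _ _ _ hC g0 S /nbhs_nrm[e e0 xS].
pose d := e / #|J|.+1%:R; have d0 : 0 < d by rewrite divr_gt0.
have near_k : \forall g \near g0, forall k, nrm (mact g0 x k - mact g x k) < d.
  apply: filter_forall => k.
  have := @scont_sum _ _ _ (index_enum J) (fun j g => x j * m g j k) _ g0 d d0.
  under eq_near do rewrite !ffunE; apply=> j.
  by apply: scontM; [exact: scont_cst|exact: hC].
apply: filterS near_k => g hg; apply: xS.
apply: le_lt_trans (l2_norm_le _) _.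
apply: (@le_lt_trans _ _ (\sum_(j : J) d)).
  by apply: ler_sum => k _; rewrite !ffunE; apply/ltW; have := hg k; rewrite !ffunE.
rewrite sumr_const -mulr_natr /d mulrAC ltr_pdivrMr ?ltr0n // ltr_pM2l //.
by rewrite ltr_nat.
Qed.

Definition urep_of_mrep : urep R G :=
  @URep R G (l2 R J) (fun g => mact g : {linear l2 R J -> l2 R J})
    mact1 mactM mact_dot mact_continuous.

End MatrixRep.

(** * Orthonormal bases of subspaces *)

Section OrthonormalBasis.
Variables (R : realType) (H : hilbertType R).
Implicit Types (E : set H) (x y : H).

Definition onb (J : finType) E (u : J -> H) := [/\ forall j, E (u j),
  forall j k, hdot (u j) (u k) = (j == k)%:R
  & forall x, E x -> x = \sum_j hdot x (u j) *: u j].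

Lemma onb_parseval (J : finType) E (u : J -> H) x y : onb E u -> E x -> E y ->
  hdot x y = \sum_j hdot x (u j) * Num.conj (hdot y (u j)).
Proof.
move=> [_ _ tot] Ex Ey; rewrite {1}(tot y Ey) hdot_sumr.
by apply: eq_bigr => j _; rewrite hdotZr mulrC.
Qed.

(** By Parseval, the matrix of coordinates of [v] in the basis [u] times its conjugate transpose is
    the identity, so it has at most as many rows as columns. *)
Lemma onb_size (J K : finType) E (u : J -> H) (v : K -> H) : onb E u ->
  (forall k, E (v k)) -> (forall k l, hdot (v k) (v l) = (k == l)%:R) ->
  (#|K| <= #|J|)%N.
Proof.
move=> uE vE vv.
pose M := \matrix_(k < #|K|, j < #|J|) hdot (v (enum_val k)) (u (enum_val j)).
pose N := \matrix_(j < #|J|, k < #|K|)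
  Num.conj (hdot (v (enum_val k)) (u (enum_val j))).
apply: (@mulmx1_min _ _ _ M N); apply/matrixP => k l; rewrite !mxE.
under eq_bigr => j _ do rewrite !mxE.
have := onb_parseval uE (vE (enum_val k)) (vE (enum_val l)).
by rewrite vv (inj_eq enum_val_inj) (reindex _ (onW_bij _ (enum_val_bij J))) => ->.
Qed.

Definition subspace E := E 0 /\ forall (a : R[i]) x y, E x -> E y -> E (a *: x + y).

Lemma subspace_sum E (I : Type) (s : seq I) (F : I -> H) : subspace E ->
  (forall i, E (F i)) -> E (\sum_(i <- s) F i).
Proof.
move=> [E0 EP] EF; elim: s => [|i s IHs]; first by rewrite big_nil.
by rewrite big_cons -[F i]scale1r; exact: EP.
Qed.

Lemma subspaceZ E (a : R[i]) x : subspace E -> E x -> E (a *: x).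
Proof. by move=> [E0 EP] Ex; rewrite -[_ *: _]addr0; exact: EP. Qed.

(** One Gram-Schmidt step: the new vector is the normalized remainder of [x]. *)
Lemma orthonormal_extend E n (u : 'I_n -> H) x : subspace E ->
  (forall j, E (u j)) -> (forall j k, hdot (u j) (u k) = (j == k)%:R) ->
  E x -> x <> \sum_j hdot x (u j) *: u j ->
  exists v : 'I_n.+1 -> H, (forall j, E (v j)) /\
    forall j k, hdot (v j) (v k) = (j == k)%:R.
Proof.
move=> sE Eu uu Ex xu; have [E0 EP] := sE.
pose y := x - \sum_j hdot x (u j) *: u j.
have Ey : E y.
  rewrite /y addrC -scaleN1r; apply: EP => //; apply: subspace_sum => // j.
  exact: subspaceZ.
have y0 : y != 0 by rewrite subr_eq0; apply/eqP.
have yu k : hdot y (u k) = 0.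
  rewrite hdotBl hdot_suml (bigD1 k) //= hdotZl uu eqxx mulr1 big1 ?addr0 ?subrr //.
  by move=> j /negbTE jk; rewrite hdotZl uu jk mulr0.
have ny : nrm y != 0 by apply: contra_neq y0; exact: nrm0_eq0.
pose z := (nrm y)^-1%:C%C *: y.
have zz : hdot z z = 1.
  rewrite hdotZl hdotZr -nrm_hdot_sq conj_Creal ?complex_real // -!rmorphM /=.
  by have -> : (nrm y)^-1 * ((nrm y)^-1 * nrm y ^+ 2) = 1 by field.
have zu k : hdot z (u k) = 0 by rewrite hdotZl yu mulr0.
pose v (j : 'I_n.+1) := if unlift ord0 j is Some k then u k else z.
exists v; split=> [j|j k]; rewrite /v.
  by case: unliftP => // _; exact: subspaceZ.
case: (unliftP ord0 j) => [j'|] ->; case: (unliftP ord0 k) => [k'|] ->.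
- by rewrite uu (inj_eq lift_inj).
- by rewrite hdotC zu conjC0 eq_sym; have /negbTE -> := neq_lift ord0 j'.
- by rewrite zu; have /negbTE -> := neq_lift ord0 k'.
- by rewrite zz eqxx.
Qed.

(** Orthonormal families in [E] have at most [#|J|] members; one of maximal size is total, since
    otherwise it could be extended. *)
Lemma onb_exists (J : finType) (E0 E : set H) (u : J -> H) : onb E0 u ->
  subspace E -> E `<=` E0 -> exists n (v : 'I_n -> H), onb E v.
Proof.
move=> uE0 sE EE0.
pose P n := `[< exists v : 'I_n -> H, (forall j, E (v j)) /\
  forall j k, hdot (v j) (v k) = (j == k)%:R >].
have Pub n : P n -> (n <= #|J|)%N.
  move=> /asboolP[v [vE vv]]; rewrite -[n]card_ord.
  by apply: onb_size uE0 _ vv => j; exact: EE0.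
have P0 : exists n, P n by exists 0%N; apply/asboolP; exists (fun=> 0); split=> -[].
case: (ex_maxnP P0 Pub) => n /asboolP[v [vE vv]] max; exists n, v; split=> // x Ex.
apply: contrapT => xv; have := orthonormal_extend sE vE vv Ex xv.
by move=> /asboolP/max; rewrite ltnn.
Qed.

Lemma onb_full n (E F : set H) (v w : 'I_n -> H) : onb E v -> onb F w ->
  subspace E -> subspace F -> F `<=` E -> F = E.
Proof.
move=> vE wF sE sF FE; apply/seteqP; split=> // x Ex; have [wFi ww _] := wF.
suff -> : x = \sum_j hdot x (w j) *: w j.
  by apply: subspace_sum => // j; exact: subspaceZ.
apply: contrapT => xw; have [z [zE zz]] :=
  orthonormal_extend sE (fun j => FE _ (wFi j)) ww Ex xw.
by have := onb_size vE zE zz; rewrite !card_ord ltnn.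
Qed.

End OrthonormalBasis.

(** * Matrix representations on invariant subspaces *)

Section Representations.
Variables (R : realType) (G : topologicalGroupType).
Implicit Types (V W : urep R G).

Lemma closed_subspaceE (H : hilbertType R) (E : set H) :
  closed_subspace E -> subspace E.
Proof. by case. Qed.

Lemma mrep_of_onb V (E : set V) (J : finType) (u : J -> V) :
  (forall g x, E x -> E (urep_act V g x)) -> onb E u ->
  mrep (fun g j k => hdot (urep_act V g (u j)) (u k)).
Proof.
move=> Einv uE; have [Eu uu tot] := uE; split=> [j k|g h j k|g j j'|j k].
- by rewrite urep_act1 uu.
- rewrite urep_actM {1}(tot _ (Einv h _ (Eu j))) raddf_sum /= hdot_suml.
  by apply: eq_bigr => l _; rewrite linearZ /= hdotZl.
- rewrite -(onb_parseval uE); try exact: Einv.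
  by rewrite urep_dot uu.
- move=> g0 e e0; have [->|k0] := eqVneq (u k) 0.
    by apply: filterE => g; rewrite !hdot0r subrr nrm0.
  have nk : 0 < nrm (u k).
    by rewrite lt_neqAle nrm_ge0 andbT eq_sym; apply: contra_neq k0 => /nrm0_eq0.
  have nb : nbhs (urep_act V g0 (u j))
      [set y | nrm (urep_act V g0 (u j) - y) < e / nrm (u k)].
    by apply/nbhs_nrm; exists (e / nrm (u k)); rewrite // divr_gt0.
  have nb' : \forall g \near g0,
      nrm (urep_act V g0 (u j) - urep_act V g (u j)) < e / nrm (u k).
    exact: (@urep_continuous _ _ V (u j) g0 _ nb).
  apply: filterS nb' => g.
  rewrite ltr_pdivlMr //; apply: le_lt_trans.
  by rewrite -hdotBl; exact: nrm_hdot.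
Qed.

Definition coord_map (H : hilbertType R) (J : finType) (u : J -> H)
  (x : l2 R J) : H := \sum_j x j *: u j.

Lemma coord_map_linear (H : hilbertType R) (J : finType) (u : J -> H) :
  linear (coord_map u).
Proof.
move=> a x y; rewrite /coord_map scaler_sumr -big_split /=.
by apply: eq_bigr => j _; rewrite !ffunE scalerDl scalerA.
Qed.

HB.instance Definition _ (H : hilbertType R) (J : finType) (u : J -> H) :=
  GRing.isLinear.Build R[i] (l2 R J) H _ (coord_map u) (coord_map_linear u).

(** A subspace is only a set of vectors, while classes consist of representations; the coordinate
    representation is the member of the class to which [E] belongs. *)
Lemma equivalent_onb V (E : set V) (J : finType) (u : J -> V)
    (Einv : forall g x, E x -> E (urep_act V g x)) (uE : onb E u) :
  subspace E -> equivalent_to (urep_of_mrep (mrep_of_onb Einv uE)) E.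
Proof.
move=> sE; have [Eu uu tot] := uE; exists (coord_map u : {linear _ -> _}).
  split=> [x y|g x].
    rewrite /= /coord_map hdot_suml; apply: eq_bigr => j _.
    rewrite hdotZl hdot_sumr; congr (_ * _).
    under eq_bigr => k _ do rewrite hdotZr uu eq_sym.
    by rewrite (sum_delta (fun k => Num.conj (y k))).
  rewrite /= /coord_map linear_sum /=.
  under [RHS]eq_bigr => j _ do
    rewrite linearZ /= (tot _ (Einv g _ (Eu j))) scaler_sumr.
  rewrite exchange_big; apply: eq_bigr => k _ /=.
  rewrite ffunE scaler_suml; apply: eq_bigr => j _.
  by rewrite scalerA.
apply/seteqP; split=> [_ [x _ <-]|x Ex] /=.
  by apply: subspace_sum => // j; exact: subspaceZ.
exists [ffun j => hdot x (u j)] => //; rewrite /coord_map [RHS](tot x Ex).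
by apply: eq_bigr => j _; rewrite ffunE.
Qed.

End Representations.

(** * Isometric intertwiners and irreducible subspaces *)

Section Intertwiners.
Variables (R : realType) (G : topologicalGroupType).
Implicit Types (U V W : urep R G).

Lemma intertwiner_nrm W V (T : {linear W -> V}) x : intertwiner T ->
  nrm (T x) = nrm x.
Proof.
move=> [Tdot _]; apply/eqP; rewrite -(@eqrXn2 _ 2) ?nrm_ge0 //; apply/eqP.
by apply: complexI; rewrite !nrm_hdot_sq Tdot.
Qed.

Lemma intertwiner_inj W V (T : {linear W -> V}) : intertwiner T -> injective T.
Proof.
move=> hT x y xy; apply/subr0_eq/nrm0_eq0.
by rewrite -(intertwiner_nrm _ hT) linearB /= xy subrr nrm0.
Qed.

Lemma intertwiner_lift U W V (S : {linear U -> V}) (T : {linear W -> V}) :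
  intertwiner S -> intertwiner T -> range S `<=` range T ->
  exists2 L : {linear U -> W}, intertwiner L & forall x, T (L x) = S x.
Proof.
move=> hS hT ST; have Ti := intertwiner_inj hT.
have /choice[L LE] x : exists y, T y = S x.
  by have [y _ yx] := ST (S x) (imageT _ x); exists y.
have Llin : linear L.
  by move=> a x y; apply: Ti; rewrite LE !linearP /= !LE.
pose M : {linear U -> W} := HB.pack L (GRing.isLinear.Build R[i] U W _ L Llin).
exists M => //; split=> [x y|g x] /=.
  by rewrite -(hT.1 (L x)) !LE hS.1.
by apply: Ti; rewrite LE hS.2 hT.2 LE.
Qed.

Lemma intertwiner_id V : intertwiner (idfun : {linear V -> V}).
Proof. by []. Qed.

Lemma equivalent_sub W W' V (E : set V) :
  equivalent_to W E -> equivalent_to W' E -> equivalent_to W [set: W'].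
Proof.
move=> [S hS SE] [T hT TE]; have [|L hL LE] := intertwiner_lift hS hT.
  by rewrite SE TE.
exists L => //; apply/seteqP; split=> // y _.
have [x _ xy] : range S (T y) by rewrite SE -TE; exists y.
by exists x => //; apply: (intertwiner_inj hT); rewrite LE.
Qed.

Lemma equivalent_refl V : equivalent_to V [set: V].
Proof.
exists (idfun : {linear V -> V}); first exact: intertwiner_id.
by apply/seteqP; split=> // x _; exists x.
Qed.

Lemma equivalent_sym W V : equivalent_to W [set: V] -> equivalent_to V [set: W].
Proof. by move=> WV; apply: equivalent_sub WV; exact: equivalent_refl. Qed.

Lemma equivalent_trans U W V : equivalent_to U [set: W] ->
  equivalent_to W [set: V] -> equivalent_to U [set: V].
Proof. by move=> UW /equivalent_sym VW; exact: equivalent_sub UW VW. Qed.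

(** Representatives of the two classes are equivalent through [E], so the two predicates
    coincide. *)
Lemma of_class_unique V (E : set V) (D D' : dual R G) :
  of_class E D -> of_class E D' -> D = D'.
Proof.
case: D D' => [D [V0 V0irr DE]] [D' [V0' V0'irr D'E]] [W DW WE] [W' D'W' W'E].
rewrite /dual_pred /= in DW D'W'; apply/eq_exist.
rewrite DE in DW *; rewrite D'E in D'W' *.
have WW' : equivalent_to W [set: W'] := equivalent_sub WE W'E.
have VV' : equivalent_to V0 [set: V0'].
  apply: equivalent_trans (equivalent_sym DW) _.
  exact: equivalent_trans WW' D'W'.
apply/funext => U; apply/propext; split=> h; first exact: equivalent_trans h VV'.
exact: equivalent_trans h (equivalent_sym VV').
Qed.

(** The point is that the image is closed: [T] is isometric, so preimages of a convergent sequence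
    of images are Cauchy in the complete space [W]. *)
Lemma intertwiner_image_subrep W V (T : {linear W -> V}) (F : set W) :
  intertwiner T -> subrepresentation F -> subrepresentation (T @` F).
Proof.
move=> hT [[clF F0 FP] Finv]; split; last first.
  by move=> g _ [x Fx <-]; exists (urep_act W g x); [exact: Finv|rewrite hT.2].
split; last 2 first.
- by exists 0; rewrite ?linear0.
- move=> a _ _ [x Fx <-] [y Fy <-]; exists (a *: x + y); first exact: FP.
  by rewrite linearP.
apply/closed_nrm => y hy.
have /choice[x hx] n : exists x, F x /\ nrm (y - T x) < n.+1%:R^-1.
  have n0 : 0 < n.+1%:R^-1 :> R by rewrite invr_gt0.
  by have [_ [x Fx <-] xy] := hy _ n0; exists x.
have Tx : ncvg (fun n => T (x n)) y.
  move=> e /exists_inv_lt[N HN]; exists N => n /HN; apply: le_lt_trans.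
  by rewrite nrmBC ltW //; exact: (hx n).2.
have cx : ncauchy x.
  move=> e e0; have e2 : 0 < e / 2 by rewrite divr_gt0.
  have [N HN] := Tx _ e2; exists N => m n /HN hm /HN hn.
  rewrite -(intertwiner_nrm _ hT) linearB /=.
  rewrite (le_lt_trans (nrm_triangle y _ _)) // (splitr e) ltrD //.
  by rewrite nrmBC.
have [z xz] := ncauchy_cvg cx.
exists z; first by apply: closed_ncvg clF _ xz => n; exact: (hx n).1.
apply: ncvg_unique Tx => e /xz[N HN]; exists N => n /HN.
by rewrite -linearB /= (intertwiner_nrm _ hT).
Qed.

Lemma equivalent_irreducible W V (E : set V) :
  irreducible_subspace E -> equivalent_to W E -> irreducible W.
Proof.
move=> [sE E0 Emin] [T hT TE]; have Ti := intertwiner_inj hT.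
split.
- by split=> //; split=> //; exact: closedT.
- move=> W0; apply: E0; rewrite -TE; apply/seteqP; split=> [_ [x _ <-]|_ ->].
    by have -> : x = 0 :> W; [have : [set: W] x by []; rewrite W0|rewrite linear0].
  by exists 0; rewrite ?linear0.
- move=> F sF _; have FE : T @` F `<=` E by rewrite -TE => _ [x _ <-]; exists x.
  have [F0|FE'] := Emin _ (intertwiner_image_subrep hT sF) FE.
    left; apply/seteqP; split=> [x Fx|_ ->]; last by case: sF => -[].
    apply: Ti; rewrite linear0; have : (T @` F) (T x) by exists x.
    by rewrite F0.
  right; apply/seteqP; split=> // x _.
  have [y Fy yx] : (T @` F) (T x) by rewrite FE' -TE; exists x.
  by rewrite -(Ti _ _ yx).
Qed.

(** A nonzero subrepresentation of least dimension is irreducible: a nonzero subrepresentation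
    inside it has the same dimension and is equal to it by [onb_full]. *)
Lemma irreducible_exists V (J : finType) (u : J -> V) : onb [set: V] u ->
  nonzero V -> exists (E : set V) n (v : 'I_n -> V),
    irreducible_subspace E /\ onb E v.
Proof.
move=> uV [x x0]; have closedS (E : set V) : subrepresentation E -> subspace E.
  by move=> [] [].
pose P n := `[< exists (E : set V) (v : 'I_n -> V),
  [/\ subrepresentation E, E <> [set 0] & onb E v] >].
have exP : exists n, P n.
  have sT : subrepresentation [set: V].
    by split=> //; split=> //; exact: closedT.
  have [n [v vT]] := onb_exists uV (closedS _ sT) (@subsetT _ _).
  exists n; apply/asboolP; exists setT, v; split=> // V0.
  by move/eqP: x0; apply; have : [set: V] x by []; rewrite V0.
case: (ex_minnP exP) => n /asboolP[E [v [sE E0 vE]]] nmin.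
exists E, n, v; split=> //; split=> // F sF FE.
have [F0|F0] := pselect (F = [set 0]); [by left|right].
have [m [w wF]] := onb_exists vE (closedS _ sF) FE.
have nm : (n <= m)%N by apply: nmin; apply/asboolP; exists F, w.
have [wFi ww _] := wF; have := onb_size vE (fun j => FE _ (wFi j)) ww.
rewrite !card_ord => mn; have mnE : m = n by apply/eqP; rewrite eqn_leq mn nm.
subst m; exact: onb_full vE wF (closedS _ sE) (closedS _ sF) FE.
Qed.

Lemma onb_nonzero V (E : set V) (J : finType) (u : J -> V) (j : J) :
  onb E u -> nonzero V.
Proof.
move=> [_ uu _]; exists (u j); apply/eqP => u0; have := uu j j.
by rewrite u0 hdot0l eqxx => /esym/eqP; rewrite oner_eq0.
Qed.

End Intertwiners.

(** * Tensor products of two representations *)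

Section Tensor.
Variables (R : realType) (G : topologicalGroupType).
Implicit Types (V W : urep R G).

Lemma mrep_tensor (J K : finType) (m : G -> J -> J -> R[i])
    (p : G -> K -> K -> R[i]) : mrep m -> mrep p ->
  mrep (fun g (x y : J * K) => m g x.1 y.1 * p g x.2 y.2).
Proof.
move=> [m1 mM mU mC] [p1 pM pU pC].
split=> [[j k] [j' k']|g h [j k] [j' k']|g [j k] [j' k']|[j k] [j' k']] /=.
- by rewrite m1 p1 -natrM mulnb.
- rewrite mM pM big_distrlr pair_big /=.
  by apply: eq_bigr => -[l l'] _ /=; rewrite mulrACA.
- rewrite (_ : ((j, k) == (j', k'))%:R = (j == j')%:R * (k == k')%:R); last first.
    by rewrite -natrM mulnb.
  rewrite -(mU g) -(pU g) big_distrlr pair_big /=.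
  by apply: eq_bigr => -[l l'] _ /=; rewrite rmorphM /= mulrACA.
- exact: scontM.
Qed.

Lemma dfwith2 (V : 'I_2 -> urep R G) (a b : 'I_2) (x : V a) (y : V b) : a != b ->
  exists z : forall i, V i, z a = x /\ z b = y.
Proof.
move=> ab; exists (dfwith (dfwith (fun i => 0 : V i) a x) b y); split.
  by rewrite dfwithout 1?eq_sym // dfwithin.
by rewrite dfwithin.
Qed.

(** The positions [a] and [b] may come in either order while the coordinates stay indexed by
    [J * K]. One representation is therefore a tensor product for both orders, and no flip map is
    required. *)
Lemma is_tensor_mrep (V : 'I_2 -> urep R G) (a b : 'I_2) (J K : finType)
    (u : J -> V a) (w : K -> V b) (uV : onb [set: V a] u) (wV : onb [set: V b] w)
    (mu := mrep_of_onb (fun g x _ => I) uV) (mw := mrep_of_onb (fun g x _ => I) wV) :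
  a != b -> is_tensor V (urep_of_mrep (mrep_tensor mu mw)).
Proof.
move=> ab; have I2 i : i = a \/ i = b.
  by move: a b i ab {u w uV wV mu mw} => [[|[|//]] ?] [[|[|//]] ?] [[|[|//]] ?] // _;
    (by left; exact: val_inj) || (right; exact: val_inj).
pose tau (x : forall i, V i) : l2 R (J * K)%type :=
  [ffun p => hdot (x a) (u p.1) * hdot (x b) (w p.2)].
exists tau; split.
- move=> x i c y z; apply/ffunP => p; rewrite !ffunE.
  have [ia|ib] := I2 i.
    subst i; rewrite !dfwithin !dfwithout // hdotDl hdotZl mulrDl.
    by rewrite -mulrA.
  subst i; have ba : b != a by rewrite eq_sym.
  rewrite !dfwithin !dfwithout // hdotDl hdotZl mulrDr.
  by rewrite mulrCA.
- move=> x y; rewrite (bigD1 a) //= (bigD1 b) /= 1?eq_sym // big1 ?mulr1; last first.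
    by move=> i /andP[ia ib]; have [] := I2 i => e; rewrite e eqxx in ia ib.
  rewrite -[LHS]/(l2dot _ _) /l2dot (onb_parseval uV) // (onb_parseval wV) //.
  rewrite big_distrlr pair_big /=; apply: eq_bigr => -[j k] _.
  by rewrite !ffunE /= rmorphM /= mulrACA.
- move=> g x; apply/ffunP => -[j k]; rewrite !ffunE /=.
  have expand (W : urep R G) (L : finType) (v : L -> W) (vW : onb [set: W] v) y l :
      hdot (urep_act W g y) (v l) =
      \sum_l' hdot y (v l') * hdot (urep_act W g (v l')) (v l).
    have [_ _ tot] := vW; rewrite {1}(tot y I) raddf_sum /= hdot_suml.
    by apply: eq_bigr => l' _; rewrite linearZ /= hdotZl.
  rewrite (expand _ _ _ uV) (expand _ _ _ wV) big_distrlr pair_big /=.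
  by apply: eq_bigr => -[j' k'] _; rewrite !ffunE /= mulrACA.
- apply/seteqP; split=> // x _ S [[clS S0 SP] Stau].
  have [_ uu _] := uV; have [_ ww _] := wV.
  have -> : x = \sum_p x p *: [ffun q => (p == q)%:R] :> l2 R (J * K)%type.
    apply/ffunP => q; rewrite sum_ffunE.
    under eq_bigr => p _ do rewrite !ffunE.
    by rewrite -[LHS](sum_delta (fun p => x p)).
  apply: (@subspace_sum _ (urep_of_mrep (mrep_tensor mu mw)) S) => // p.
  apply: (@subspaceZ _ (urep_of_mrep (mrep_tensor mu mw)) S) => //.
  (* Each coordinate vector is the tensor of two basis vectors. *)
  apply: Stau; have [z [za zb]] := dfwith2 (u p.1) (w p.2) ab; exists z => //.
  apply/ffunP => q; rewrite !ffunE za zb uu ww -natrM mulnb.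
  by case: p q {za zb} => [? ?] [? ?].
Qed.

Lemma dual_prod_comm (D0 D1 : dual R G) W0 W1 (J0 J1 : finType) (u0 : J0 -> W0)
    (u1 : J1 -> W1) (j0 : J0) (j1 : J1) : D0 W0 -> D1 W1 ->
  onb [set: W0] u0 -> onb [set: W1] u1 ->
  exists D, dual_prod (dual_pair D0 D1) D /\ dual_prod (dual_pair D1 D0) D.
Proof.
move=> DW0 DW1 o0 o1.
pose m0 := mrep_of_onb (fun g x _ => I) o0.
pose m1 := mrep_of_onb (fun g x _ => I) o1.
pose T : urep R G := urep_of_mrep (mrep_tensor m0 m1).
pose e (p : J0 * J1) : T := [ffun q => (p == q)%:R : R[i]].
have eT : onb [set: T] e.
  have dot_e (x : l2 R (J0 * J1)%type) p : l2dot x (e p) = x p.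
    rewrite /l2dot; under eq_bigr => q _ do rewrite ffunE conjC_nat eq_sym.
    exact: sum_delta.
  split=> // [p q|x _].
    by rewrite -[LHS]/(l2dot _ _) dot_e ffunE.
  apply/ffunP => q; rewrite sum_ffunE.
  under eq_bigr => p _ do rewrite -[hdot _ _]/(l2dot _ _) dot_e !ffunE.
  by rewrite -[LHS](sum_delta (fun p => x p)).
(* The index [(j0, j1)] witnesses that the tensor product is nonzero. *)
have [E [n [v [Eirr vE]]]] := irreducible_exists eT (onb_nonzero (j0, j1) eT).
have [[sE Einv] _ _] := Eirr.
pose W := urep_of_mrep (mrep_of_onb Einv vE).
have WE : equivalent_to W E by apply: equivalent_onb; exact: closed_subspaceE.
pose D : dual R G := exist _ (urep_class W)
  (ex_intro2 _ _ W (equivalent_irreducible Eirr WE) erefl).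
have ED : of_class E D by exists W => //; exact: equivalent_refl.
exists D; split.
  exists (fun i : 'I_2 => if i == ord0 then W0 else W1), T, E; split=> //.
    by move=> i; rewrite /dual_pair; case: (i == ord0).
  exact: (@is_tensor_mrep (fun i : 'I_2 => if i == ord0 then W0 else W1)
    ord0 ord_max _ _ _ _ o0 o1).
exists (fun i : 'I_2 => if i == ord0 then W1 else W0), T, E; split=> //.
  by move=> i; rewrite /dual_pair; case: (i == ord0).
exact: (@is_tensor_mrep (fun i : 'I_2 => if i == ord0 then W1 else W0)
    ord_max ord0 _ _ _ _ o0 o1).
Qed.

End Tensor.

(** * Classes attached to an adapted basis *)

Section AdaptedBases.
Variables (R : realType) (G : topologicalGroupType).

Lemma ab_class_eq (V : urep R G) (c : adapted_basis V) i j :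
  ab_pos c i = ab_pos c j -> ab_class c i = ab_class c j.
Proof.
move=> ij; have hj := ab_classP j; rewrite -ij in hj.
exact: (of_class_unique (ab_classP i) hj).
Qed.

(** The finite orthonormal basis of [W] is pulled back along the equivalence from the adapted basis
    vectors placed in the subspace of [i]. It is total because the remaining basis vectors lie in
    other, orthogonal, subspaces. *)
Lemma ab_class_onb (V : urep R G) (c : adapted_basis V) i :
  exists (W : urep R G) (J : finType) (u : J -> W),
    [/\ ab_class c i W, inhabited J & onb [set: W] u].
Proof.
have [W DW [T hT TE]] := ab_classP i.
pose Q := [set k | ab_pos c k == ab_pos c i]%SET; pose J : finType := {k in Q}.
have /choice[u uE] (j : J) : exists w : W, T w = ab_vec c (val j).
  have : range T (ab_vec c (val j)).
    have := valP j; rewrite inE => /eqP jE.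
    by rewrite TE -jE; exact: ab_vec_sub.
  by case=> w _ wj; exists w.
exists W, J, u; split=> //; first by apply: inhabits; exists i; rewrite inE.
split=> // [j k|x _].
  by rewrite -hT.1 !uE ab_vec_orthonormal.
apply: (intertwiner_inj hT); rewrite linear_sum /= {1}(ab_vec_total c (T x)).
rewrite (bigID (mem Q)) /= [X in _ + X]big1 ?addr0.
  rewrite big_sub; apply: eq_bigr => j _.
  by rewrite linearZ /= -hT.1 !uE.
move=> k; rewrite inE => ki.
rewrite (@ab_sub_orth _ _ _ c (ab_pos c i) (ab_pos c k)) ?scale0r //.
- by rewrite eq_sym.
- by rewrite -TE; exists x.
- exact: ab_vec_sub.
Qed.

(** A common [D] in both products makes either composite equal to the automorphism of the chain
    class of [D]. *)
Lemma chain_action_comm (A : cstarAlgType R) (alpha : chain_group R G -> starAut A)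
    (V W : urep R G) (c : adapted_basis V) (d : adapted_basis W) i j x :
  chain_action alpha ->
  alpha (chain_of (ab_class c i)) (alpha (chain_of (ab_class d j)) x) =
  alpha (chain_of (ab_class d j)) (alpha (chain_of (ab_class c i)) x).
Proof.
move=> act; have [W0 [J0 [u0 [D0 [j0] o0]]]] := ab_class_onb i.
have [W1 [J1 [u1 [D1 [j1] o1]]]] := ab_class_onb j.
have [D [p01 p10]] := dual_prod_comm j0 j1 D0 D1 o0 o1.
rewrite -(act _ _ (chain_of D)); last by exists (ab_class c i), (ab_class d j), D.
by apply: act; exists (ab_class d j), (ab_class c i), D.
Qed.

End AdaptedBases.

(** * The crossed product *)

(** By extensionality the predicate [rel] is equal to satisfaction of equations, so universality
    transfers as it stands. *)
Lemma universal_of_equations (R : realType) (A : cstarAlgType R) (J : Type)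
    (rel : forall B : cstarAlgType R, starHom A B -> (J -> B) -> Prop)
    (E : term R A J -> term R A J -> Prop) (K : J -> R) :
  (forall B (rho : starHom A B) phi, rel B rho phi <-> satisfies E rho phi) ->
  (forall B (rho : starHom A B) phi, rel B rho phi -> forall j, nrm (phi j) <= K j) ->
  (exists B (rho : starHom A B) phi, rel B rho phi) ->
  exists (U : cstarAlgType R) (iota : starHom A U) (psi : J -> U),
    universal_cstar rel iota psi /\
    forall u (e : R), 0 < e -> exists t, nrm (u - teval iota psi t) < e.
Proof.
move=> relE; have -> : rel = (fun B => @satisfies R A J E B).
  apply: functional_extensionality_dep => B; apply/funext => rho.
  by apply/funext => phi; apply/propext.
exact: universal_exists.
Qed.

(** * The relations as equations between terms *)

Section CuntzEquations.
Variables (R : realType) (G : topologicalGroupType) (A : cstarAlgType R).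
Variable alpha : chain_group R G -> starAut A.

Fixpoint tmap (J J' : Type) (f : J -> J') (t : term R A J) : term R A J' :=
  match t with
  | TCst a => TCst a
  | TGen j => TGen (f j)
  | TAdd t1 t2 => TAdd (tmap f t1) (tmap f t2)
  | TMul t1 t2 => TMul (tmap f t1) (tmap f t2)
  | TScale c t1 => TScale c (tmap f t1)
  | TAdj t1 => TAdj (tmap f t1)
  end.

Lemma teval_tmap (J J' : Type) (f : J -> J') (B : cstarAlgType R) (rho : A -> B)
    (phi : J' -> B) t : teval rho phi (tmap f t) = teval rho (phi \o f) t.
Proof. by elim: t => //= [t1 -> t2 ->|t1 -> t2 ->|c t1 ->|t1 ->]. Qed.

Lemma starHom_teval (J : Type) (B B' : cstarAlgType R) (th : starHom B B')
    (rho : A -> B) (phi : J -> B) t :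
  th (teval rho phi t) = teval (th \o rho) (th \o phi) t.
Proof.
elim: t => //= [t1 <- t2 <-|t1 <- t2 <-|c t1 <-|t1 <-].
- exact: raddfD.
- exact: rmorphM.
- exact: linearZ.
- exact: starHom_adj.
Qed.

Lemma teval_eq (J : Type) (B : cstarAlgType R) (rho rho' : A -> B)
  (phi phi' : J -> B) t : rho =1 rho' -> phi =1 phi' ->
  teval rho phi t = teval rho' phi' t.
Proof. by move=> /funext -> /funext ->. Qed.

Definition tsum (J : Type) (s : seq (term R A J)) : term R A J :=
  foldr (@TAdd R A J) (TCst 0) s.

Lemma teval_tsum (J I : Type) (B : cstarAlgType R) (rho : starHom A B)
    (phi : J -> B) (s : seq I) (F : I -> term R A J) :
  teval rho phi (tsum [seq F i | i <- s]) = \sum_(i <- s) teval rho phi (F i).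
Proof.
by elim: s => [|i s IHs]; rewrite ?big_nil ?big_cons /= ?IHs ?raddf0.
Qed.

Inductive cuntz_eqs n (D : 'I_n -> dual R G) :
    term R A 'I_n -> term R A 'I_n -> Prop :=
| CuntzSum : cuntz_eqs D
    (tsum [seq TMul (TGen i) (TAdj (TGen i)) | i <- index_enum 'I_n]) (TCst 1)
| CuntzOrth i j : cuntz_eqs D
    (TMul (TAdj (TGen i)) (TGen j)) (TScale (i == j)%:R (TCst 1))
| CuntzTwist i a : cuntz_eqs D
    (TMul (TGen i) (TCst a)) (TMul (TCst (alpha (chain_of (D i)) a)) (TGen i)).

Lemma cuntz_eqsP n (D : 'I_n -> dual R G) (B : cstarAlgType R) (rho : starHom A B)
    (phi : 'I_n -> B) :
  cuntz_relations alpha D rho phi <-> satisfies (cuntz_eqs D) rho phi.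
Proof.
split=> [[h1 h2 h3] t t' []|h].
- by rewrite teval_tsum /= h1 rmorph1.
- by move=> i j /=; rewrite h2 rmorph1 scaler_nat.
- by move=> i a /=; rewrite h3.
split.
- by have := h _ _ (CuntzSum D); rewrite teval_tsum /= rmorph1.
- by move=> i j; have := h _ _ (CuntzOrth D i j); rewrite /= rmorph1 scaler_nat.
- by move=> i a; have := h _ _ (CuntzTwist D i a).
Qed.

Variables (GG : Type) (V : GG -> urep R G).
Variable b : forall v, adapted_basis (V v).
Local Notation gn v i :=
  (Tagged (fun v => 'I_(ab_dim (b v))) (i : 'I_(ab_dim (b v))) : gen b).

Inductive crossed_eqs : term R A (gen b) -> term R A (gen b) -> Prop :=
| CrossedCuntz v t t' : cuntz_eqs (ab_class (b v)) t t' ->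
    crossed_eqs (tmap (fun i => gn v i) t) (tmap (fun i => gn v i) t')
| CrossedComm v w (i : 'I_(ab_dim (b v))) (j : 'I_(ab_dim (b w))) : v <> w ->
    crossed_eqs (TMul (TGen (gn v i)) (TGen (gn w j)))
                (TMul (TGen (gn w j)) (TGen (gn v i)))
| CrossedStar v w (i : 'I_(ab_dim (b v))) (j : 'I_(ab_dim (b w))) : v <> w ->
    crossed_eqs (TMul (TAdj (TGen (gn v i))) (TGen (gn w j)))
                (TMul (TGen (gn w j)) (TAdj (TGen (gn v i)))).

Lemma crossed_eqsP (B : cstarAlgType R) (rho : starHom A B) (phi : gen b -> B) :
  crossed_relations alpha rho phi <-> satisfies crossed_eqs rho phi.
Proof.
split=> [[h1 h2] t t' []|h].
- move=> v s s' ss'; rewrite !teval_tmap.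
  by move/cuntz_eqsP: (h1 v); exact.
- by move=> v w i j vw; exact: (h2 v w i j vw).1.
- by move=> v w i j vw; exact: (h2 v w i j vw).2.
split=> [v|v w i j vw].
  apply/cuntz_eqsP => t t' /CrossedCuntz/h; rewrite !teval_tmap.
  exact.
by split; [exact: (h _ _ (CrossedComm i j vw))|exact: (h _ _ (CrossedStar i j vw))].
Qed.

End CuntzEquations.

Section UniversalActions.
Variables (R : realType) (A : cstarAlgType R) (J : Type).
Variable rel : forall B : cstarAlgType R, starHom A B -> (J -> B) -> Prop.
Variables (U : cstarAlgType R) (iota : starHom A U) (psi : J -> U).
Hypothesis univ : universal_cstar rel iota psi.
Variables (T : groupType) (phi : T -> J -> U).
Hypothesis phi_rel : forall t, rel iota (phi t).
Hypothesis phi1 : phi 1%g =1 psi.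
Hypothesis phiM : forall s t (th : starHom U U), (forall a, th (iota a) = iota a) ->
  (forall j, th (psi j) = phi s j) -> forall j, th (phi t j) = phi (s * t)%g j.

(** Universality provides an endomorphism for each [t]; the group law is checked on generators, and
    inverses come from it. [phiM] quantifies over every [th] extending [phi s] because [phi t j] may
    be a combination of generators, on which [th] has to be computed. *)
Lemma universal_action : exists2 act : T -> starAut U, is_action act &
  forall t, (forall j, act t (psi j) = phi t j) /\
            (forall a, act t (iota a) = iota a).
Proof.
case: univ => _ genU ext.
have /choice[th thE] t : exists th : starHom U U,
    (forall a, th (iota a) = iota a) /\ (forall j, th (psi j) = phi t j).
  by have [th thE _] := ext U iota (phi t) (phi_rel t); exists th.
have thM s t x : th (s * t)%g x = th s (th t x).
  have [h hE] := starHom_comp (th s) (th t); rewrite -hE.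
  apply: starHom_ext genU _ _ => _ [[a _ <-]|[j _ <-]]; rewrite hE.
    by rewrite !(thE _).1.
  by rewrite (thE (s * t)%g).2 (thE t).2 (phiM t (thE s).1 (thE s).2).
have th1 x : th 1%g x = x.
  have [h hE] := starHom_id U; rewrite -[RHS]hE.
  apply: starHom_ext genU _ _ => _ [[a _ <-]|[j _ <-]]; rewrite hE.
    by rewrite (thE _).1.
  by rewrite (thE _).2 phi1.
have th_bij t : bijective (th t).
  by exists (th (t^-1)%g) => x; rewrite -thM ?mulVg ?mulgV th1.
exists (fun t => StarAut (th_bij t)); first by split=> *; [exact: th1|exact: thM].
by move=> t; split=> *; [exact: (thE t).2|exact: (thE t).1].
Qed.

End UniversalActions.

Section Embedding.
Variables (R : realType) (G : topologicalGroupType) (V : urep R G).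
Variables (c : adapted_basis V) (U : cstarAlgType R) (psi : 'I_(ab_dim c) -> U).

Lemma embed_linear : linear (embed psi).
Proof.
move=> a x y; rewrite /embed scaler_sumr -big_split /=; apply: eq_bigr => i _.
by rewrite hdotPl scalerDl scalerA.
Qed.

Lemma embed_sum (I : Type) (s : seq I) (F : I -> R[i]) (f : I -> V) :
  embed psi (\sum_(i <- s) F i *: f i) = \sum_(i <- s) F i *: embed psi (f i).
Proof.
have e0 : embed psi 0 = 0.
  by rewrite /embed big1 // => i _; rewrite hdot0l scale0r.
elim: s => [|i s IHs]; first by rewrite !big_nil.
by rewrite !big_cons embed_linear IHs.
Qed.

Lemma embed_vec i : embed psi (ab_vec c i) = psi i.
Proof.
rewrite /embed (bigD1 i) //= ab_vec_orthonormal eqxx scale1r big1 ?addr0 // => j ji.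
by rewrite ab_vec_orthonormal eq_sym (negbTE ji) scale0r.
Qed.

Lemma adj_embed x : adj (embed psi x) =
  \sum_i Num.conj (hdot x (ab_vec c i)) *: adj (psi i).
Proof. by rewrite /embed adj_sum; apply: eq_bigr => i _; exact: adjZ. Qed.

Lemma comm_embed x (z : U) : (forall i, GRing.comm (psi i) z) ->
  GRing.comm (embed psi x) z.
Proof.
move=> h; rewrite /embed; apply: commr_sym; apply: commr_sum => i _.
by apply: comm_scale; exact: commr_sym.
Qed.

Lemma comm_adj_embed x (z : U) : (forall i, GRing.comm (adj (psi i)) z) ->
  GRing.comm (adj (embed psi x)) z.
Proof.
move=> h; rewrite adj_embed; apply: commr_sym; apply: commr_sum => i _.
by apply: comm_scale; exact: commr_sym.
Qed.

End Embedding.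

Section UnitaryRotation.
Variables (R : realType) (G : topologicalGroupType) (A : cstarAlgType R).
Variable alpha : chain_group R G -> starAut A.
Variables (V : urep R G) (c : adapted_basis V).
Variables (U : cstarAlgType R) (iota : starHom A U) (psi : 'I_(ab_dim c) -> U).
Hypothesis psi_rel : cuntz_relations alpha (ab_class c) iota psi.
Variable g : G.

Let rot i : V := urep_act V g (ab_vec c i).

Let hdot_rot i k : hdot (rot i) (ab_vec c k) =
  Num.conj (hdot (urep_act V (g^-1)%g (ab_vec c k)) (ab_vec c i)).
Proof.
by rewrite -hdotC -(urep_dot (g^-1)%g) -urep_actM mulVg urep_act1.
Qed.

Let parseval x y : hdot x y =
  \sum_i hdot x (ab_vec c i) * Num.conj (hdot y (ab_vec c i)).
Proof.
rewrite {1}(ab_vec_total c y) hdot_sumr; apply: eq_bigr => i _.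
by rewrite hdotZr mulrC.
Qed.

(* [V g] maps each irreducible subspace to itself, so only generators of one
   class are mixed. *)
Let rot_class i k : hdot (rot i) (ab_vec c k) != 0 -> ab_class c i = ab_class c k.
Proof.
move=> ik; apply: ab_class_eq; apply/eqP; apply: contraNT ik => ik; apply/eqP.
apply: (ab_sub_orth ik); last exact: ab_vec_sub.
have [[_ inv] _ _] := ab_sub_irr (a := c) (ab_pos c i).
by apply: inv; exact: ab_vec_sub.
Qed.

(** The coefficients form a unitary matrix: Parseval for [g] gives the second relation, and for the
    inverse of [g] the first. The third survives because nonzero coefficients only join generators
    with the same automorphism. *)
Lemma cuntz_rotation :
  cuntz_relations alpha (ab_class c) iota (fun i => embed psi (rot i)).
Proof.
have [h1 h2 h3] := psi_rel; split.
- under eq_bigr => i _.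
    rewrite adj_embed /embed big_distrlr /=.
    under eq_bigr => k _.
      under eq_bigr => l _ do rewrite -scalerAl -scalerAr scalerA.
      over.
    over.
  rewrite exchange_big -h1; apply: eq_bigr => k _; rewrite exchange_big /=.
  rewrite (bigD1 k) //= [X in _ + X]big1 ?addr0 => [|l lk].
    rewrite -scaler_suml.
    under eq_bigr => i _ do rewrite !hdot_rot conjCK mulrC.
    by rewrite -parseval urep_dot ab_vec_orthonormal eqxx scale1r.
  rewrite -scaler_suml.
  under eq_bigr => i _ do rewrite !hdot_rot conjCK mulrC.
  by rewrite -parseval urep_dot ab_vec_orthonormal (negbTE lk) scale0r.
- move=> i j; rewrite adj_embed /embed big_distrlr /=.
  transitivity (\sum_k (hdot (rot j) (ab_vec c k) *
      Num.conj (hdot (rot i) (ab_vec c k))) *: (1 : U)).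
    apply: eq_bigr => k _; rewrite (bigD1 k) //= [X in _ + X]big1 ?addr0 => [|l lk].
      by rewrite -scalerAl -scalerAr scalerA h2 eqxx mulrC.
    by rewrite -scalerAl -scalerAr scalerA h2 eq_sym (negbTE lk) scaler0.
  by rewrite -scaler_suml -parseval urep_dot ab_vec_orthonormal scaler_nat eq_sym.
- move=> i a; rewrite /embed mulr_suml mulr_sumr; apply: eq_bigr => k _.
  rewrite -scalerAl -scalerAr h3.
  have [->|/rot_class ->//] := eqVneq (hdot (rot i) (ab_vec c k)) 0.
  by rewrite !scale0r.
Qed.

End UnitaryRotation.

Lemma adapted_dim_gt0 (R : realType) (G : topologicalGroupType) (V : urep R G)
  (c : adapted_basis V) : nonzero V -> (0 < ab_dim c)%N.
Proof.
move=> [x x0]; rewrite lt0n; apply: contra_neq x0 => c0.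
rewrite (ab_vec_total c x) big1 // => i _.
by have := ltn_ord i; rewrite {2}c0.
Qed.

Section CrossedProduct.
Variables (R : realType) (G : topologicalGroupType) (A : cstarAlgType R).
Variable alpha : chain_group R G -> starAut A.
Hypothesis alpha_action : chain_action alpha.
Variables (GG : Type) (V : GG -> urep R G).
Hypothesis V_nonzero : forall v, nonzero (V v).
Variable b : forall v, adapted_basis (V v).
Local Notation gn v i :=
  (Tagged (fun v => 'I_(ab_dim (b v))) (i : 'I_(ab_dim (b v))) : gen b).

Lemma crossed_representation (B : cstarAlgType R) (rho : starHom A B)
    (K : GG -> Prop) (phi : gen b -> B) : (forall v w, K v -> K w -> v = w) ->
  (forall v, K v ->
    cuntz_relations alpha (ab_class (b v)) rho (fun i => phi (gn v i))) ->
  exists (E : cstarAlgType R) (iota : starHom A E)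
  (psi : gen b -> E), [/\ crossed_relations alpha iota psi,
    forall a, nrm (rho a) <= nrm (iota a)
  & forall v (t : term R A 'I_(ab_dim (b v))), K v ->
      nrm (teval rho (fun i => phi (gn v i)) t) <=
      nrm (teval iota (fun i => psi (gn v i)) t)].
Proof.
apply: crossed_model => [v|v w i j x]; first exact: adapted_dim_gt0.
exact: chain_action_comm.
Qed.

Lemma crossed_representation0 :
  exists (E : cstarAlgType R) (iota : starHom A E) (psi : gen b -> E),
    crossed_relations alpha iota psi /\ injective iota.
Proof.
have [h hE] := starHom_id A.
(* With [K] empty no relation is asked of the generators in [A], so they are set to 0; [rho] is the
   identity. *)
have [||E [iota [psi [rel hi _]]]] :=
  @crossed_representation A h (fun=> False) (fun=> 0) => //.
exists E, iota, psi; split=> // x y xy; apply/subr0_eq/nrm0_eq0/eqP.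
rewrite eq_le nrm_ge0 andbT; have := hi (x - y).
by rewrite hE raddfB /= xy subrr nrm0.
Qed.

Lemma cuntz_pimsner_exists v : exists (O : cstarAlgType R) (j : starHom A O)
  (chi : 'I_(ab_dim (b v)) -> O), is_cuntz_pimsner alpha j chi /\
    forall u (e : R), 0 < e -> exists t, nrm (u - teval j chi t) < e.
Proof.
apply: (universal_of_equations (E := cuntz_eqs alpha (ab_class (b v))) (K := fun=> 1)).
- by move=> B rho phi; exact: cuntz_eqsP.
- by move=> B rho phi [_ orth _] i; rewrite cuntz_nrm // orth eqxx.
(* Forgetting all generators but those of [v] gives a representation of the Cuntz relations. *)
- have [E [iota [psi [[rel _] _]]]] := crossed_representation0.
  by exists E, iota, (fun i => psi (gn v i)).
Qed.

Lemma crossed_product_exists : exists (U : cstarAlgType R) (iota : starHom A U)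
  (psi : gen b -> U), is_crossed_product alpha iota psi.
Proof.
have [|||U [iota [psi [univ _]]]] :=
  @universal_of_equations R A (gen b) (@crossed_relations R G A alpha GG V b)
    (crossed_eqs alpha (b := b)) (fun=> 1).
- by move=> B rho phi; exact: crossed_eqsP.
- by move=> B rho phi [h _] [v i]; have [_ orth _] := h v; rewrite cuntz_nrm // orth eqxx.
- have [E [iota [psi [rel _]]]] := crossed_representation0.
  by exists E, iota, psi.
by exists U, iota, psi.
Qed.

Variables (U : cstarAlgType R) (iota : starHom A U) (psi : gen b -> U).
Hypothesis U_univ : is_crossed_product alpha iota psi.

Let psi_rel : crossed_relations alpha iota psi.
Proof. by case: U_univ. Qed.

Lemma crossed_iota_inj : injective iota.
Proof.
have [E [iota' [psi' [rel inj]]]] := crossed_representation0.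
have [_ _ ext] := U_univ; have [th [thi _] _] := ext E iota' psi' rel.
by move=> x y xy; apply: inj; rewrite -!thi xy.
Qed.

(** The model built on [B = O] with [K = {v}] is reached from [O] through [kappa] and the universal
    map [th] of [U]. On terms this composite does not decrease norms, and by density nowhere on [O],
    so [kappa] is injective. *)
Lemma cuntz_pimsner_embeds v (O : cstarAlgType R) (j : starHom A O)
    (chi : 'I_(ab_dim (b v)) -> O) : is_cuntz_pimsner alpha j chi ->
  (forall u (e : R), 0 < e -> exists t, nrm (u - teval j chi t) < e) ->
  exists kappa : starHom O U, [/\ injective kappa,
    forall a, kappa (j a) = iota a & forall i, kappa (chi i) = psi (gn v i)].
Proof.
move=> [relO _ extO] dense.
have [kappa [ka kchi] _] := extO U iota (fun i => psi (gn v i)) (psi_rel.1 v).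
exists kappa; split=> //.
(* [chi] on the generators of [v], transported along the equality of indices, and the arbitrary
   value 0 on all others. *)
pose phi (k : gen b) : O :=
  if pselect (tag k = v) is left e
  then chi (ecast w 'I_(ab_dim (b w)) e (tagged k)) else 0.
have phiE i : phi (gn v i) = chi i.
  by rewrite /phi; case: pselect => // e; rewrite (Prop_irrelevance e erefl).
have [|w <-|E [iE [pE [relE _ leE]]]] :=
  @crossed_representation O j (fun w => v = w) phi.
- by move=> w w' <- <-.
- by rewrite (funext phiE).
have [_ _ ext] := U_univ; have [th [thi thp] _] := ext E iE pE relE.
have le_term t : nrm (teval j chi t) <= nrm (th (kappa (teval j chi t))).
  rewrite !starHom_teval; rewrite -(funext phiE).
  rewrite (teval_eq (rho' := iE) (phi' := fun i => pE (gn v i))).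
  - exact: leE.
  - by move=> a /=; rewrite ka thi.
  - by move=> i /=; rewrite phiE kchi thp.
have le z : nrm z <= nrm (th (kappa z)).
  apply/ler_addgt0Pr => e e0.
  have [t zt] := dense z _ (divr_gt0 e0 (ltr0n R 2)).
  have h1 := nrm_sub z (teval j chi t).
  have h2 := nrm_sub (th (kappa (teval j chi t))) (th (kappa z)).
  have h3 : nrm (th (kappa (teval j chi t)) - th (kappa z)) <= nrm (z - teval j chi t).
    rewrite [leRHS]nrmBC -!raddfB /=.
    exact: le_trans (starHom_nrm_le _ _) (starHom_nrm_le _ _).
  have := le_term t; lra.
move=> x y xy; apply/subr0_eq/nrm0_eq0/eqP; rewrite eq_le nrm_ge0 andbT.
by have := le (x - y); rewrite raddfB /= xy subrr raddf0 nrm0.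
Qed.

(** For one representation the relations are those of [cuntz_rotation]; between different ones
    commutation extends to linear combinations. The formula on basis vectors extends to [V v] by
    linearity of [embed]. *)
Lemma crossed_beta : exists2 beta : G -> starAut U, is_action beta &
  forall g, (forall v (x : V v), beta g (embed (fun i => psi (gn v i)) x) =
      embed (fun i => psi (gn v i)) (urep_act (V v) g x)) /\
    (forall a, beta g (iota a) = iota a).
Proof.
pose emb v (x : V v) : U := embed (b := b v) (fun i => psi (gn v i)) x.
pose phi (g : G) (k : gen b) : U :=
  emb (tag k) (urep_act (V (tag k)) g (ab_vec (b (tag k)) (tagged k))).
have phiE g v i : phi g (gn v i) = emb v (urep_act (V v) g (ab_vec (b v) i)) by [].
have embE g v (x : V v) :
    \sum_i hdot x (ab_vec (b v) i) *: phi g (gn v i) = emb v (urep_act (V v) g x).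
  rewrite {2}(ab_vec_total (b v) x) linear_sum /=.
  under [X in emb v X]eq_bigr do rewrite linearZ /=.
  by rewrite /emb embed_sum.
have [|||beta act betaE] := @universal_action R A (gen b) _ U iota psi U_univ G phi.
- move=> g; split=> [v|v w i j vw]; first exact: cuntz_rotation (psi_rel.1 v) g.
  rewrite !phiE; split.
    apply: comm_embed => k; apply/commr_sym; apply: comm_embed => l.
    by apply/commr_sym; exact: (psi_rel.2 v w k l vw).1.
  apply: comm_adj_embed => k; apply/commr_sym; apply: comm_embed => l.
  by apply/commr_sym; exact: (psi_rel.2 v w k l vw).2.
- by move=> [v i]; rewrite phiE urep_act1 /emb embed_vec.
- move=> s t th thi thp [v i]; rewrite !phiE {1}/emb /embed raddf_sum /=.
  under eq_bigr => k _ do rewrite linearZ /= thp.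
  by rewrite embE urep_actM.
exists beta => // g; split; last exact: (betaE g).2.
move=> v x; rewrite {1}/embed raddf_sum /=.
under eq_bigr => k _ do rewrite linearZ /= (betaE g).1.
exact: embE.
Qed.

(** The generators of one representation share a unimodular factor, which cancels against its
    conjugate in the first two relations and appears on both sides of the others. *)
Lemma crossed_delta : exists2 delta : torus R GG -> starAut U, is_action delta &
  forall z, (forall v i, delta z (psi (gn v i)) = z v *: psi (gn v i)) /\
    (forall a, delta z (iota a) = iota a).
Proof.
pose phi (z : torus R GG) (k : gen b) : U := z (tag k) *: psi k.
have zz (z : torus R GG) v : z v * Num.conj (z v) = 1.
  by rewrite -normCK torus_norm expr1n.
have [|||delta act deltaE] := @universal_action R A (gen b) _ U iota psi U_univ _ phi.
- move=> z; have [h1 h2] := psi_rel; split=> [v|v w i j vw]; rewrite /phi /=.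
    have [s o tw] := h1 v; split=> [|i j|i a].
    - rewrite -s; apply: eq_bigr => i _.
      by rewrite adjZ -scalerAl -scalerAr scalerA zz scale1r.
    - by rewrite adjZ -scalerAl -scalerAr scalerA mulrC zz scale1r.
    - by rewrite -scalerAl -scalerAr tw.
  have [c1 c2] := h2 v w i j vw; rewrite adjZ; split.
    by apply: comm_scale; apply/commr_sym; apply: comm_scale; exact/commr_sym.
  by apply: comm_scale; apply/commr_sym; apply: comm_scale; exact/commr_sym.
- by move=> k; rewrite /phi scale1r.
- by move=> s t th thi thp k; rewrite /phi linearZ /= thp scalerA mulrC.
exists delta => // z; split; last exact: (deltaE z).2.
by move=> v i; rewrite (deltaE z).1.
Qed.

End CrossedProduct.

(* The set of representations is given as an injective family [V] indexed by a
   type [GG], since the type of all representations lives in a universe too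
   large for the library's [set]. *)
Theorem theorem2 (R : realType) (G : topologicalGroupType)
  (G_compact : compact [set: G]) (G_hausdorff : hausdorff_space G)
  (A : cstarAlgType R)
  (alpha : chain_group R G -> starAut A) (alpha_action : chain_action alpha)
  (GG : Type) (V : GG -> urep R G) (V_inj : injective V)
  (V_fin : forall v, finite_dimensional (V v) /\ nonzero (V v))
  (b : forall v, adapted_basis (V v)) :
  exists (U : cstarAlgType R) (iota : starHom A U) (psi : gen b -> U),
  [/\ injective iota,
      is_crossed_product alpha iota psi,
      exists (O : GG -> cstarAlgType R)
             (j : forall v, starHom A (O v))
             (chi : forall v, 'I_(ab_dim (b v)) -> O v)
             (kappa : forall v, starHom (O v) U),
      [/\ forall v, is_cuntz_pimsner alpha (j v) (chi v),
          forall v, injective (kappa v),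
          (forall v a, kappa v (j v a) = iota a) /\
          (forall v i, kappa v (chi v i) = psi (Tagged _ i)),
          cstar_generated (range iota `|` \bigcup_v range (kappa v))
        & forall v w i k a a', v <> w ->
            kappa v (j v a * chi v i) * kappa w (j w a' * chi w k) =
              iota (a * alpha (chain_of (ab_class (b v) i)) a') *
              (kappa w (chi w k) * kappa v (chi v i)) /\
            kappa v (j v a * adj (chi v i)) *
              kappa w (j w (alpha (chain_of (ab_class (b v) i)) a') * chi w k) =
              iota (a * a') * (kappa w (chi w k) * kappa v (adj (chi v i)))],
      exists2 beta : G -> starAut U, is_action beta &
        forall g,
        (forall v (x : V v),
           beta g (embed (fun i => psi (Tagged _ i)) x) =
           embed (fun i => psi (Tagged _ i)) (urep_act (V v) g x)) /\
        (forall a, beta g (iota a) = iota a)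
    & exists2 delta : torus R GG -> starAut U, is_action delta &
        forall z,
        (forall v (i : 'I_(ab_dim (b v))),
           delta z (psi (Tagged _ i)) = z v *: psi (Tagged _ i)) /\
        (forall a, delta z (iota a) = iota a)].

Proof.
have V0 v : nonzero (V v) by case: (V_fin v).
have [U [iota [psi univ]]] := crossed_product_exists alpha_action V0 b.
have [[psi_cuntz psi_comm] genU ext] := univ.
exists U, iota, psi; split.
- exact: crossed_iota_inj univ.
- exact: univ.
(* The choices are made one after the other, uniformly in [v], because the type of each family
   depends on the families before it. *)
- have ex v := cid (cuntz_pimsner_exists alpha_action V0 b v).
  pose O v := sval (ex v); have exj v := cid (svalP (ex v)).
  pose j v : starHom A (O v) := sval (exj v); have exchi v := cid (svalP (exj v)).
  pose chi v : 'I_(ab_dim (b v)) -> O v := sval (exchi v).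
  have chiP v := svalP (exchi v).
  have exk v := cid (cuntz_pimsner_embeds alpha_action V0 univ (chiP v).1 (chiP v).2).
  pose kappa v : starHom (O v) U := sval (exk v).
  have kP v := svalP (exk v).
  have kj v a : kappa v (j v a) = iota a by case: (kP v).
  have kchi v i : kappa v (chi v i) = psi (Tagged _ i) by case: (kP v) => _ _; exact.
  have tw v i a : psi (Tagged _ i) * iota a =
      iota (alpha (chain_of (ab_class (b v) i)) a) * psi (Tagged _ i).
    by case: (psi_cuntz v).
  (* The adjoint of the twist relation: [adj (psi i)] absorbs the automorphism, which is why the
     second product formula carries it on the left-hand side. *)
  have tw_adj v i a : adj (psi (Tagged _ i)) *
      iota (alpha (chain_of (ab_class (b v) i)) a) = iota a * adj (psi (Tagged _ i)).
    apply: (can_inj (@adjK _ U)); rewrite !adj_mul !adjK -!starHom_adj.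
    by rewrite tw.
  exists O, j, chi, kappa; split.
  + by move=> v; exact: (chiP v).1.
  + by move=> v; case: (kP v).
  + by split.
  + apply/seteqP; split=> // x _ S [subS genS].
    have : [set: U] x by []; rewrite -genU; apply; split=> // y [[a _ <-]|[[v i] _ <-]].
      by apply: genS; left; exists a.
    by apply: genS; right; exists v => //; exists (chi v i); rewrite // kchi.
  + move=> v w i k a a' vw; rewrite !rmorphM /= !starHom_adj !kj !kchi; split.
      have [c _] := psi_comm v w i k vw.
      by rewrite -c -!mulrA; congr (_ * _); rewrite !mulrA tw.
    have [_ c] := psi_comm v w i k vw.
    by rewrite -c -!mulrA; congr (_ * _); rewrite !mulrA tw_adj.
- exact: crossed_beta univ.
- exact: crossed_delta univ.
Qed.
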